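(* Let $(\mathcal A,\mu,\phi,\psi)$ be a measured regular multiplier Hopf algebroid. Then the subspace $\hat A=A\cdot\phi\subseteq{}_\mu A^\vee_\mu$ is an idempotent, non-degenerate algebra, $A$ is an idempotent, non-degenerate and faithful $\hat A$-bimodule, and ${}_\mu A^\vee_\mu$ is a non-degenerate and faithful $\hat A$-bimodule, with respect to the products given by $$\omega\omega':=\omega\circ\rho(\omega')=\omega'\circ\lambda(\omega)\quad\text{for all }\omega,\omega'\in\hat A,$$ $$\omega*a=\rho(\omega)(a),\qquad a*\omega=\lambda(\omega)(a)\quad\text{for all }a\in A,\ \omega\in\hat A,$$ $$\omega\upsilon=\upsilon\circ\lambda(\omega),\qquad \upsilon\omega=\upsilon\circ\rho(\omega)\quad\text{for all }\upsilon\in{}_\mu A^\vee_\mu,\ \omega\in\hat A.$$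
   Context: Conventions. Algebras are over $\mathbb C$ and need not be unital; products $XY$ of subspaces denote linear spans. An algebra $A$ is non-degenerate if $aA\neq 0\neq Aa$ for $a\ne 0$ and idempotent if $AA=A$; $M(A)$ is its multiplier algebra. A left module $M$ over $D$ is idempotent if $DM=M$, non-degenerate if $Dm\ne0$ for $m\neq0$, faithful if $dM\neq0$ for $d\ne0$; similarly for right modules; a bimodule has one of these properties if it has it both as left and as right module. $A^\vee$ is the dual vector space; $(a\cdot\omega)(b)=\omega(ba)$, $(\omega\cdot a)(b)=\omega(ab)$. A functional $\omega$ on $D$ is faithful if $\omega(dD)\ne0\ne\omega(Dd)$ for all $d\neq 0$. Regular multiplier Hopf algebroids. Compatible left and right quantum graphs consist of a non-degenerate algebra $A$, commuting subalgebras $B,C\subseteq M(A)$ and anti-isomorphisms $S_B:B\to C$, $S_C:C\to B$ with $BA=AB=CA=AC=A$, such that (i) either every finite $F\subseteq A$ admits $e\in A$ with $ae=a$ for $a\in F$, or the left modules ${}_BA,{}_CA$ are flat; (ii) either every finite $F\subseteq A$ admits $e\in A$ with $ea=a$ for $a\in F$, or the right modules $A_B,A_C$ are flat. Quotients of $A\otimes A$ are defined by the relations (for $x\in B$, $y\in C$): $A\otimes_BA$: $ax\otimes b=a\otimes xb$; $A\otimes_CA$: $ay\otimes b=a\otimes yb$; $A\otimes^BA$: $xa\otimes b=a\otimes bx$; $A\otimes^CA$: $ya\otimes b=a\otimes by$; $A\otimes_lA$: $xa\otimes b=a\otimes S_B(x)b$; $A\otimes_rA$: $aS_C(y)\otimes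 b=a\otimes by$. A left comultiplication is a homomorphism $\Delta_B:A\to\mathrm{End}(A\otimes_lA)$ such that for each $a$ there are elements $\Delta_B(a)(1\otimes b)$, $\Delta_B(a)(b\otimes1)$ of $A\otimes_lA$ with $\Delta_B(a)(b\otimes c)=(\Delta_B(a)(1\otimes c))(b\otimes1)=(\Delta_B(a)(b\otimes1))(1\otimes c)$, and $\Delta_B(xyax'y')=(y\otimes x)\Delta_B(a)(y'\otimes x')$ for $x,x'\in B$, $y,y'\in C$, and $((\Delta_B\otimes\mathrm{id})(\Delta_B(b)(1\otimes c)))(a\otimes1\otimes1)=((\mathrm{id}\otimes\Delta_B)(\Delta_B(b)(a\otimes1)))(1\otimes1\otimes c)$. A right comultiplication is a homomorphism $\Delta_C:A\to\mathrm{End}(A\otimes_rA)^{op}$ (acting from the right) such that there are elements $(a\otimes1)\Delta_C(c),(1\otimes b)\Delta_C(c)\in A\otimes_rA$ with $(a\otimes b)\Delta_C(c)=(1\otimes b)((a\otimes1)\Delta_C(c))=(a\otimes1)((1\otimes b)\Delta_C(c))$, and $\Delta_C(xyax'y')=(y\otimes x)\Delta_C(a)(y'\otimes x')$, $(a\otimes1\otimes1)((\Delta_C\otimes\mathrm{id})((1\otimes c)\Delta_C(b)))=(1\otimes1\otimes c)((\mathrm{id}\otimes\Delta_C)((a\otimes1)\Delta_C(b)))$. These data form a multiplier bialgebroid $\mathcal A$ if also $((\Delta_B\otimes\mathrm{id})((1\otimes c)\Delta_C(b)))(a\otimes1\otimes1)=(1\otimes1\otimes c)((\mathrm{id}\otimes\Delta_C)(\Delta_B(b)(a\otimes1)))$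 and $(a\otimes1\otimes1)((\Delta_C\otimes\mathrm{id})(\Delta_B(b)(1\otimes c)))=((\mathrm{id}\otimes\Delta_B)((a\otimes1)\Delta_C(b)))(1\otimes1\otimes c)$. It is a regular multiplier Hopf algebroid if the canonical maps $T_\lambda:A\otimes^CA\to A\otimes_lA$, $a\otimes b\mapsto\Delta_B(b)(a\otimes1)$; $T_\rho:A\otimes_BA\to A\otimes_lA$, $a\otimes b\mapsto\Delta_B(a)(1\otimes b)$; ${}_\lambda T:A\otimes_CA\to A\otimes_rA$, $a\otimes b\mapsto(a\otimes1)\Delta_C(b)$; ${}_\rho T:A\otimes^BA\to A\otimes_rA$, $a\otimes b\mapsto(1\otimes b)\Delta_C(a)$ are bijective. It is flat if the modules ${}_BA,A_B,{}_CA,A_C$ are all flat. Sweedler notation: $\Delta_B(a)(1\otimes b)=\sum a_{(1)}\otimes a_{(2)}b$, $\Delta_B(b)(a\otimes 1)=\sum b_{(1)}a\otimes b_{(2)}$, $(a\otimes1)\Delta_C(b)=\sum ab_{(1)}\otimes b_{(2)}$, $(1\otimes b)\Delta_C(a)=\sum a_{(1)}\otimes ba_{(2)}$. There are then a unique left counit ${}_B\varepsilon:A\to B$ and right counit $\varepsilon_C:A\to C$ with ${}_B\varepsilon(xa)=x\,{}_B\varepsilon(a)$, ${}_B\varepsilon(S_B(x)a)={}_B\varepsilon(a)x$, $\sum S_B({}_B\varepsilon(a_{(1)}))a_{(2)}b=ab$, $\sum{}_B\varepsilon(b_{(2)})b_{(1)}a=ba$, ${}_B\varepsilon(ab)={}_B\varepsilon(a\,{}_B\varepsilon(b))={}_B\varepsilon(aS_B({}_B\varepsilon(b)))$,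 and $\varepsilon_C(ay)=\varepsilon_C(a)y$, $\varepsilon_C(aS_C(y))=y\varepsilon_C(a)$, $\sum ba_{(2)}\varepsilon_C(a_{(1)})=ba$, $\sum ab_{(1)}S_C(\varepsilon_C(b_{(2)}))=ab$, $\varepsilon_C(ab)=\varepsilon_C(\varepsilon_C(a)b)=\varepsilon_C(S_C(\varepsilon_C(a))b)$. Base weights and integrals. A base weight is a pair $\mu=(\mu_B,\mu_C)$ of faithful functionals on $B$ and $C$ with $\mu_B\circ S_C=\mu_C$, $\mu_C\circ S_B=\mu_B$, $\mu_B\circ{}_B\varepsilon=\mu_C\circ\varepsilon_C$. A functional $\omega\in A^\vee$ is adapted to $\mu$ if there are (unique) maps ${}_B\omega,\omega_B:A\to B$, ${}_C\omega,\omega_C:A\to C$ with $\omega(xa)=\mu_B(x\,{}_B\omega(a))$, $\omega(ax)=\mu_B(\omega_B(a)x)$, $\omega(ya)=\mu_C(y\,{}_C\omega(a))$, $\omega(ay)=\mu_C(\omega_C(a)y)$ for $x\in B,y\in C,a\in A$; ${}_\mu A^\vee_\mu$ is the space of adapted functionals. A left integral is an adapted $\phi$ with $\sum S_B^{-1}({}_C\phi(b_{(2)}))b_{(1)}a={}_C\phi(b)a$ for all $a,b$ (then ${}_C\phi=\phi_C$); a right integral is an adapted $\psi$ with $\sum S_B({}_B\psi(a_{(1)}))a_{(2)}b={}_B\psi(a)b$ for all $a,b$ (then ${}_B\psi=\psi_B$). $\phi$ is full if ${}_B\phi,\phi_B$ are surjective onto $B$; $\psi$ is full if ${}_C\psi,\psi_C$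 are surjective onto $C$. A measured regular multiplier Hopf algebroid $(\mathcal A,\mu,\phi,\psi)$ is a flat regular multiplier Hopf algebroid with base weight and full and faithful left and right integrals $\phi,\psi$. Then $\hat A:=A\cdot\phi=\phi\cdot A=A\cdot\psi=\psi\cdot A\subseteq{}_\mu A^\vee_\mu$. Convolution operators. For $\omega\in\hat A$, $\lambda(\omega),\rho(\omega):A\to A$ are given by $\lambda(\omega)(a)b=\sum S_B({}_B\omega(a_{(1)}))a_{(2)}b$, $b\lambda(\omega)(a)=\sum ba_{(2)}S_C^{-1}(\omega_B(a_{(1)}))$, $\rho(\omega)(a)b=\sum S_B^{-1}({}_C\omega(a_{(2)}))a_{(1)}b$, $b\rho(\omega)(a)=\sum ba_{(1)}S_C(\omega_C(a_{(2)}))$. *)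

(* Defs.v *)
From HB Require Import structures.
From mathcomp Require Import all_boot all_order all_algebra.
From mathcomp Require Import boolp classical_sets functions reals complex.

Set Implicit Arguments.
Unset Strict Implicit.
Unset Printing Implicit Defensive.

Import GRing.Theory.
Local Open Scope classical_set_scope.
Local Open Scope ring_scope.
Local Open Scope quotient_scope.

(* Subspaces are Prop-valued sets (mathcomp-analysis [set V]) of an lmodType,
   and non-unital algebras, modules over them, etc. are predicates on such
   sets: this treats uniformly a whole space ([setT]), subalgebras of
   multiplier algebras and spaces of functionals. *)
Section Subspaces.
Context (K : fieldType).

Definition subspace (V : lmodType K) (P : set V) : Prop :=
  P 0 /\ forall k u v, P u -> P v -> P (k *: u + v).

Definition linear_on (V W : lmodType K) (P : set V) (f : V -> W) : Prop :=
  forall k u v, P u -> P v -> f (k *: u + v) = k *: f u + f v.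

Definition bilinear_on (U V W : lmodType K) (P : set U) (Q : set V)
    (m : U -> V -> W) : Prop :=
  (forall v, Q v -> linear_on P (m^~ v)) /\ (forall u, P u -> linear_on Q (m u)).

(* The product of the subspaces P and Q under the pairing m: finite sums of
   products, which is the linear span of the products when P is a subspace. *)
Definition span_prod (U V W : lmodType K) (P : set U) (Q : set V)
    (m : U -> V -> W) : set W :=
  [set w | exists s : seq (U * V),
     (forall p, p \in s -> P p.1 /\ Q p.2) /\ w = \sum_(p <- s) m p.1 p.2].

End Subspaces.

Section Algebras.
Context (K : fieldType).

Record algebra_on (V : lmodType K) (P : set V) (m : V -> V -> V) : Prop := {
  alg_subspace : subspace P;
  alg_closed : forall u v, P u -> P v -> P (m u v);
  alg_bilinear : bilinear_on P P m;
  alg_assoc : forall u v w, P u -> P v -> P w -> m u (m v w) = m (m u v) w }.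

Definition idempotent_algebra (V : lmodType K) (P : set V) (m : V -> V -> V) :=
  span_prod P P m = P.

Definition nondegenerate_algebra (V : lmodType K) (P : set V)
    (m : V -> V -> V) : Prop :=
  forall a, P a -> a != 0 ->
    (exists2 b, P b & m a b != 0) /\ (exists2 b, P b & m b a != 0).

Definition faithful_functional (V : lmodType K) (P : set V) (m : V -> V -> V)
    (w : V -> K^o) : Prop :=
  forall d, P d -> d != 0 ->
    (exists2 e, P e & w (m d e) != 0) /\ (exists2 e, P e & w (m e d) != 0).

Record left_module_on (V M : lmodType K) (D : set V) (mD : V -> V -> V)
    (E : set M) (act : V -> M -> M) : Prop := {
  lmod_subspace : subspace E;
  lmod_closed : forall d m, D d -> E m -> E (act d m);
  lmod_bilinear : bilinear_on D E act;
  lmod_assoc : forall d d' m, D d -> D d' -> E m ->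
    act (mD d d') m = act d (act d' m) }.

Record right_module_on (V M : lmodType K) (D : set V) (mD : V -> V -> V)
    (E : set M) (act : M -> V -> M) : Prop := {
  rmod_subspace : subspace E;
  rmod_closed : forall m d, E m -> D d -> E (act m d);
  rmod_bilinear : bilinear_on E D act;
  rmod_assoc : forall m d d', E m -> D d -> D d' ->
    act m (mD d d') = act (act m d) d' }.

Record bimodule_on (V M : lmodType K) (D : set V) (mD : V -> V -> V)
    (E : set M) (actl : V -> M -> M) (actr : M -> V -> M) : Prop := {
  bimod_left : left_module_on D mD E actl;
  bimod_right : right_module_on D mD E actr;
  bimod_comm : forall d m e, D d -> E m -> D e ->
    actr (actl d m) e = actl d (actr m e) }.

Definition idempotent_bimodule (V M : lmodType K) (D : set V) (E : set M)
    (actl : V -> M -> M) (actr : M -> V -> M) : Prop :=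
  span_prod D E actl = E /\ span_prod E D actr = E.

Definition nondegenerate_bimodule (V M : lmodType K) (D : set V) (E : set M)
    (actl : V -> M -> M) (actr : M -> V -> M) : Prop :=
  forall m, E m -> m != 0 ->
    (exists2 d, D d & actl d m != 0) /\ (exists2 d, D d & actr m d != 0).

Definition faithful_bimodule (V M : lmodType K) (D : set V) (E : set M)
    (actl : V -> M -> M) (actr : M -> V -> M) : Prop :=
  forall d, D d -> d != 0 ->
    (exists2 m, E m & actl d m != 0) /\ (exists2 m, E m & actr m d != 0).

End Algebras.

(* [tens D f g] is the quotient of the tensor product of V and W over K by the
   span of the elements f x v (x) w - v (x) g x w, for x in D. Its elements are
   classes of finite formal sums of pairs, written as sequences. *)
Section BalancedTensor.
Context (K : fieldType) (V W : lmodType K) (X : Type) (D : set X).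
Context (f : X -> V -> V) (g : X -> W -> W).

Inductive tens_eq : seq (V * W) -> seq (V * W) -> Prop :=
| tens_refl s : tens_eq s s
| tens_sym s t : tens_eq s t -> tens_eq t s
| tens_trans s t u : tens_eq s t -> tens_eq t u -> tens_eq s u
| tens_cat s s' t t' : tens_eq s s' -> tens_eq t t' -> tens_eq (s ++ t) (s' ++ t')
| tens_comm s t : tens_eq (s ++ t) (t ++ s)
| tens_zero w : tens_eq [:: (0, w)] [::]
| tens_addl v v' w : tens_eq [:: (v + v', w)] [:: (v, w); (v', w)]
| tens_addr v w w' : tens_eq [:: (v, w + w')] [:: (v, w); (v, w')]
| tens_scale k v w : tens_eq [:: (k *: v, w)] [:: (v, k *: w)]
(* the factor k makes the relators closed under scaling for arbitrary f, g *)
| tens_bal k x v w : D x -> tens_eq [:: (k *: f x v, w)] [:: (k *: v, g x w)].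

Definition tens_eqb (s t : seq (V * W)) : bool := `[< tens_eq s t >].

Lemma tens_eqb_refl : reflexive tens_eqb.
Proof. by move=> s; apply/asboolP; exact: tens_refl. Qed.

Lemma tens_eqb_sym : symmetric tens_eqb.
Proof. by move=> s t; apply/asboolP/asboolP; exact: tens_sym. Qed.

Lemma tens_eqb_trans : transitive tens_eqb.
Proof.
by move=> t s u /asboolP st /asboolP tu; apply/asboolP; exact: tens_trans tu.
Qed.

Canonical tens_equiv := EquivRel tens_eqb tens_eqb_refl tens_eqb_sym tens_eqb_trans.

Definition tens : Type := {eq_quot tens_equiv}.
HB.instance Definition _ : EqQuotient _ tens_equiv tens := EqQuotient.on tens.
HB.instance Definition _ := Choice.on tens.

Lemma tensW (P : tens -> Prop) : (forall s, P (\pi_tens s)) -> forall t, P t.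
Proof. by move=> Ps t; rewrite -[t]reprK; exact: Ps. Qed.

Lemma tens_piE s t : (\pi_tens s = \pi_tens t) <-> tens_eq s t.
Proof.
split=> [/eqmodP/asboolP//|st]; apply/eqmodP; exact/asboolP.
Qed.

Lemma tens_reprE s : tens_eq (repr (\pi_tens s)) s.
Proof. by apply/tens_piE; rewrite reprK. Qed.

Definition smap (k : K) (s : seq (V * W)) := [seq (k *: p.1, p.2) | p <- s].

Lemma smap_eq k s t : tens_eq s t -> tens_eq (smap k s) (smap k t).
Proof.
elim=> {s t} [s|s t _|s t u _ + _|s s' t t' _ + _|s t|w|v v' w|v w w'|l v w|l x v w Dx].
- exact: tens_refl.
- exact: tens_sym.
- exact: tens_trans.
- by rewrite /smap !map_cat; exact: tens_cat.
- by rewrite /smap !map_cat; exact: tens_comm.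
- by rewrite /= scaler0; exact: tens_zero.
- by rewrite /= scalerDr; exact: tens_addl.
- exact: tens_addr.
- by rewrite /= scalerA mulrC -scalerA; exact: tens_scale.
- by rewrite /= !scalerA; exact: tens_bal.
Qed.

Definition tens0 : tens := \pi_tens [::].
Definition tensD (s t : tens) : tens := \pi_tens (repr s ++ repr t).
Definition tensN (s : tens) : tens := \pi_tens (smap (-1) (repr s)).
Definition tensZ (k : K) (s : tens) : tens := \pi_tens (smap k (repr s)).

Lemma pi_tensD s t : tensD (\pi_tens s) (\pi_tens t) = \pi_tens (s ++ t).
Proof. by apply/tens_piE; apply: tens_cat; exact: tens_reprE. Qed.

Lemma pi_tensZ k s : tensZ k (\pi_tens s) = \pi_tens (smap k s).
Proof. by apply/tens_piE; apply: smap_eq; exact: tens_reprE. Qed.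

Lemma pi_tensN s : tensN (\pi_tens s) = \pi_tens (smap (-1) s).
Proof. exact: pi_tensZ. Qed.

Lemma tensDA : associative tensD.
Proof. by move=> x y z; elim/tensW: x => s; elim/tensW: y => t; elim/tensW: z => u; rewrite !pi_tensD catA. Qed.

Lemma tensDC : commutative tensD.
Proof.
move=> x y; elim/tensW: x => s; elim/tensW: y => t.
rewrite !pi_tensD; apply/tens_piE; exact: tens_comm.
Qed.

Lemma tens0D : left_id tens0 tensD.
Proof. by move=> x; elim/tensW: x => s; rewrite pi_tensD. Qed.

Lemma smapDl k l s : tens_eq (smap (k + l) s) (smap k s ++ smap l s).
Proof.
elim: s => [|[v w] s IHs]; first exact: tens_refl.
apply: tens_trans (_ : tens_eq ([:: (k *: v, w); (l *: v, w)] ++ (smap k s ++ smap l s)) _).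
  by rewrite [smap _ _]/= -cat1s; apply: tens_cat => //; rewrite scalerDl; exact: tens_addl.
rewrite /= -cat1s -[in X in tens_eq _ X]cat1s; apply: tens_cat; first exact: tens_refl.
rewrite -[(_, _) :: smap l s]cat1s -cat1s !catA.
apply: tens_cat; [exact: tens_comm | exact: tens_refl].
Qed.

Lemma smap0 s : tens_eq (smap 0 s) [::].
Proof.
elim: s => [|[v w] s IHs]; first exact: tens_refl.
rewrite /= scale0r -cat1s -[X in tens_eq _ X]cat0s; apply: tens_cat => //.
exact: tens_zero.
Qed.

Lemma smap1 s : smap 1 s = s.
Proof. by rewrite -[RHS]map_id; apply: eq_map => -[v w] /=; rewrite scale1r. Qed.

Lemma tensND : left_inverse tens0 tensN tensD.
Proof.
move=> x; elim/tensW: x => s; rewrite pi_tensN pi_tensD -[X in _ ++ X]smap1; apply/tens_piE.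
apply: tens_trans (smap0 s); apply: tens_sym.
by rewrite -[0](addNr 1); exact: smapDl.
Qed.

HB.instance Definition _ := GRing.isZmodule.Build tens tensDA tensDC tens0D tensND.

Lemma tensZA k l s : tensZ k (tensZ l s) = tensZ (k * l) s.
Proof.
elim/tensW: s => s; rewrite !pi_tensZ /smap -map_comp; congr (\pi_tens _).
by apply: eq_map => p /=; rewrite scalerA.
Qed.

Lemma tens1Z : left_id 1 tensZ.
Proof. by move=> x; elim/tensW: x => s; rewrite pi_tensZ smap1. Qed.

Lemma tensZDr : right_distributive tensZ +%R.
Proof.
move=> k x y; elim/tensW: x => s; elim/tensW: y => t.
by rewrite [_ + _]pi_tensD !pi_tensZ [RHS]pi_tensD /smap map_cat.
Qed.

Lemma tensZDl s : {morph tensZ^~ s : k l / k + l}.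
Proof.
move=> k l; elim/tensW: s => s; rewrite !pi_tensZ [RHS]pi_tensD.
apply/tens_piE; exact: smapDl.
Qed.

HB.instance Definition _ :=
  GRing.Zmodule_isLmodule.Build K tens tensZA tens1Z tensZDr tensZDl.

Definition otimes (v : V) (w : W) : tens := \pi_tens [:: (v, w)].

(* The map induced by h : v (x) w |-> h v w. It is computed on a representative
   so as to be total; it is the induced linear map as soon as h is bilinear and
   balanced ([tlift_otimes], [tlift_linear]), and is only used for such h. *)
Definition tlift (U : lmodType K) (h : V -> W -> U) (t : tens) : U :=
  \sum_(p <- repr t) h p.1 p.2.

Section Lift.
Context (U : lmodType K) (h : V -> W -> U).
Hypothesis hl : forall w, linear (h^~ w).
Hypothesis hr : forall v, linear (h v).
Hypothesis hbal : forall x v w, D x -> h (f x v) w = h v (g x w).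

Let hZl k v w : h (k *: v) w = k *: h v w.
Proof.
have h0 : h 0 w = 0 by have := hl w (-1) 0 0; rewrite scaler0 addr0 scaleN1r addNr.
by have := hl w k v 0; rewrite addr0 h0 addr0.
Qed.

Let hZr k v w : h v (k *: w) = k *: h v w.
Proof.
have h0 : h v 0 = 0 by have := hr v (-1) 0 0; rewrite scaler0 addr0 scaleN1r addNr.
by have := hr v k w 0; rewrite addr0 h0 addr0.
Qed.

Lemma tlift_eq s t : tens_eq s t ->
  \sum_(p <- s) h p.1 p.2 = \sum_(p <- t) h p.1 p.2.
Proof.
elim=> {s t} [s|s t _|s t u _ + _|s s' t t' _ + _|s t|w|v v' w|v w w'|l v w|l x v w Dx] //.
- by move=> -> ->.
- by move=> Es Et; rewrite !big_cat /= Es Et.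
- by rewrite !big_cat /= addrC.
- by rewrite big_seq1 big_nil /= -(scale0r 0) hZl scale0r.
- rewrite big_seq1 big_cons big_seq1 /=.
  by have := hl w 1 v v'; rewrite !scale1r.
- rewrite big_seq1 big_cons big_seq1 /=.
  by have := hr v 1 w w'; rewrite !scale1r.
- by rewrite !big_seq1 /= hZl hZr.
- by rewrite !big_seq1 /= !hZl hbal.
Qed.

Lemma tlift_otimes v w : tlift h (otimes v w) = h v w.
Proof. by rewrite /tlift (tlift_eq (tens_reprE _)) big_seq1. Qed.

Lemma tlift_linear : linear (tlift h).
Proof.
move=> k x y; elim/tensW: x => s; elim/tensW: y => t.
rewrite [_ *: _]pi_tensZ [_ + _]pi_tensD /tlift !(tlift_eq (tens_reprE _)).
rewrite big_cat big_map /= scaler_sumr; congr (_ + _).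
by apply: eq_bigr => p _; rewrite hZl.
Qed.

End Lift.
End BalancedTensor.

Arguments tens {K V W X} D f g.
Arguments otimes {K V W X D f g} v w.
Arguments tlift {K V W X D f g U} h t.

Definition tmap (K : fieldType) (V W V' W' : lmodType K) (X X' : Type)
    (D : set X) (f : X -> V -> V) (g : X -> W -> W)
    (D' : set X') (f' : X' -> V' -> V') (g' : X' -> W' -> W')
    (h : V -> V') (k : W -> W') : tens D f g -> tens D' f' g' :=
  tlift (fun v w => otimes (h v) (k w)).

Arguments tmap {K V W V' W' X X' D f g D' f' g'} h k t.

(* Flatness over a non-unital algebra D: tensoring over D preserves injectivity
   of D-linear maps between arbitrary (not necessarily idempotent) modules. *)
Section Flatness.
Context (K : fieldType) (V M : lmodType K) (D : set V) (mD : V -> V -> V).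

Definition flat_left (act : V -> M -> M) : Prop :=
  forall (N N' : lmodType K) (aN : N -> V -> N) (aN' : N' -> V -> N')
    (h : N -> N'),
  right_module_on D mD setT aN -> right_module_on D mD setT aN' ->
  linear h -> (forall n d, D d -> h (aN n d) = aN' (h n) d) -> injective h ->
  injective (tmap h id : tens D (fun d n => aN n d) act ->
                         tens D (fun d n => aN' n d) act).

Definition flat_right (act : M -> V -> M) : Prop :=
  forall (N N' : lmodType K) (aN : V -> N -> N) (aN' : V -> N' -> N')
    (h : N -> N'),
  left_module_on D mD setT aN -> left_module_on D mD setT aN' ->
  linear h -> (forall d n, D d -> h (aN d n) = aN' d (h n)) -> injective h ->
  injective (tmap id h : tens D (fun d m => act m d) aN ->
                         tens D (fun d m => act m d) aN').

End Flatness.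

(* A multiplier T is the pair of maps (a |-> T a, a |-> a T). *)
Section Multipliers.
Context (K : fieldType) (A : lmodType K) (mul : A -> A -> A).

Definition dcent : lmodType K := ((A -> A) * (A -> A))%type.

Definition multiplier : set dcent :=
  [set T | [/\ linear T.1 /\ linear T.2,
     forall a b, T.1 (mul a b) = mul (T.1 a) b,
     forall a b, T.2 (mul a b) = mul a (T.2 b) &
     forall a b, mul (T.2 a) b = mul a (T.1 b)]].

Definition mulM (S T : dcent) : dcent := (S.1 \o T.1, T.2 \o S.2).

End Multipliers.

Arguments dcent {K} A.

Notation "x *> a" := (x.1 a) (at level 40, left associativity, only parsing).
Notation "a <* x" := (x.2 a) (at level 40, left associativity, only parsing).

Definition anti_isomorphism (K : fieldType) (V : lmodType K) (m : V -> V -> V)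
    (P Q : set V) (S : V -> V) : Prop :=
  [/\ set_bij P Q S, linear_on P S &
      forall x x', P x -> P x' -> S (m x x') = m (S x') (S x)].

(* The inverse Q -> P of a bijection S : P -> Q between subsets. *)
Definition inv_on (T : choiceType) (x0 : T) (P : set T) (S : T -> T) (y : T) : T :=
  xget x0 [set x | P x /\ S x = y].

Record quantum_graph (K : fieldType) := QuantumGraph {
  qg_A :> lmodType K;
  mul : qg_A -> qg_A -> qg_A;
  qg_B : set (dcent qg_A);
  qg_C : set (dcent qg_A);
  S_B : dcent qg_A -> dcent qg_A;
  S_C : dcent qg_A -> dcent qg_A;
  qg_alg : algebra_on setT mul;
  qg_nondeg : nondegenerate_algebra setT mul;
  qg_subB : qg_B `<=` multiplier mul;
  qg_subC : qg_C `<=` multiplier mul;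
  qg_algB : algebra_on qg_B (@mulM K qg_A);
  qg_algC : algebra_on qg_C (@mulM K qg_A);
  qg_commBC : forall x y, qg_B x -> qg_C y -> mulM x y = mulM y x;
  qg_SB : anti_isomorphism (@mulM K qg_A) qg_B qg_C S_B;
  qg_SC : anti_isomorphism (@mulM K qg_A) qg_C qg_B S_C;
  qg_BA : span_prod qg_B setT (fun x (a : qg_A) => x *> a) = setT;
  qg_AB : span_prod setT qg_B (fun (a : qg_A) x => a <* x) = setT;
  qg_CA : span_prod qg_C setT (fun y (a : qg_A) => y *> a) = setT;
  qg_AC : span_prod setT qg_C (fun (a : qg_A) y => a <* y) = setT;
  qg_left :
    (forall F : seq qg_A, exists e, forall a, a \in F -> mul a e = a) \/
    (flat_left qg_B (@mulM K qg_A) (fun x (a : qg_A) => x *> a) /\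
     flat_left qg_C (@mulM K qg_A) (fun y (a : qg_A) => y *> a));
  qg_right :
    (forall F : seq qg_A, exists e, forall a, a \in F -> mul e a = a) \/
    (flat_right qg_B (@mulM K qg_A) (fun (a : qg_A) x => a <* x) /\
     flat_right qg_C (@mulM K qg_A) (fun (a : qg_A) y => a <* y)) }.

Arguments mul {K q}.
Arguments qg_B {K} q.
Arguments qg_C {K} q.
Arguments S_B {K q}.
Arguments S_C {K q}.

Local Notation "a ** b" := (mul a b) (at level 40, left associativity).

Section Quotients.
Context (K : fieldType) (A : quantum_graph K).
Implicit Types (a b : A) (x y : dcent A).

Definition SBinv x : dcent A := inv_on 0 (qg_B A) S_B x.
Definition SCinv x : dcent A := inv_on 0 (qg_C A) S_C x.

(* The indices [_B], [_C], [^B], [^C], [_l], [_r] of the quotients of A (x) A. *)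
Definition tens_B : lmodType K :=
  tens (qg_B A) (fun x a => a <* x) (fun x b => x *> b).
Definition tens_C : lmodType K :=
  tens (qg_C A) (fun y a => a <* y) (fun y b => y *> b).
Definition tens_upB : lmodType K :=
  tens (qg_B A) (fun x a => x *> a) (fun x b => b <* x).
Definition tens_upC : lmodType K :=
  tens (qg_C A) (fun y a => y *> a) (fun y b => b <* y).
Definition tens_l : lmodType K :=
  tens (qg_B A) (fun x a => x *> a) (fun x b => S_B x *> b).
Definition tens_r : lmodType K :=
  tens (qg_C A) (fun y a => a <* S_C y) (fun y b => b <* y).

(* The iterated quotients of A (x) A (x) A, bracketed to the left. *)
Definition tens_ll : lmodType K :=
  tens (V := tens_l) (qg_B A) (fun x => tmap id (fun b => x *> b))
       (fun x c => S_B x *> c).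
Definition tens_rr : lmodType K :=
  tens (V := tens_r) (qg_C A) (fun y => tmap id (fun b => b <* S_C y))
       (fun y c => c <* y).
Definition tens_lr : lmodType K :=
  tens (V := tens_l) (qg_C A) (fun y => tmap id (fun b => b <* S_C y))
       (fun y c => c <* y).
Definition tens_rl : lmodType K :=
  tens (V := tens_r) (qg_B A) (fun x => tmap id (fun b => x *> b))
       (fun x c => S_B x *> c).

End Quotients.

(* A left comultiplication: [DeltaB a] is Delta_B(a) in End(A (x)_l A), [DBr a c]
   is the element Delta_B(a)(1 (x) c) and [DBl a b] is Delta_B(a)(b (x) 1) of
   A (x)_l A. The equivalences [DBrP] and [DBlP] say that these elements exist
   and are determined by their defining property, which is what makes the
   notation meaningful and the canonical maps below well defined. *)
Record left_comultiplication (K : fieldType) (A : quantum_graph K) :=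
LeftComultiplication {
  DeltaB : A -> tens_l A -> tens_l A;
  DBr : A -> A -> tens_l A;
  DBl : A -> A -> tens_l A;
  DeltaB_end : forall a, linear (DeltaB a);
  DeltaB_lin : forall t, linear (DeltaB^~ t);
  DeltaB_mul : forall a b t, DeltaB (a ** b) t = DeltaB a (DeltaB b t);
  DBrP : forall a c (t : tens_l A),
    (forall b, DeltaB a (otimes b c) = tmap (fun p => p ** b) id t) <->
    t = DBr a c;
  DBlP : forall a b (t : tens_l A),
    (forall c, DeltaB a (otimes b c) = tmap id (fun q => q ** c) t) <->
    t = DBl a b;
  DeltaB_cov : forall (a : A) x y x' y' (t : tens_l A),
    qg_B A x -> qg_C A y -> qg_B A x' -> qg_C A y' ->
    DeltaB (x *> (y *> (a <* x' <* y'))) t =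
    tmap (fun p => y *> p) (fun q => x *> q)
      (DeltaB a (tmap (fun p => y' *> p) (fun q => x' *> q) t));
  DeltaB_coassoc : forall a b c,
    tlift (fun p q => otimes (DBl p a) q : tens_ll A) (DBr b c) =
    tlift (fun p q => tlift (fun u v => otimes (otimes p u) v : tens_ll A)
                        (DBr q c)) (DBl b a) }.

(* A right comultiplication: [DeltaC c t] is t Delta_C(c), where Delta_C(c) acts
   on A (x)_r A from the right, [DCl a c] is (a (x) 1) Delta_C(c) and [DCr b c]
   is (1 (x) b) Delta_C(c). *)
Record right_comultiplication (K : fieldType) (A : quantum_graph K) :=
RightComultiplication {
  DeltaC : A -> tens_r A -> tens_r A;
  DCl : A -> A -> tens_r A;
  DCr : A -> A -> tens_r A;
  DeltaC_end : forall a, linear (DeltaC a);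
  DeltaC_lin : forall t, linear (DeltaC^~ t);
  DeltaC_mul : forall a b t, DeltaC (a ** b) t = DeltaC b (DeltaC a t);
  DClP : forall a c (t : tens_r A),
    (forall b, DeltaC c (otimes a b) = tmap id (fun q => b ** q) t) <->
    t = DCl a c;
  DCrP : forall b c (t : tens_r A),
    (forall a, DeltaC c (otimes a b) = tmap (fun p => a ** p) id t) <->
    t = DCr b c;
  DeltaC_cov : forall (a : A) x y x' y' (t : tens_r A),
    qg_B A x -> qg_C A y -> qg_B A x' -> qg_C A y' ->
    DeltaC (x *> (y *> (a <* x' <* y'))) t =
    tmap (fun p => p <* y') (fun q => q <* x')
      (DeltaC a (tmap (fun p => p <* y) (fun q => q <* x) t));
  DeltaC_coassoc : forall a b c,
    tlift (fun p q => otimes (DCl a p) q : tens_rr A) (DCr c b) =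
    tlift (fun p q => tlift (fun u v => otimes (otimes p u) v : tens_rr A)
                        (DCr c q)) (DCl a b) }.

Record multiplier_bialgebroid (K : fieldType) := MultiplierBialgebroid {
  mb_graph :> quantum_graph K;
  mb_left :> left_comultiplication mb_graph;
  mb_right :> right_comultiplication mb_graph;
  mb_mixed_lr : forall a b c,
    tlift (fun p q => otimes (DBl mb_left p a) q : tens_lr mb_graph)
      (DCr mb_right c b) =
    tlift (fun p q => tlift (fun u v => otimes (otimes p u) v : tens_lr mb_graph)
                        (DCr mb_right c q)) (DBl mb_left b a);
  mb_mixed_rl : forall a b c,
    tlift (fun p q => otimes (DCl mb_right a p) q : tens_rl mb_graph)
      (DBr mb_left b c) =
    tlift (fun p q => tlift (fun u v => otimes (otimes p u) v : tens_rl mb_graph)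
                        (DBr mb_left q c)) (DCl mb_right a b) }.

Section HopfAlgebroids.
Context (K : fieldType) (A : multiplier_bialgebroid K).

Definition T_lambda : tens_upC A -> tens_l A := tlift (fun a b => DBl A b a).
Definition T_rho : tens_B A -> tens_l A := tlift (fun a b => DBr A a b).
Definition lambda_T : tens_C A -> tens_r A := tlift (fun a b => DCl A a b).
Definition rho_T : tens_upB A -> tens_r A := tlift (fun a b => DCr A b a).

Definition regular_hopf : Prop :=
  [/\ bijective T_lambda, bijective T_rho, bijective lambda_T & bijective rho_T].

Definition flat_bialgebroid : Prop :=
  [/\ flat_left (qg_B A) (@mulM K A) (fun x (a : A) => x *> a),
      flat_right (qg_B A) (@mulM K A) (fun (a : A) x => a <* x),
      flat_left (qg_C A) (@mulM K A) (fun y (a : A) => y *> a) &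
      flat_right (qg_C A) (@mulM K A) (fun (a : A) y => a <* y)].

(* In the next two definitions and below, a Sweedler sum is [tlift] of the
   summand, as a function of the two legs p and q, at the corresponding element
   of A (x)_l A or A (x)_r A. *)
Record left_counit (e : A -> dcent A) : Prop := {
  lcounit_range : forall a, qg_B A (e a);
  lcounit_linear : linear e;
  lcounit_B : forall x a, qg_B A x -> e (x *> a) = mulM x (e a);
  lcounit_SB : forall x a, qg_B A x -> e (S_B x *> a) = mulM (e a) x;
  lcounit_l : forall a b,
    tlift (fun p q => S_B (e p) *> q) (DBr A a b) = a ** b;
  lcounit_r : forall a b,
    tlift (fun p q => e q *> p) (DBl A b a) = b ** a;
  lcounit_mul : forall a b,
    e (a ** b) = e (a <* e b) /\ e (a ** b) = e (a <* S_B (e b)) }.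

Record right_counit (e : A -> dcent A) : Prop := {
  rcounit_range : forall a, qg_C A (e a);
  rcounit_linear : linear e;
  rcounit_C : forall y a, qg_C A y -> e (a <* y) = mulM (e a) y;
  rcounit_SC : forall y a, qg_C A y -> e (a <* S_C y) = mulM y (e a);
  rcounit_l : forall a b,
    tlift (fun p q => q <* e p) (DCr A b a) = b ** a;
  rcounit_r : forall a b,
    tlift (fun p q => p <* S_C (e q)) (DCl A a b) = a ** b;
  rcounit_mul : forall a b,
    e (a ** b) = e (e a *> b) /\ e (a ** b) = e (S_C (e a) *> b) }.

(* The counits exist and are unique for regular multiplier Hopf algebroids;
   [bw_counit] is the identity mu_B o _B eps = mu_C o eps_C for them. *)
Record base_weight (muB muC : dcent A -> K^o) : Prop := {
  bw_linB : linear_on (qg_B A) muB;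
  bw_linC : linear_on (qg_C A) muC;
  bw_faithfulB : faithful_functional (qg_B A) (@mulM K A) muB;
  bw_faithfulC : faithful_functional (qg_C A) (@mulM K A) muC;
  bw_SC : forall y, qg_C A y -> muB (S_C y) = muC y;
  bw_SB : forall x, qg_B A x -> muC (S_B x) = muB x;
  bw_counit : exists eB eC, [/\ left_counit eB, right_counit eC &
                                forall a, muB (eB a) = muC (eC a)] }.

End HopfAlgebroids.

Section Adapted.
Context (K : fieldType) (A : multiplier_bialgebroid K).
Context (muB muC : dcent A -> K^o).
Implicit Types (w : A -> K^o) (f : A -> dcent A).

(* The characterisations of the maps _B w, w_B, _C w and w_C. *)
Definition is_Bl w f : Prop := forall a, qg_B A (f a) /\
  forall x, qg_B A x -> w (x *> a) = muB (mulM x (f a)).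
Definition is_Br w f : Prop := forall a, qg_B A (f a) /\
  forall x, qg_B A x -> w (a <* x) = muB (mulM (f a) x).
Definition is_Cl w f : Prop := forall a, qg_C A (f a) /\
  forall y, qg_C A y -> w (y *> a) = muC (mulM y (f a)).
Definition is_Cr w f : Prop := forall a, qg_C A (f a) /\
  forall y, qg_C A y -> w (a <* y) = muC (mulM (f a) y).

Definition adapted : set (A -> K^o) :=
  [set w | linear w /\ [/\ exists f, is_Bl w f, exists f, is_Br w f,
                           exists f, is_Cl w f & exists f, is_Cr w f]].

(* For an adapted w, the maps _B w, w_B, _C w and w_C; they are unique when
   muB and muC are faithful. *)
Definition Bl w : A -> dcent A := xget (fun=> 0) (is_Bl w).
Definition Br w : A -> dcent A := xget (fun=> 0) (is_Br w).
Definition Cl w : A -> dcent A := xget (fun=> 0) (is_Cl w).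
Definition Cr w : A -> dcent A := xget (fun=> 0) (is_Cr w).

Definition left_integral phi : Prop :=
  adapted phi /\ forall a b,
    tlift (fun p q => SBinv (Cl phi q) *> p) (DBl A b a) = Cl phi b *> a.

Definition right_integral psi : Prop :=
  adapted psi /\ forall a b,
    tlift (fun p q => S_B (Bl psi p) *> q) (DBr A a b) = Bl psi a *> b.

Definition full_left phi : Prop :=
  range (Bl phi) = qg_B A /\ range (Br phi) = qg_B A.

Definition full_right psi : Prop :=
  range (Cl psi) = qg_C A /\ range (Cr psi) = qg_C A.

(* The convolution operators: l = lambda(w) and r = rho(w). *)
Definition is_lambda w (l : A -> A) : Prop := forall a b,
  l a ** b = tlift (fun p q => S_B (Bl w p) *> q) (DBr A a b) /\
  b ** l a = tlift (fun p q => q <* SCinv (Br w p)) (DCr A b a).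

Definition is_rho w (r : A -> A) : Prop := forall a b,
  r a ** b = tlift (fun p q => SBinv (Cl w q) *> p) (DBl A a b) /\
  b ** r a = tlift (fun p q => p <* S_C (Cr w q)) (DCl A b a).

Definition conv_lambda w : A -> A := xget (fun=> 0) (is_lambda w).
Definition conv_rho w : A -> A := xget (fun=> 0) (is_rho w).

End Adapted.

Record measured_hopf_algebroid (K : fieldType) := MeasuredHopfAlgebroid {
  mh_A :> multiplier_bialgebroid K;
  mu_B : dcent mh_A -> K^o;
  mu_C : dcent mh_A -> K^o;
  phi : mh_A -> K^o;
  psi : mh_A -> K^o;
  mh_regular : regular_hopf mh_A;
  mh_flat : flat_bialgebroid mh_A;
  mh_base_weight : base_weight mu_B mu_C;
  mh_left_integral : left_integral mu_B mu_C phi;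
  mh_full_left : full_left mu_B phi;
  mh_faithful_left : faithful_functional setT mul phi;
  mh_right_integral : right_integral mu_B mu_C psi;
  mh_full_right : full_right mu_C psi;
  mh_faithful_right : faithful_functional setT mul psi }.

Arguments mu_B {K m}.
Arguments mu_C {K m}.
Arguments phi {K m}.
Arguments psi {K m}.

Section Dual.
Context (K : fieldType) (A : measured_hopf_algebroid K).
Implicit Types w : A -> K^o.

(* The dual A . phi, where (a . phi)(b) = phi (b a). *)
Definition dual_alg : set (A -> K^o) :=
  [set w | exists a, w = fun b => phi (b ** a)].

Definition adapted_space : set (A -> K^o) := adapted mu_B mu_C.
Definition lambda w : A -> A := conv_lambda mu_B w.
Definition rho w : A -> A := conv_rho mu_C w.

End Dual.

Arguments dual_alg {K} A.
Arguments adapted_space {K} A.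
Arguments lambda {K A} w.
Arguments rho {K A} w.

(* Main.v *)
Require Import Defs.
From mathcomp Require Import all_boot all_order all_algebra.
From mathcomp Require Import boolp classical_sets functions reals complex.
Import GRing.Theory.
Local Open Scope classical_set_scope.
Local Open Scope ring_scope.

(* Write D(b) = b1 (x) b2. By invariance of the integrals and bijectivity of the
   canonical maps, the functional b |-> (psi (x) phi)(D(b) t) is of the form
   phi(. a) for t = D(p)(q (x) 1) and of the form psi(. a) for t = D(p)(1 (x) q).
   Hence A.phi = A.psi, this space is closed under convolution, and the products
   psi(. d) phi(. d') span it. The counit formula p d = sum eB(p2) p1 d and the
   equality of the functionals muB o eB and muC o eC provide the module maps of
   phi(. d) for the right actions of B and C, and the equality of the descriptions
   of the convolution operators by Delta_B and by Delta_C. The module laws follow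
   from coassociativity by testing against A.phi, which separates the points of A.
   The functionals u o lambda(w) and u o rho(w) are adapted because A.phi is
   contained in phi.A: with r_c(b) = lambda(psi(. c))(b) = S(sum psi(b c1) c2),
   for the antipode S, the functional b |-> phi(S(x) r_c(b)) is of the form
   psi(. p), with p ranging over A, and of the form phi(q .). *)

Set Implicit Arguments.
Unset Strict Implicit.
Unset Printing Implicit Defensive.

Local Notation "a ** b" := (Defs.mul a b) (at level 40, left associativity).

(** The comultiplications exist only after multiplication by elements of [A], and [B], [C] need not
    have units. Identities are therefore tested by multiplication, and a convolution operator is
    given by two one-sided formulas, one over Delta_B and one over Delta_C, which must be shown to
    define the same element of [A]. In a product psi(. d) phi(. d') the right integral sits on the
    first leg and the left integral on the second, so that invariance can remove either leg. The
    inclusion of A.phi in phi.A is forced by adaptedness: lambda(w) is linear for both actions of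
    [B], but for the actions of [C] one needs w = phi(. d) to get the left module map of u o
    lambda(w), and the mirror form w = phi(q .) to get the right one. The antipode is not part of
    the data: inverting two canonical maps yields only the products S(x) e and e S(x). That S(x) is
    an element of [A] follows from the strong invariance S(lambda(psi(b .))(c)) = lambda(psi(.
    c))(b), because the elements lambda(psi(b .))(c) span [A]. *)

Section Linear.
Context (K : fieldType) (U V : lmodType K).
Implicit Types (f : U -> V).

Lemma linear_at0 f : linear f -> f 0 = 0.
Proof. by move=> lf; have := lf (-1) 0 0; rewrite scaler0 addr0 scaleN1r addNr. Qed.

Lemma linear_add f u v : linear f -> f (u + v) = f u + f v.
Proof. by move=> lf; have := lf 1 u v; rewrite !scale1r. Qed.

Lemma linear_scale f k u : linear f -> f (k *: u) = k *: f u.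
Proof. by move=> lf; have := lf k u 0; rewrite !addr0 linear_at0 // addr0. Qed.

Lemma linear_bigsum f (I : Type) (r : seq I) (F : I -> U) : linear f ->
  f (\sum_(i <- r) F i) = \sum_(i <- r) f (F i).
Proof.
move=> lf; elim: r => [|i r IHr]; first by rewrite !big_nil linear_at0.
by rewrite !big_cons linear_add // IHr.
Qed.

End Linear.

(** * Balanced tensor products and induced maps *)

Section Tensor.
Context (K : fieldType) (V W : lmodType K) (X : Type) (D : set X).
Context (f : X -> V -> V) (g : X -> W -> W).
Implicit Types (U : lmodType K).

(** The hypotheses of [tlift_otimes] and [tlift_linear] in one predicate: for such h the total
    function [tlift h] is the induced linear map. *)
Definition balanced U (h : V -> W -> U) : Prop :=
  [/\ forall w, linear (h^~ w), forall v, linear (h v) &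
      forall x v w, D x -> h (f x v) w = h v (g x w)].

Local Notation T := (tens D f g).
Local Notation ot := (@otimes K V W X D f g).

Lemma tliftE U (h : V -> W -> U) v w : balanced h -> tlift h (ot v w) = h v w.
Proof. by move=> [hl hr hb]; exact: tlift_otimes. Qed.

Lemma tlift_lin U (h : V -> W -> U) : balanced h -> linear (tlift h : T -> U).
Proof. by move=> [hl hr hb]; exact: tlift_linear. Qed.

(** By definition [tlift h t] is a finite sum over a representative of t, and a linear map passes
    through that sum, whatever h is. *)
Lemma tlift_comp U U' (F : U -> U') (h : V -> W -> U) (t : T) : linear F ->
  F (tlift h t) = tlift (fun v w => F (h v w)) t.
Proof. by move=> lF; rewrite /tlift linear_bigsum. Qed.

Lemma eq_tlift U (h h' : V -> W -> U) (t : T) :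
  (forall v w, h v w = h' v w) -> tlift h t = tlift h' t.
Proof. by move=> hh'; apply: eq_bigr. Qed.

Lemma otimesDl v v' w : ot (v + v') w = ot v w + ot v' w.
Proof.
rewrite [RHS]/GRing.add /= /tensD.
have E : tensD (ot v w) (ot v' w) = \pi_T%qT ([:: (v, w)] ++ [:: (v', w)])
  by rewrite -pi_tensD.
by rewrite -/(tensD _ _) E; apply/tens_piE; exact: tens_addl.
Qed.

Lemma otimesDr v w w' : ot v (w + w') = ot v w + ot v w'.
Proof.
rewrite [RHS]/GRing.add /= /tensD.
have E : tensD (ot v w) (ot v w') = \pi_T%qT ([:: (v, w)] ++ [:: (v, w')])
  by rewrite -pi_tensD.
by rewrite -/(tensD _ _) E; apply/tens_piE; exact: tens_addr.
Qed.

Lemma otimesZl k v w : ot (k *: v) w = k *: ot v w.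
Proof. by rewrite [RHS]/GRing.scale /= pi_tensZ. Qed.

Lemma otimesZr k v w : ot v (k *: w) = k *: ot v w.
Proof.
by rewrite -otimesZl; apply/tens_piE; apply: tens_sym; exact: tens_scale.
Qed.

Lemma otimes_linl w : linear (ot^~ w).
Proof. by move=> k u v /=; rewrite otimesDl otimesZl. Qed.

Lemma otimes_linr v : linear (ot v).
Proof. by move=> k u w /=; rewrite otimesDr otimesZr. Qed.

Lemma otimes_bal x v w : D x -> ot (f x v) w = ot v (g x w).
Proof.
move=> Dx; apply/tens_piE; have := tens_bal f g 1 v w Dx; by rewrite !scale1r.
Qed.

Lemma balanced_comp U U' (F : U -> U') (h : V -> W -> U) :
  linear F -> balanced h -> balanced (fun v w => F (h v w)).
Proof.
move=> lF [hl hr hb]; split=> [w k u v|v k u w|x v w Dx] /=.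
- by rewrite hl lF.
- by rewrite hr lF.
- by rewrite hb.
Qed.

Lemma otimes_sum (t : T) : t = \sum_(p <- repr t) ot p.1 p.2.
Proof.
have -> : \sum_(p <- repr t) ot p.1 p.2 = \pi_T%qT (repr t).
  elim: (repr t) => [|[v w] s IHs]; first by rewrite big_nil.
  by rewrite big_cons IHs [LHS]/GRing.add /= pi_tensD.
by rewrite reprK.
Qed.

Lemma tens_ext U (F G : T -> U) : linear F -> linear G ->
  (forall v w, F (ot v w) = G (ot v w)) -> F =1 G.
Proof.
move=> lF lG FG t; rewrite (otimes_sum t) !linear_bigsum //.
by apply: eq_bigr => p _.
Qed.

Lemma tlift_id (t : T) : tlift ot t = t.
Proof. by rewrite [RHS]otimes_sum. Qed.

End Tensor.

Section TensorMaps.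
Context (K : fieldType) (V W V' W' : lmodType K) (X X' : Type).
Context (D : set X) (f : X -> V -> V) (g : X -> W -> W).
Context (D' : set X') (f' : X' -> V' -> V') (g' : X' -> W' -> W').
Local Notation T := (tens D f g).
Local Notation T' := (tens D' f' g').

Lemma tlift_tlift (U : lmodType K) (h : V' -> W' -> U) (k : V -> W -> T') (t : T) :
  balanced D' f' g' h -> tlift h (tlift k t) = tlift (fun v w => tlift h (k v w)) t.
Proof. by move=> bh; apply: tlift_comp; exact: tlift_lin. Qed.

Lemma tlift_tmap (U : lmodType K) (h : V' -> W' -> U) a b (t : T) :
  balanced D' f' g' h ->
  tlift h (tmap a b t : T') = tlift (fun v w => h (a v) (b w)) t.
Proof.
move=> bh; rewrite /tmap tlift_tlift //; apply: eq_tlift => v w.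
by rewrite tliftE.
Qed.

End TensorMaps.

(** * Anti-isomorphisms and calculus with multipliers *)

Section AntiIsomorphism.
Context (K : fieldType) (V : lmodType K) (m : V -> V -> V) (P Q : set V) (S : V -> V).
Hypothesis S_anti : anti_isomorphism m P Q S.

Lemma anti_fun x : P x -> Q (S x).
Proof. by case: S_anti => -[fS _ _] _ _; exact: fS. Qed.

Lemma anti_inj x x' : P x -> P x' -> S x = S x' -> x = x'.
Proof. by case: S_anti => -[_ iS _] _ _ Px Px'; apply: iS; exact/mem_set. Qed.

Lemma inv_onP x0 y : Q y -> P (inv_on x0 P S y) /\ S (inv_on x0 P S y) = y.
Proof.
case: S_anti => -[_ _ sS] _ _ /sS[x Px xy].
by rewrite /inv_on; case: xgetP => [z _ []//|/(_ x)]; case.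
Qed.

Lemma inv_onK x0 x : P x -> inv_on x0 P S (S x) = x.
Proof.
move=> Px; have [Pi Ei] := inv_onP x0 (anti_fun Px).
exact: anti_inj.
Qed.

Lemma inv_onE x0 x y : P x -> S x = y -> inv_on x0 P S y = x.
Proof. by move=> Px <-; exact: inv_onK. Qed.

End AntiIsomorphism.

Section QuantumGraph.
Context (K : fieldType) (A : quantum_graph K).
Implicit Types (a b c : A) (x y z : dcent A).
Local Notation B := (qg_B A).
Local Notation C := (qg_C A).
Local Notation isM := (multiplier (@Defs.mul K A)).

Lemma qmulA a b c : a ** (b ** c) = (a ** b) ** c.
Proof. by case: (qg_alg A) => _ _ _; apply. Qed.

Lemma qmul_linl c : linear (fun a => a ** c).
Proof. by case: (qg_alg A) => _ _ [l _] _ k u v; exact: l. Qed.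

Lemma qmul_linr c : linear (fun a => c ** a).
Proof. by case: (qg_alg A) => _ _ [_ l] _ k u v; exact: l. Qed.

Lemma qmulDl c k a b : (k *: a + b) ** c = k *: (a ** c) + b ** c.
Proof. exact: qmul_linl. Qed.

Lemma qmulDr c k a b : c ** (k *: a + b) = k *: (c ** a) + c ** b.
Proof. exact: qmul_linr. Qed.

Lemma qmul_injl a b : (forall c, c ** a = c ** b) -> a = b.
Proof.
move=> E; apply/eqP; rewrite -subr_eq0; apply/negPn/negP => ab0.
have [_ [c _ +]] := qg_nondeg I ab0.
by rewrite (linear_add _ _ (qmul_linr c)) -scaleN1r (linear_scale _ _ (qmul_linr c)) E scaleN1r subrr eqxx.
Qed.

Lemma qmul_injr a b : (forall c, a ** c = b ** c) -> a = b.
Proof.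
move=> E; apply/eqP; rewrite -subr_eq0; apply/negPn/negP => ab0.
have [[c _ +] _] := qg_nondeg I ab0.
by rewrite (linear_add _ _ (qmul_linl c)) -scaleN1r (linear_scale _ _ (qmul_linl c)) E scaleN1r subrr eqxx.
Qed.

Lemma multiplierB x : B x -> isM x. Proof. exact: qg_subB. Qed.
Lemma multiplierC x : C x -> isM x. Proof. exact: qg_subC. Qed.

Lemma multl_linear x : isM x -> linear x.1. Proof. by case=> -[]. Qed.
Lemma multr_linear x : isM x -> linear x.2. Proof. by case=> -[]. Qed.
Lemma multlD x k a b : isM x -> x.1 (k *: a + b) = k *: x.1 a + x.1 b.
Proof. by move=> /multl_linear; apply. Qed.
Lemma multrD x k a b : isM x -> x.2 (k *: a + b) = k *: x.2 a + x.2 b.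
Proof. by move=> /multr_linear; apply. Qed.
Lemma multl_mul x a b : isM x -> x *> (a ** b) = (x *> a) ** b.
Proof. by case. Qed.
Lemma multr_mul x a b : isM x -> (a ** b) <* x = a ** (b <* x).
Proof. by case. Qed.
Lemma mul_mult x a b : isM x -> (a <* x) ** b = a ** (x *> b).
Proof. by case. Qed.

(** Multiplied on the right by c, both sides become x (a (y c)); non-degeneracy removes c. *)
Lemma multl_multr x y a : isM x -> isM y -> x *> (a <* y) = (x *> a) <* y.
Proof.
move=> mx my; apply: qmul_injr => c.
by rewrite -multl_mul // !mul_mult // -multl_mul.
Qed.

(** A multiplier is determined by its left action, because (a x) c = a (x c) and [A] is
    non-degenerate. *)
Lemma multl_inj x y : isM x -> isM y -> (forall a, x *> a = y *> a) -> x = y.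
Proof.
move=> mx my E; case: x mx E => x1 x2 mx E; case: y my E => y1 y2 my E.
congr (_, _); apply/funext => a; first exact: E.
by apply: qmul_injr => c; rewrite (mul_mult _ _ mx) (mul_mult _ _ my) [in LHS]E.
Qed.

Lemma multl_BC x y a : B x -> C y -> x *> (y *> a) = y *> (x *> a).
Proof. by move=> Bx Cy; have := qg_commBC Bx Cy => -[/(congr1 (@^~ a))]. Qed.

Lemma multr_BC x y a : B x -> C y -> (a <* x) <* y = (a <* y) <* x.
Proof. by move=> Bx Cy; have := qg_commBC Bx Cy => -[_ /(congr1 (@^~ a))]. Qed.

Lemma qgB_0 : B 0. Proof. by case: (qg_algB A) => -[]. Qed.
Lemma qgB_lin k x y : B x -> B y -> B (k *: x + y).
Proof. by case: (qg_algB A) => -[_ h] _ _ _; exact: h. Qed.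
Lemma qgB_mul x y : B x -> B y -> B (mulM x y).
Proof. by case: (qg_algB A) => _ h _ _; exact: h. Qed.
Lemma qgC_0 : C 0. Proof. by case: (qg_algC A) => -[]. Qed.
Lemma qgC_lin k x y : C x -> C y -> C (k *: x + y).
Proof. by case: (qg_algC A) => -[_ h] _ _ _; exact: h. Qed.
Lemma qgC_mul x y : C x -> C y -> C (mulM x y).
Proof. by case: (qg_algC A) => _ h _ _; exact: h. Qed.

Lemma S_B_in x : B x -> C (S_B x). Proof. exact: (anti_fun (qg_SB A)). Qed.
Lemma S_C_in y : C y -> B (S_C y). Proof. exact: (anti_fun (qg_SC A)). Qed.
Lemma SBinv_in y : C y -> B (SBinv y).
Proof. by move=> Cy; case: (inv_onP (qg_SB A) 0 Cy). Qed.
Lemma SCinv_in x : B x -> C (SCinv x).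
Proof. by move=> Bx; case: (inv_onP (qg_SC A) 0 Bx). Qed.
Lemma SBinvK y : C y -> S_B (SBinv y) = y.
Proof. by move=> Cy; case: (inv_onP (qg_SB A) 0 Cy). Qed.
Lemma SCinvK x : B x -> S_C (SCinv x) = x.
Proof. by move=> Bx; case: (inv_onP (qg_SC A) 0 Bx). Qed.
Lemma S_BK x : B x -> SBinv (S_B x) = x. Proof. exact: (inv_onK (qg_SB A)). Qed.
Lemma S_CK y : C y -> SCinv (S_C y) = y. Proof. exact: (inv_onK (qg_SC A)). Qed.
Lemma S_BD k x y : B x -> B y -> S_B (k *: x + y) = k *: S_B x + S_B y.
Proof. by case: (qg_SB A) => _ h _; exact: h. Qed.
Lemma S_CD k x y : C x -> C y -> S_C (k *: x + y) = k *: S_C x + S_C y.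
Proof. by case: (qg_SC A) => _ h _; exact: h. Qed.
Lemma S_BM x y : B x -> B y -> S_B (mulM x y) = mulM (S_B y) (S_B x).
Proof. by case: (qg_SB A) => _ _ h; exact: h. Qed.
Lemma S_CM x y : C x -> C y -> S_C (mulM x y) = mulM (S_C y) (S_C x).
Proof. by case: (qg_SC A) => _ _ h; exact: h. Qed.

Lemma SBinvD k x y : C x -> C y -> SBinv (k *: x + y) = k *: SBinv x + SBinv y.
Proof.
move=> Cx Cy; apply: (inv_onE (qg_SB A)); first by apply: qgB_lin; exact: SBinv_in.
by rewrite S_BD ?SBinvK //; exact: SBinv_in.
Qed.
Lemma SCinvD k x y : B x -> B y -> SCinv (k *: x + y) = k *: SCinv x + SCinv y.
Proof.
move=> Cx Cy; apply: (inv_onE (qg_SC A)); first by apply: qgC_lin; exact: SCinv_in.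
by rewrite S_CD ?SCinvK //; exact: SCinv_in.
Qed.
Lemma SBinvM x y : C x -> C y -> SBinv (mulM x y) = mulM (SBinv y) (SBinv x).
Proof.
move=> Cx Cy; apply: (inv_onE (qg_SB A)); first by apply: qgB_mul; exact: SBinv_in.
by rewrite S_BM ?SBinvK //; exact: SBinv_in.
Qed.
Lemma SCinvM x y : B x -> B y -> SCinv (mulM x y) = mulM (SCinv y) (SCinv x).
Proof.
move=> Cx Cy; apply: (inv_onE (qg_SC A)); first by apply: qgC_mul; exact: SCinv_in.
by rewrite S_CM ?SCinvK //; exact: SCinv_in.
Qed.

(* This replaces the missing units of B and C. *)
Lemma quantum_graph_ind (P : A -> Prop) : P 0 -> (forall a b, P a -> P b -> P (a + b)) ->
  (forall x y a x' y', B x -> C y -> B x' -> C y' ->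
     P (x *> (y *> (a <* x' <* y')))) -> forall a, P a.
Proof.
move=> P0 PD Pi.
have ind (T : Type) (s : seq T) (F : T -> A) : (forall p, P (F p)) ->
    P (\sum_(p <- s) F p).
  by move=> PF; elim: s => [|p s IHs]; rewrite ?big_nil // big_cons; exact: PD.
have ind2 (T : eqType) (s : seq T) (F : T -> A) : (forall p, p \in s -> P (F p)) ->
    P (\sum_(p <- s) F p).
  move=> PF; rewrite big_seq; elim/big_ind: _ => //; exact: PF.
(* The four factors are split off one at a time, in reverse order: an arbitrary element lies in
   [BA], its inner factor in [CA], then in [AB], and finally in [AC]. *)
have P3 x y a x' : B x -> C y -> B x' -> P (x *> (y *> (a <* x'))).
  move=> Bx Cy Bx'; have : [set: A] a by [].
  rewrite -(qg_AC A) => -[s [sP ->]].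
  rewrite !(linear_bigsum _ _ (multr_linear (multiplierB Bx')), linear_bigsum _ _ (multl_linear (multiplierC Cy)),
            linear_bigsum _ _ (multl_linear (multiplierB Bx))).
  apply: ind2 => p /sP[_ Cp].
  by rewrite -multr_BC //; exact: Pi.
have P2 x y a : B x -> C y -> P (x *> (y *> a)).
  move=> Bx Cy; have : [set: A] a by [].
  rewrite -(qg_AB A) => -[s [sP ->]].
  rewrite !(linear_bigsum _ _ (multl_linear (multiplierC Cy)), linear_bigsum _ _ (multl_linear (multiplierB Bx))).
  by apply: ind2 => p /sP[_ Bp]; exact: P3.
have P1 x a : B x -> P (x *> a).
  move=> Bx; have : [set: A] a by [].
  rewrite -(qg_CA A) => -[s [sP ->]].
  rewrite !(linear_bigsum _ _ (multl_linear (multiplierB Bx))).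
  by apply: ind2 => p /sP[Cp _]; exact: P2.
move=> a; have : [set: A] a by [].
rewrite -(qg_BA A) => -[s [sP ->]].
by apply: ind2 => p /sP[Bp _]; exact: P1.
Qed.

End QuantumGraph.

#[local] Hint Resolve multiplierB multiplierC qgB_0 qgB_lin qgB_mul qgC_0 qgC_lin qgC_mul S_B_in S_C_in SBinv_in SCinv_in : qg.

Ltac qmem := solve [auto 12 with qg].

(** * Maps acting on the legs of a tensor *)

Section ModuleMaps.
Context (K : fieldType) (A : quantum_graph K).
Implicit Types (a b c : A) (x y z : dcent A) (f g : A -> A).
Local Notation B := (qg_B A).
Local Notation C := (qg_C A).
Local Notation isM := (multiplier (@Defs.mul K A)).

(** These conditions decide when f (x) g descends: [tens_l] balances the left action of [B] on the
    first leg against that of [C] on the second, so it needs [lBlin f] and [lClin g]; [tens_r] needs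
    [rBlin f] and [rClin g]. *)
Definition lBlin f := linear f /\ forall x a, B x -> f (x *> a) = x *> f a.
Definition lClin f := linear f /\ forall y a, C y -> f (y *> a) = y *> f a.
Definition rBlin f := linear f /\ forall x a, B x -> f (a <* x) = f a <* x.
Definition rClin f := linear f /\ forall y a, C y -> f (a <* y) = f a <* y.

Lemma lBlin_id : lBlin (fun a => a). Proof. by []. Qed.
Lemma lClin_id : lClin (fun a => a). Proof. by []. Qed.
Lemma rBlin_id : rBlin (fun a => a). Proof. by []. Qed.
Lemma rClin_id : rClin (fun a => a). Proof. by []. Qed.
Lemma lBlin_mul b : lBlin (fun a => a ** b).
Proof. by split=> [|x a Bx]; [exact: qmul_linl|rewrite multl_mul //; qmem]. Qed.
Lemma lClin_mul b : lClin (fun a => a ** b).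
Proof. by split=> [|x a Bx]; [exact: qmul_linl|rewrite multl_mul //; qmem]. Qed.
Lemma rBlin_mul b : rBlin (fun a => b ** a).
Proof. by split=> [|x a Bx]; [exact: qmul_linr|rewrite multr_mul //; qmem]. Qed.
Lemma rClin_mul b : rClin (fun a => b ** a).
Proof. by split=> [|x a Bx]; [exact: qmul_linr|rewrite multr_mul //; qmem]. Qed.
Lemma lBlin_M z : isM z -> lBlin (fun a => a <* z).
Proof. by move=> mz; split=> [|x a Bx]; [exact: multr_linear|rewrite multl_multr //; qmem]. Qed.
Lemma lClin_M z : isM z -> lClin (fun a => a <* z).
Proof. by move=> mz; split=> [|x a Bx]; [exact: multr_linear|rewrite multl_multr //; qmem]. Qed.
Lemma rBlin_M z : isM z -> rBlin (fun a => z *> a).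
Proof. by move=> mz; split=> [|x a Bx]; [exact: multl_linear|rewrite multl_multr //; qmem]. Qed.
Lemma rClin_M z : isM z -> rClin (fun a => z *> a).
Proof. by move=> mz; split=> [|x a Bx]; [exact: multl_linear|rewrite multl_multr //; qmem]. Qed.
Lemma lBlin_C y : C y -> lBlin (fun a => y *> a).
Proof. by move=> Cy; split=> [|x a Bx]; [apply: multl_linear; qmem|rewrite -(multl_BC _ Bx Cy)]. Qed.
Lemma lClin_B x : B x -> lClin (fun a => x *> a).
Proof. by move=> Bx; split=> [|y a Cy]; [apply: multl_linear; qmem|rewrite (multl_BC _ Bx Cy)]. Qed.
Lemma rBlin_C y : C y -> rBlin (fun a => a <* y).
Proof. by move=> Cy; split=> [|x a Bx]; [apply: multr_linear; qmem|rewrite (multr_BC _ Bx Cy)]. Qed.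
Lemma rClin_B x : B x -> rClin (fun a => a <* x).
Proof. by move=> Bx; split=> [|y a Cy]; [apply: multr_linear; qmem|rewrite -(multr_BC _ Bx Cy)]. Qed.

Lemma otimes_l x u v : B x -> otimes (x *> u) v = otimes u (S_B x *> v) :> tens_l A.
Proof. exact: (@otimes_bal K A A _ B (fun x a => x *> a) (fun x b => S_B x *> b)). Qed.

Lemma otimes_r y u v : C y -> otimes (u <* S_C y) v = otimes u (v <* y) :> tens_r A.
Proof. exact: (@otimes_bal K A A _ C (fun y a => a <* S_C y) (fun y b => b <* y)). Qed.

Notation bal_l := (balanced B (fun x a => x *> a) (fun x b => S_B x *> b)).
Notation bal_r := (balanced C (fun y a => a <* S_C y) (fun y b => b <* y)).

Lemma bal_tmap_l f g : lBlin f -> lClin g ->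
  bal_l (fun u v => otimes (f u) (g v) : tens_l A).
Proof.
move=> [lf hf] [lg hg]; split=> [w k u v|v k u w|x v w Bx] /=.
- by rewrite lf; exact: otimes_linl.
- by rewrite lg; exact: otimes_linr.
- by rewrite hf // hg; [exact: otimes_l|qmem].
Qed.

Lemma bal_tmap_r f g : rBlin f -> rClin g ->
  bal_r (fun u v => otimes (f u) (g v) : tens_r A).
Proof.
move=> [lf hf] [lg hg]; split=> [w k u v|v k u w|x v w Bx] /=.
- by rewrite lf; exact: otimes_linl.
- by rewrite lg; exact: otimes_linr.
- by rewrite hg // hf; [exact: otimes_r|qmem].
Qed.

Lemma tmap_lE f g u v : lBlin f -> lClin g ->
  tmap f g (otimes u v : tens_l A) = otimes (f u) (g v) :> tens_l A.
Proof. by move=> hf hg; apply: (@tliftE _ _ _ _ B); exact: bal_tmap_l. Qed.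

Lemma tmap_rE f g u v : rBlin f -> rClin g ->
  tmap f g (otimes u v : tens_r A) = otimes (f u) (g v) :> tens_r A.
Proof. by move=> hf hg; apply: (@tliftE _ _ _ _ C); exact: bal_tmap_r. Qed.

Lemma tmap_l_lin f g : lBlin f -> lClin g ->
  linear (tmap f g : tens_l A -> tens_l A).
Proof. by move=> hf hg; apply: (@tlift_lin _ _ _ _ B); exact: bal_tmap_l. Qed.

Lemma tmap_r_lin f g : rBlin f -> rClin g ->
  linear (tmap f g : tens_r A -> tens_r A).
Proof. by move=> hf hg; apply: (@tlift_lin _ _ _ _ C); exact: bal_tmap_r. Qed.

Lemma tmap_lM f g f' g' (t : tens_l A) : lBlin f -> lClin g ->
  tmap f g (tmap f' g' t : tens_l A) =
  tmap (fun u => f (f' u)) (fun v => g (g' v)) t :> tens_l A.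
Proof. by move=> hf hg; apply: tlift_tmap; exact: bal_tmap_l. Qed.

Lemma tmap_rM f g f' g' (t : tens_r A) : rBlin f -> rClin g ->
  tmap f g (tmap f' g' t : tens_r A) =
  tmap (fun u => f (f' u)) (fun v => g (g' v)) t :> tens_r A.
Proof. by move=> hf hg; apply: tlift_tmap; exact: bal_tmap_r. Qed.

Lemma eq_tmap_l f g f' g' (t : tens_l A) : f =1 f' -> g =1 g' ->
  tmap f g t = tmap f' g' t :> tens_l A.
Proof. by move=> ef eg; apply: eq_tlift => u v; rewrite ef eg. Qed.

Lemma eq_tmap_r f g f' g' (t : tens_r A) : f =1 f' -> g =1 g' ->
  tmap f g t = tmap f' g' t :> tens_r A.
Proof. by move=> ef eg; apply: eq_tlift => u v; rewrite ef eg. Qed.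

End ModuleMaps.

Notation bal_l A := (balanced (qg_B A) (fun x (a : A) => x *> a) (fun x (b : A) => S_B x *> b)).
Notation bal_r A := (balanced (qg_C A) (fun y (a : A) => a <* S_C y) (fun y (b : A) => b <* y)).

#[local] Hint Resolve lBlin_id lClin_id rBlin_id rClin_id lBlin_mul lClin_mul
  rBlin_mul rClin_mul lBlin_M lClin_M rBlin_M rClin_M lBlin_C lClin_B rBlin_C
  rClin_B : qg.

(** * Covariance of the left comultiplication, one factor at a time *)

Section LeftComultiplication.
Context (K : fieldType) (A : quantum_graph K) (L : left_comultiplication A).
Implicit Types (a b c d : A) (x y z : dcent A) (t : tens_l A).
Local Notation B := (qg_B A).
Local Notation C := (qg_C A).

Lemma DBrE a b c :
  tmap (fun p => p ** b) id (DBr L a c) = DeltaB L a (otimes b c).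
Proof. by rewrite (DBrP L a c (DBr L a c)).2. Qed.

Lemma DBlE a b c :
  tmap id (fun q => q ** c) (DBl L a b) = DeltaB L a (otimes b c).
Proof. by rewrite (DBlP L a b (DBl L a b)).2. Qed.

(** The uniqueness half of [DBrP]: an identity for [DBr] is proved by multiplying the first leg on
    the right by every b, which turns it into an identity for [DeltaB]. *)
Lemma DBrU a c t :
  (forall b, tmap (fun p => p ** b) id t = DeltaB L a (otimes b c)) -> DBr L a c = t.
Proof. by move=> h; apply/esym/DBrP => b; rewrite h. Qed.

Lemma DBlU a b t :
  (forall c, tmap id (fun q => q ** c) t = DeltaB L a (otimes b c)) -> DBl L a b = t.
Proof. by move=> h; apply/esym/DBlP => c; rewrite h. Qed.

Lemma DeltaB0 t : DeltaB L 0 t = 0.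
Proof. exact: (linear_at0 (DeltaB_lin L t)). Qed.

(** The axiom [DeltaB_cov] carries four factors at once and there is no unit to put for three of
    them. On the elements x0 y a x' y', to which [quantum_graph_ind] reduces, the factor x is
    absorbed into x0. *)
Lemma DeltaB_xl a x t : B x ->
  DeltaB L (x *> a) t = tmap id (fun q => x *> q) (DeltaB L a t).
Proof.
move=> Bx; move: a t; apply: quantum_graph_ind => [t|a b IHa IHb t|x0 y a x' y' Bx0 Cy Bx' Cy' t].
- by rewrite (linear_at0 (multl_linear (multiplierB Bx))) DeltaB0 linear_at0 //; apply: tmap_l_lin; qmem.
- rewrite (linear_add _ _ (multl_linear (multiplierB Bx))) !(linear_add _ _ (DeltaB_lin L t)) IHa IHb.
  by rewrite [RHS]linear_add //; apply: tmap_l_lin; qmem.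
rewrite (DeltaB_cov L _ (x := mulM x x0)) //; last qmem.
rewrite DeltaB_cov // tmap_lM; [|qmem|qmem].
exact: eq_tmap_l.
Qed.

Lemma DeltaB_yl a y t : C y ->
  DeltaB L (y *> a) t = tmap (fun p => y *> p) id (DeltaB L a t).
Proof.
move=> Cy; move: a t; apply: quantum_graph_ind => [t|a b IHa IHb t|x y0 a x' y' Bx Cy0 Bx' Cy' t].
- by rewrite (linear_at0 (multl_linear (multiplierC Cy))) DeltaB0 linear_at0 //; apply: tmap_l_lin; qmem.
- rewrite (linear_add _ _ (multl_linear (multiplierC Cy))) !(linear_add _ _ (DeltaB_lin L t)) IHa IHb.
  by rewrite [RHS]linear_add //; apply: tmap_l_lin; qmem.
rewrite -multl_BC // (DeltaB_cov L _ (y := mulM y y0)) //; last qmem.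
rewrite DeltaB_cov // tmap_lM; [|qmem|qmem].
exact: eq_tmap_l.
Qed.

Lemma DeltaB_yr a y t : C y ->
  DeltaB L (a <* y) t = DeltaB L a (tmap (fun p => y *> p) id t).
Proof.
move=> Cy; move: a t; apply: quantum_graph_ind => [t|a b IHa IHb t|x y0 a x' y' Bx Cy0 Bx' Cy' t].
- by rewrite (linear_at0 (multr_linear (multiplierC Cy))) !DeltaB0.
- by rewrite (linear_add _ _ (multr_linear (multiplierC Cy))) !(linear_add _ _ (DeltaB_lin L _)) IHa IHb.
rewrite -2?multl_multr; [|qmem..].
rewrite (DeltaB_cov L _ (y' := mulM y' y)) //; last qmem.
rewrite DeltaB_cov // tmap_lM; [|qmem|qmem].
by congr (tmap _ _ (DeltaB L a _)); exact: eq_tmap_l.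
Qed.

Lemma DeltaB_xr a x t : B x ->
  DeltaB L (a <* x) t = DeltaB L a (tmap id (fun q => x *> q) t).
Proof.
move=> Bx; move: a t; apply: quantum_graph_ind => [t|a b IHa IHb t|x0 y0 a x' y' Bx0 Cy0 Bx' Cy' t].
- by rewrite (linear_at0 (multr_linear (multiplierB Bx))) !DeltaB0.
- by rewrite (linear_add _ _ (multr_linear (multiplierB Bx))) !(linear_add _ _ (DeltaB_lin L _)) IHa IHb.
rewrite -2?multl_multr; [|qmem..].
rewrite -multr_BC // (DeltaB_cov L _ (x' := mulM x' x)) //; last qmem.
rewrite DeltaB_cov // tmap_lM; [|qmem|qmem].
by congr (tmap _ _ (DeltaB L a _)); exact: eq_tmap_l.
Qed.

(** On p (x) q the left side is [DBr L a q] with its first leg multiplied by p b, which is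
    multiplication by p followed by b. *)
Lemma DeltaB_mulr1 a b t :
  DeltaB L a (tmap (fun p => p ** b) id t) = tmap (fun p => p ** b) id (DeltaB L a t).
Proof.
have l1 : linear (tmap (fun p => p ** b) id : tens_l A -> tens_l A).
  by apply: tmap_l_lin; qmem.
move: t; apply: tens_ext => [k u v|k u v|p q].
- by rewrite l1 DeltaB_end.
- by rewrite DeltaB_end l1.
rewrite tmap_lE; [|qmem|qmem].
rewrite -!DBrE tmap_lM; [|qmem|qmem].
by apply: eq_tmap_l => // u; rewrite qmulA.
Qed.

Lemma DeltaB_mulr2 a b t :
  DeltaB L a (tmap id (fun p => p ** b) t) = tmap id (fun p => p ** b) (DeltaB L a t).
Proof.
have l1 : linear (tmap id (fun p => p ** b) : tens_l A -> tens_l A).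
  by apply: tmap_l_lin; qmem.
move: t; apply: tens_ext => [k u v|k u v|p q].
- by rewrite l1 DeltaB_end.
- by rewrite DeltaB_end l1.
rewrite tmap_lE; [|qmem|qmem].
rewrite -!DBlE tmap_lM; [|qmem|qmem].
by apply: eq_tmap_l => // u; rewrite qmulA.
Qed.

Lemma DBr_linl c : linear (fun a => DBr L a c).
Proof.
move=> k a b /=; apply: DBrU => d; rewrite tmap_l_lin; [|qmem|qmem].
by rewrite !DBrE DeltaB_lin.
Qed.

Lemma DBr_linr a : linear (DBr L a).
Proof.
move=> k c c'; apply: DBrU => d; rewrite tmap_l_lin; [|qmem|qmem].
by rewrite !DBrE -DeltaB_end; congr DeltaB; rewrite -(otimes_linr).
Qed.

Lemma DBl_linl c : linear (fun a => DBl L a c).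
Proof.
move=> k a b /=; apply: DBlU => d; rewrite tmap_l_lin; [|qmem|qmem].
by rewrite !DBlE DeltaB_lin.
Qed.

Lemma DBl_linr a : linear (DBl L a).
Proof.
move=> k c c'; apply: DBlU => d; rewrite tmap_l_lin; [|qmem|qmem].
by rewrite !DBlE -DeltaB_end; congr DeltaB; rewrite -(otimes_linl).
Qed.

Lemma DBr_xl a c x : B x -> DBr L (x *> a) c = tmap id (fun q => x *> q) (DBr L a c).
Proof.
move=> Bx; apply: DBrU => b; rewrite tmap_lM; [|qmem|qmem].
rewrite DeltaB_xl // -DBrE tmap_lM; [|qmem|qmem]; exact: eq_tmap_l.
Qed.

Lemma DBr_yl a c y : C y -> DBr L (y *> a) c = tmap (fun p => y *> p) id (DBr L a c).
Proof.
move=> Cy; apply: DBrU => b; rewrite tmap_lM; [|qmem|qmem].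
rewrite DeltaB_yl // -DBrE tmap_lM; [|qmem|qmem].
by apply: eq_tmap_l => // u; rewrite multl_mul //; qmem.
Qed.

Lemma DBr_yr a c y : C y -> DBr L (a <* y) c = tmap (fun p => p <* y) id (DBr L a c).
Proof.
move=> Cy; apply: DBrU => b; rewrite tmap_lM; [|qmem|qmem].
rewrite DeltaB_yr // tmap_lE; [|qmem|qmem]; rewrite -DBrE.
by apply: eq_tmap_l => // u; rewrite mul_mult //; qmem.
Qed.

Lemma DBr_xr a c x : B x -> DBr L (a <* x) c = DBr L a (x *> c).
Proof.
move=> Bx; apply: DBrU => b; rewrite DeltaB_xr // tmap_lE; [|qmem|qmem].
by rewrite DBrE.
Qed.

(** In [tens_l] one has b (x) S_B(x) c = x b (x) c, so the test element b is replaced by x b, that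
    is, x lands on the right of the first leg. *)
Lemma DBr_SB a c x : B x -> DBr L a (S_B x *> c) = tmap (fun p => p <* x) id (DBr L a c).
Proof.
move=> Bx; apply: DBrU => b; rewrite tmap_lM; [|qmem|qmem].
have -> : (otimes b (S_B x *> c) : tens_l A) = otimes (x *> b) c.
  by rewrite otimes_l.
rewrite -DBrE.
by apply: eq_tmap_l => // u; rewrite mul_mult //; qmem.
Qed.

Lemma DBr_mul a b c : DBr L (a ** b) c = DeltaB L a (DBr L b c).
Proof.
by apply: DBrU => d; rewrite -DeltaB_mulr1 DBrE DeltaB_mul.
Qed.

Lemma DBl_xl a c x : B x -> DBl L (x *> a) c = tmap id (fun q => x *> q) (DBl L a c).
Proof.
move=> Bx; apply: DBlU => b; rewrite tmap_lM; [|qmem|qmem].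
rewrite DeltaB_xl // -DBlE tmap_lM; [|qmem|qmem].
by apply: eq_tmap_l => // u; rewrite multl_mul //; qmem.
Qed.

Lemma DBl_yl a c y : C y -> DBl L (y *> a) c = tmap (fun p => y *> p) id (DBl L a c).
Proof.
move=> Cy; apply: DBlU => b; rewrite tmap_lM; [|qmem|qmem].
rewrite DeltaB_yl // -DBlE tmap_lM; [|qmem|qmem]; exact: eq_tmap_l.
Qed.

Lemma DBl_xr a c x : B x -> DBl L (a <* x) c = tmap id (fun q => q <* x) (DBl L a c).
Proof.
move=> Cy; apply: DBlU => b; rewrite tmap_lM; [|qmem|qmem].
rewrite DeltaB_xr // tmap_lE; [|qmem|qmem]; rewrite -DBlE.
by apply: eq_tmap_l => // u; rewrite mul_mult //; qmem.
Qed.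

Lemma DBl_yr a c y : C y -> DBl L (a <* y) c = DBl L a (y *> c).
Proof.
move=> Bx; apply: DBlU => b; rewrite DeltaB_yr // tmap_lE; [|qmem|qmem].
by rewrite DBlE.
Qed.

Lemma DBl_mul a b c : DBl L (a ** b) c = DeltaB L a (DBl L b c).
Proof.
by apply: DBlU => d; rewrite -DeltaB_mulr2 DBlE DeltaB_mul.
Qed.

End LeftComultiplication.

(** * The mirror rules for the right comultiplication *)

Section RightComultiplication.
Context (K : fieldType) (A : quantum_graph K) (R : right_comultiplication A).
Implicit Types (a b c d : A) (x y z : dcent A) (t : tens_r A).
Local Notation B := (qg_B A).
Local Notation C := (qg_C A).

Lemma DClE a b c :
  tmap id (fun q => b ** q) (DCl R a c) = DeltaC R c (otimes a b).
Proof. by rewrite (DClP R a c (DCl R a c)).2. Qed.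

Lemma DCrE a b c :
  tmap (fun p => a ** p) id (DCr R b c) = DeltaC R c (otimes a b).
Proof. by rewrite (DCrP R b c (DCr R b c)).2. Qed.

Lemma DClU a c t :
  (forall b, tmap id (fun q => b ** q) t = DeltaC R c (otimes a b)) -> DCl R a c = t.
Proof. by move=> h; apply/esym/DClP => b; rewrite h. Qed.

Lemma DCrU b c t :
  (forall a, tmap (fun p => a ** p) id t = DeltaC R c (otimes a b)) -> DCr R b c = t.
Proof. by move=> h; apply/esym/DCrP => a; rewrite h. Qed.

Lemma DeltaC0 t : DeltaC R 0 t = 0.
Proof. exact: (linear_at0 (DeltaC_lin R t)). Qed.

Lemma DeltaC_xl a x t : B x ->
  DeltaC R (x *> a) t = DeltaC R a (tmap id (fun q => q <* x) t).
Proof.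
move=> Bx; move: a t; apply: quantum_graph_ind => [t|a b IHa IHb t|x0 y a x' y' Bx0 Cy Bx' Cy' t].
- by rewrite (linear_at0 (multl_linear (multiplierB Bx))) !DeltaC0.
- by rewrite (linear_add _ _ (multl_linear (multiplierB Bx))) !(linear_add _ _ (DeltaC_lin R _)) IHa IHb.
rewrite (DeltaC_cov R _ (x := mulM x x0)) //; last qmem.
rewrite DeltaC_cov // tmap_rM; [|qmem|qmem].
by congr (tmap _ _ (DeltaC R a _)); exact: eq_tmap_r.
Qed.

Lemma DeltaC_yl a y t : C y ->
  DeltaC R (y *> a) t = DeltaC R a (tmap (fun p => p <* y) id t).
Proof.
move=> Cy; move: a t; apply: quantum_graph_ind => [t|a b IHa IHb t|x y0 a x' y' Bx Cy0 Bx' Cy' t].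
- by rewrite (linear_at0 (multl_linear (multiplierC Cy))) !DeltaC0.
- by rewrite (linear_add _ _ (multl_linear (multiplierC Cy))) !(linear_add _ _ (DeltaC_lin R _)) IHa IHb.
rewrite -multl_BC // (DeltaC_cov R _ (y := mulM y y0)) //; last qmem.
rewrite DeltaC_cov // tmap_rM; [|qmem|qmem].
by congr (tmap _ _ (DeltaC R a _)); exact: eq_tmap_r.
Qed.

Lemma DeltaC_xr a x t : B x ->
  DeltaC R (a <* x) t = tmap id (fun q => q <* x) (DeltaC R a t).
Proof.
move=> Bx; move: a t; apply: quantum_graph_ind => [t|a b IHa IHb t|x0 y a x' y' Bx0 Cy Bx' Cy' t].
- by rewrite (linear_at0 (multr_linear (multiplierB Bx))) DeltaC0 linear_at0 //; apply: tmap_r_lin; qmem.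
- rewrite (linear_add _ _ (multr_linear (multiplierB Bx))) !(linear_add _ _ (DeltaC_lin R t)) IHa IHb.
  by rewrite [RHS]linear_add //; apply: tmap_r_lin; qmem.
rewrite -2?multl_multr; [|qmem..].
rewrite -multr_BC // (DeltaC_cov R _ (x' := mulM x' x)) //; last qmem.
rewrite DeltaC_cov // tmap_rM; [|qmem|qmem].
exact: eq_tmap_r.
Qed.

Lemma DeltaC_yr a y t : C y ->
  DeltaC R (a <* y) t = tmap (fun p => p <* y) id (DeltaC R a t).
Proof.
move=> Cy; move: a t; apply: quantum_graph_ind => [t|a b IHa IHb t|x y0 a x' y' Bx Cy0 Bx' Cy' t].
- by rewrite (linear_at0 (multr_linear (multiplierC Cy))) DeltaC0 linear_at0 //; apply: tmap_r_lin; qmem.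
- rewrite (linear_add _ _ (multr_linear (multiplierC Cy))) !(linear_add _ _ (DeltaC_lin R t)) IHa IHb.
  by rewrite [RHS]linear_add //; apply: tmap_r_lin; qmem.
rewrite -2?multl_multr; [|qmem..].
rewrite (DeltaC_cov R _ (y' := mulM y' y)) //; last qmem.
rewrite DeltaC_cov // tmap_rM; [|qmem|qmem].
exact: eq_tmap_r.
Qed.

Lemma DeltaC_mull2 a b t :
  DeltaC R a (tmap id (fun p => b ** p) t) = tmap id (fun p => b ** p) (DeltaC R a t).
Proof.
have l1 : linear (tmap id (fun p => b ** p) : tens_r A -> tens_r A).
  by apply: tmap_r_lin; qmem.
move: t; apply: tens_ext => [k u v|k u v|p q].
- by rewrite l1 DeltaC_end.
- by rewrite DeltaC_end l1.
rewrite tmap_rE; [|qmem|qmem].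
rewrite -!DClE tmap_rM; [|qmem|qmem].
by apply: eq_tmap_r => // u; rewrite qmulA.
Qed.

Lemma DCl_linr c : linear (DCl R c).
Proof.
move=> k a b /=; apply: DClU => d; rewrite tmap_r_lin; [|qmem|qmem].
by rewrite !DClE DeltaC_lin.
Qed.

Lemma DCl_linl a : linear (fun c => DCl R c a).
Proof.
move=> k c c'; apply: DClU => d; rewrite tmap_r_lin; [|qmem|qmem].
by rewrite !DClE -DeltaC_end; congr DeltaC; rewrite -(otimes_linl).
Qed.

Lemma DCl_xl a c x : B x -> DCl R a (x *> c) = tmap id (fun q => x *> q) (DCl R a c).
Proof.
move=> Bx; apply: DClU => b; rewrite tmap_rM; [|qmem|qmem].
rewrite DeltaC_xl // tmap_rE; [|qmem|qmem]; rewrite -DClE.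
by apply: eq_tmap_r => // u; rewrite mul_mult //; qmem.
Qed.

Lemma DCl_yl a c y : C y -> DCl R a (y *> c) = DCl R (a <* y) c.
Proof.
move=> Cy; apply: DClU => b; rewrite DeltaC_yl // tmap_rE; [|qmem|qmem].
by rewrite DClE.
Qed.

Lemma DCl_yr a c y : C y -> DCl R a (c <* y) = tmap (fun p => p <* y) id (DCl R a c).
Proof.
move=> Cy; apply: DClU => b; rewrite tmap_rM; [|qmem|qmem].
rewrite DeltaC_yr // -DClE tmap_rM; [|qmem|qmem]; exact: eq_tmap_r.
Qed.

(** In [tens_r] one has a S_C(y) (x) b = a (x) b y, so the test element b is replaced by b y and y
    lands on the left of the second leg. *)
Lemma DCl_SC a c y : C y -> DCl R (a <* S_C y) c = tmap id (fun q => y *> q) (DCl R a c).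
Proof.
move=> Cy; apply: DClU => b; rewrite tmap_rM; [|qmem|qmem].
have -> : (otimes (a <* S_C y) b : tens_r A) = otimes a (b <* y).
  by rewrite otimes_r.
rewrite -DClE.
by apply: eq_tmap_r => // u; rewrite mul_mult //; qmem.
Qed.

Lemma DCl_mul a b c : DCl R a (b ** c) = DeltaC R c (DCl R a b).
Proof.
by apply: DClU => d; rewrite -DeltaC_mull2 DClE DeltaC_mul.
Qed.

Lemma DCr_yl a c y : C y -> DCr R a (y *> c) = tmap (fun p => y *> p) id (DCr R a c).
Proof.
move=> Bx; apply: DCrU => b; rewrite tmap_rM; [|qmem|qmem].
rewrite DeltaC_yl // tmap_rE; [|qmem|qmem]; rewrite -DCrE.
by apply: eq_tmap_r => // u; rewrite mul_mult //; qmem.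
Qed.

Lemma DCr_xr a c x : B x -> DCr R a (c <* x) = tmap id (fun q => q <* x) (DCr R a c).
Proof.
move=> Bx; apply: DCrU => b; rewrite tmap_rM; [|qmem|qmem].
rewrite DeltaC_xr // -DCrE tmap_rM; [|qmem|qmem]; exact: eq_tmap_r.
Qed.

End RightComultiplication.

(** * Module maps into [B] and [C] and their Sweedler sums *)

Section LinearOn.
Context (K : fieldType) (U V : lmodType K) (P : set U) (F : U -> V).
Hypotheses (sP : subspace P) (lF : linear_on P F).

Lemma lin_on0 : F 0 = 0.
Proof. by case: sP => P0 _; have := lF (-1) P0 P0; rewrite scaler0 addr0 scaleN1r addNr. Qed.

Lemma subspace_sum (I : eqType) (r : seq I) (G : I -> U) :
  (forall i, i \in r -> P (G i)) -> P (\sum_(i <- r) G i).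
Proof.
case: sP => P0 PD PG; rewrite big_seq; elim/big_ind: _ => // x y Px Py.
by rewrite -[x]scale1r; exact: PD.
Qed.

Lemma lin_on_sum (I : eqType) (r : seq I) (G : I -> U) :
  (forall i, i \in r -> P (G i)) -> F (\sum_(i <- r) G i) = \sum_(i <- r) F (G i).
Proof.
elim: r => [|i r IHr] PG; first by rewrite !big_nil lin_on0.
have PG' j : j \in r -> P (G j) by move=> jr; apply: PG; rewrite in_cons jr orbT.
rewrite !big_cons -[G i]scale1r lF ?scale1r ?IHr //.
  by apply: PG; rewrite mem_head.
exact: subspace_sum.
Qed.

End LinearOn.

Section TliftOn.
Context (K : fieldType) (V W : lmodType K) (X : Type) (D : set X).
Context (f : X -> V -> V) (g : X -> W -> W).
Context (U U' : lmodType K) (P : set U) (F : U -> U') (h : V -> W -> U).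
Hypotheses (sP : subspace P) (Ph : forall v w, P (h v w)).
Local Notation T := (tens D f g).

Lemma tlift_in (t : T) : P (tlift h t).
Proof. by apply: subspace_sum. Qed.

(** [S_B], [S_C] and the weights are linear only on [B] or [C]; they pass through a Sweedler sum
    because its summands stay in that subspace. *)
Lemma tlift_comp_on (t : T) : linear_on P F ->
  F (tlift h t) = tlift (fun v w => F (h v w)) t.
Proof. by move=> lF; apply: (lin_on_sum sP). Qed.

End TliftOn.

Section Forms.
Context (K : fieldType) (A : quantum_graph K).
Implicit Types (a b c : A) (x y z : dcent A) (f g : A -> dcent A).
Local Notation B := (qg_B A).
Local Notation C := (qg_C A).
Local Notation isM := (multiplier (@Defs.mul K A)).

Lemma subspaceB : subspace B. Proof. by case: (qg_algB A). Qed.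
Lemma subspaceC : subspace C. Proof. by case: (qg_algC A). Qed.

Lemma mulM_linr x : isM x -> linear (fun z => mulM x z : dcent A).
Proof.
move=> mx k u v; congr (_, _); apply/funext => a //=; exact: (multl_linear mx).
Qed.

Lemma mulM_linl x : isM x -> linear (fun z => mulM z x : dcent A).
Proof.
move=> mx k u v; congr (_, _); apply/funext => a //=; exact: (multr_linear mx).
Qed.

(** The four records describe the module maps _B w, w_B, _C w and w_C of an adapted functional w, in
    this order. *)
Record lBform f : Prop := { lB_in : forall a, B (f a); lB_lin : linear f;
  lB_mod : forall x a, B x -> f (x *> a) = mulM x (f a) }.
Record rBform f : Prop := { rB_in : forall a, B (f a); rB_lin : linear f;
  rB_mod : forall x a, B x -> f (a <* x) = mulM (f a) x }.
Record lCform f : Prop := { lC_in : forall a, C (f a); lC_lin : linear f;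
  lC_mod : forall x a, C x -> f (x *> a) = mulM x (f a) }.
Record rCform f : Prop := { rC_in : forall a, C (f a); rC_lin : linear f;
  rC_mod : forall x a, C x -> f (a <* x) = mulM (f a) x }.

(** Anti-multiplicativity of [S_B] matches the relation of [tens_l]: S_B(x f(u)) v = S_B(f(u))
    S_B(x) v. *)
Lemma balanced_SB f : lBform f -> bal_l A (fun u v => S_B (f u) *> v).
Proof.
move=> [fin fl fm]; split=> [w k u v|v k u w|x v w Bx] /=.
- by rewrite fl S_BD.
- by rewrite multlD //; apply/multiplierC/S_B_in.
- by rewrite fm // S_BM.
Qed.

Lemma balanced_SBinv f : lCform f -> bal_l A (fun u v => SBinv (f v) *> u).
Proof.
move=> [fin fl fm]; split=> [w k u v|v k u w|x v w Bx] /=.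
- by rewrite multlD //; apply/multiplierB/SBinv_in.
- by rewrite fl SBinvD.
- by rewrite fm ?SBinvM ?S_BK //; exact: S_B_in.
Qed.

Lemma balanced_SCinv f : rBform f -> bal_r A (fun u v => v <* SCinv (f u)).
Proof.
move=> [fin fl fm]; split=> [w k u v|v k u w|x v w Bx] /=.
- by rewrite fl SCinvD.
- by rewrite multrD //; apply/multiplierC/SCinv_in.
- by rewrite fm ?SCinvM ?S_CK //; exact: S_C_in.
Qed.

Lemma balanced_SC f : rCform f -> bal_r A (fun u v => u <* S_C (f v)).
Proof.
move=> [fin fl fm]; split=> [w k u v|v k u w|x v w Bx] /=.
- by rewrite multrD //; apply/multiplierB/S_C_in.
- by rewrite fl S_CD.
- by rewrite fm // S_CM.
Qed.

Lemma S_B_linear_on : linear_on B (@S_B K A). Proof. by move=> *; exact: S_BD. Qed.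
Lemma S_C_linear_on : linear_on C (@S_C K A). Proof. by move=> *; exact: S_CD. Qed.

End Forms.

(** * Evaluating coassociativity; surjectivity of the canonical maps *)

Section Swap.
Context (K : fieldType) (A : quantum_graph K) (U : lmodType K).
Context (L : left_comultiplication A) (R : right_comultiplication A).
Implicit Types (a b c d : A).

(** Both sides evaluate h at Delta_B(a)(d (x) b), with one of the factors b, d multiplied in before
    the other. *)
Lemma DB_swap (h : A -> A -> U) a b d : bal_l A h ->
  tlift (fun u v => h u (v ** b)) (DBl L a d) =
  tlift (fun u v => h (u ** d) v) (DBr L a b).
Proof.
move=> bh; have := congr1 (tlift h) (DBlE L a d b).
by rewrite -DBrE !tlift_tmap.
Qed.

Lemma DeltaB_l (h : A -> A -> U) a b d : bal_l A h ->
  tlift h (DeltaB L a (otimes d b)) = tlift (fun u v => h u (v ** b)) (DBl L a d).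
Proof. by move=> bh; rewrite -DBlE tlift_tmap. Qed.

Lemma DC_swap (h : A -> A -> U) a b d : bal_r A h ->
  tlift (fun u v => h u (b ** v)) (DCl R d a) =
  tlift (fun u v => h (d ** u) v) (DCr R b a).
Proof.
move=> bh; have := congr1 (tlift h) (DClE R d b a).
by rewrite -DCrE !tlift_tmap.
Qed.

End Swap.

Section TripleTensor.
Context (K : fieldType) (A : multiplier_bialgebroid K) (U : lmodType K).
Implicit Types (a b c : A) (H : A -> A -> A -> U).
Local Notation B := (qg_B A).
Local Notation C := (qg_C A).

Definition trilinear H := [/\ forall u v, linear (fun p => H p u v),
  forall p v, linear (fun u => H p u v) & forall p u, linear (fun v => H p u v)].

(** Coassociativity is an equation in an iterated quotient. The first balancing condition lets H
    descend to the inner quotient, the second one to the outer. *)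
Lemma coassoc_apply H a b c : trilinear H ->
  (forall x p u v, B x -> H (x *> p) u v = H p (S_B x *> u) v) ->
  (forall x p u v, B x -> H p (x *> u) v = H p u (S_B x *> v)) ->
  tlift (fun p q => tlift (fun u v => H u v q) (DBl A p a)) (DBr A b c) =
  tlift (fun p q => tlift (fun u v => H p u v) (DBr A q c)) (DBl A b a).
Proof.
move=> [H1 H2 H3] h1 h2.
have bH v : bal_l A (fun p u => H p u v) by split=> *; rewrite ?H1 ?H2 ?h1.
pose G (t : tens_l A) v := tlift (fun p u => H p u v) t.
have bG : balanced B (fun x => tmap id (fun b => x *> b) : tens_l A -> tens_l A)
    (fun x c => S_B x *> c) G.
  split=> [w k u v|t k u v|x t v Bx].
  - by rewrite /G (tlift_lin (bH w)).
  - rewrite /G /tlift scaler_sumr -big_split; apply: eq_bigr => p _; exact: H3.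
  - by rewrite /G tlift_tmap //; apply: eq_tlift => p u; rewrite h2.
have := congr1 (tlift G) (DeltaB_coassoc A a b c).
rewrite !tlift_tlift // => E; apply: etrans; last (apply: etrans; [exact: E|]).
  by apply: eq_tlift => p q; rewrite tliftE.
apply: eq_tlift => p q; rewrite tlift_tlift //; apply: eq_tlift => u v.
by rewrite tliftE // /G tliftE.
Qed.

Lemma mixed_lr_apply H a b c : trilinear H ->
  (forall x p u v, B x -> H (x *> p) u v = H p (S_B x *> u) v) ->
  (forall y p u v, C y -> H p (u <* S_C y) v = H p u (v <* y)) ->
  tlift (fun p q => tlift (fun u v => H u v q) (DBl A p a)) (DCr A c b) =
  tlift (fun p q => tlift (fun u v => H p u v) (DCr A c q)) (DBl A b a).
Proof.
move=> [H1 H2 H3] h1 h2.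
have bH v : bal_l A (fun p u => H p u v) by split=> *; rewrite ?H1 ?H2 ?h1.
pose G (t : tens_l A) v := tlift (fun p u => H p u v) t.
have bG : balanced C (fun y => tmap id (fun b => b <* S_C y) : tens_l A -> tens_l A)
    (fun y c => c <* y) G.
  split=> [w k u v|t k u v|x t v Bx].
  - by rewrite /G (tlift_lin (bH w)).
  - rewrite /G /tlift scaler_sumr -big_split; apply: eq_bigr => p _; exact: H3.
  - by rewrite /G tlift_tmap //; apply: eq_tlift => p u; rewrite h2.
have := congr1 (tlift G) (@mb_mixed_lr K A a b c).
rewrite !tlift_tlift // => E; apply: etrans; last (apply: etrans; [exact: E|]).
  by apply: eq_tlift => p q; rewrite tliftE.
apply: eq_tlift => p q; rewrite tlift_tlift //; apply: eq_tlift => u v.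
by rewrite tliftE // /G tliftE.
Qed.

Lemma mixed_rl_apply H a b c : trilinear H ->
  (forall y p u v, C y -> H (p <* S_C y) u v = H p (u <* y) v) ->
  (forall x p u v, B x -> H p (x *> u) v = H p u (S_B x *> v)) ->
  tlift (fun p q => tlift (fun u v => H u v q) (DCl A a p)) (DBr A b c) =
  tlift (fun p q => tlift (fun u v => H p u v) (DBr A q c)) (DCl A a b).
Proof.
move=> [H1 H2 H3] h1 h2.
have bH v : bal_r A (fun p u => H p u v) by split=> *; rewrite ?H1 ?H2 ?h1.
pose G (t : tens_r A) v := tlift (fun p u => H p u v) t.
have bG : balanced B (fun x => tmap id (fun b => x *> b) : tens_r A -> tens_r A)
    (fun x c => S_B x *> c) G.
  split=> [w k u v|t k u v|x t v Bx].
  - by rewrite /G (tlift_lin (bH w)).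
  - rewrite /G /tlift scaler_sumr -big_split; apply: eq_bigr => p _; exact: H3.
  - by rewrite /G tlift_tmap //; apply: eq_tlift => p u; rewrite h2.
have := congr1 (tlift G) (@mb_mixed_rl K A a b c).
rewrite !tlift_tlift // => E; apply: etrans; last (apply: etrans; [exact: E|]).
  by apply: eq_tlift => p q; rewrite tliftE.
apply: eq_tlift => p q; rewrite tlift_tlift //; apply: eq_tlift => u v.
by rewrite tliftE // /G tliftE.
Qed.

End TripleTensor.

Section Regular.
Context (K : fieldType) (A : multiplier_bialgebroid K).
Hypothesis reg : regular_hopf A.
Implicit Types (a b c : A).
Local Notation B := (qg_B A).
Local Notation C := (qg_C A).

Lemma DBr_span (t : tens_l A) : exists s : seq (A * A), t = \sum_(p <- s) DBr A p.1 p.2.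
Proof. by case: reg => _ [g _ gK] _ _; exists (repr (g t)); rewrite -[LHS]gK. Qed.

Lemma DBl_span (t : tens_l A) : exists s : seq (A * A), t = \sum_(p <- s) DBl A p.2 p.1.
Proof. by case: reg => [[g _ gK] _ _ _]; exists (repr (g t)); rewrite -[LHS]gK. Qed.

Lemma DCl_span (t : tens_r A) : exists s : seq (A * A), t = \sum_(p <- s) DCl A p.1 p.2.
Proof. by case: reg => _ _ [g _ gK] _; exists (repr (g t)); rewrite -[LHS]gK. Qed.

(** This is how surjectivity of [T_rho] is used: linear maps on [tens_l] are compared on the
    elements [DBr], where counits and invariance apply directly. *)
Lemma DBr_ext (U : lmodType K) (F G : tens_l A -> U) : linear F -> linear G ->
  (forall u v, F (DBr A u v) = G (DBr A u v)) -> F =1 G.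
Proof.
move=> lF lG E t; have [s ->] := DBr_span t.
by rewrite !linear_bigsum //; apply: eq_bigr => p _.
Qed.

Lemma DCl_ext (U : lmodType K) (F G : tens_r A -> U) : linear F -> linear G ->
  (forall u v, F (DCl A u v) = G (DCl A u v)) -> F =1 G.
Proof.
move=> lF lG E t; have [s ->] := DCl_span t.
by rewrite !linear_bigsum //; apply: eq_bigr => p _.
Qed.

End Regular.

(** * Base weights and the module maps of adapted functionals *)

Section FaithfulFunctional.
Context (K : fieldType) (A : quantum_graph K) (P : set (dcent A)) (mu : dcent A -> K^o).
Hypotheses (sP : subspace P) (PM : forall x z, P x -> P z -> P (mulM x z)).
Hypotheses (mP : forall x, P x -> multiplier (@Defs.mul K A) x).
Hypotheses (lmu : linear_on P mu) (fmu : faithful_functional P (@mulM K A) mu).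
Implicit Types (x z : dcent A).

Lemma faithful_injl z z' : P z -> P z' ->
  (forall x, P x -> mu (mulM x z) = mu (mulM x z')) -> z = z'.
Proof.
move=> Pz Pz' E; apply/eqP; rewrite -subr_eq0; apply/negPn/negP => zz'.
have Pd : P (z - z') by rewrite addrC -scaleN1r; apply sP.
have [_ [x Px]] := fmu Pd zz'.
rewrite addrC -scaleN1r (mulM_linr (mP Px)) lmu; [|exact: PM|exact: PM].
by rewrite E // scaleN1r addNr eqxx.
Qed.

Lemma faithful_injr z z' : P z -> P z' ->
  (forall x, P x -> mu (mulM z x) = mu (mulM z' x)) -> z = z'.
Proof.
move=> Pz Pz' E; apply/eqP; rewrite -subr_eq0; apply/negPn/negP => zz'.
have Pd : P (z - z') by rewrite addrC -scaleN1r; apply sP.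
have [[x Px +] _] := fmu Pd zz'.
rewrite addrC -scaleN1r (mulM_linl (mP Px)) lmu; [|exact: PM|exact: PM].
by rewrite E // scaleN1r addNr eqxx.
Qed.

End FaithfulFunctional.

Section Weights.
Context (K : fieldType) (A : multiplier_bialgebroid K).
Context (muB muC : dcent A -> K^o) (bw : base_weight muB muC).
Implicit Types (a b c d : A) (x y z : dcent A) (w : A -> K^o) (f g : A -> dcent A).
Local Notation B := (qg_B A).
Local Notation C := (qg_C A).

Lemma muBD k x y : B x -> B y -> muB (k *: x + y) = k *: muB x + muB y.
Proof. exact: (bw_linB bw). Qed.
Lemma muCD k x y : C x -> C y -> muC (k *: x + y) = k *: muC x + muC y.
Proof. exact: (bw_linC bw). Qed.

Lemma muB_injl z z' : B z -> B z' ->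
  (forall x, B x -> muB (mulM x z) = muB (mulM x z')) -> z = z'.
Proof.
by apply: faithful_injl; [exact: subspaceB|exact: qgB_mul|exact: multiplierB|exact: (bw_linB bw)|exact: (bw_faithfulB bw)].
Qed.
Lemma muB_injr z z' : B z -> B z' ->
  (forall x, B x -> muB (mulM z x) = muB (mulM z' x)) -> z = z'.
Proof.
by apply: faithful_injr; [exact: subspaceB|exact: qgB_mul|exact: multiplierB|exact: (bw_linB bw)|exact: (bw_faithfulB bw)].
Qed.
Lemma muC_injl z z' : C z -> C z' ->
  (forall x, C x -> muC (mulM x z) = muC (mulM x z')) -> z = z'.
Proof.
by apply: faithful_injl; [exact: subspaceC|exact: qgC_mul|exact: multiplierC|exact: (bw_linC bw)|exact: (bw_faithfulC bw)].
Qed.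
Lemma muC_injr z z' : C z -> C z' ->
  (forall x, C x -> muC (mulM z x) = muC (mulM z' x)) -> z = z'.
Proof.
by apply: faithful_injr; [exact: subspaceC|exact: qgC_mul|exact: multiplierC|exact: (bw_linC bw)|exact: (bw_faithfulC bw)].
Qed.

Lemma muSB x : B x -> muC (S_B x) = muB x. Proof. exact: (bw_SB bw). Qed.
Lemma muSC y : C y -> muB (S_C y) = muC y. Proof. exact: (bw_SC bw). Qed.

(** [is_Bl] asks for no linearity of f. It is forced, since the faithful [muB] separates elements of
    [B] and w(z x a) can be read as muB(z f(x a)) and as muB(z x f(a)). *)
Lemma is_Bl_form w f : linear w -> is_Bl muB w f -> lBform f.
Proof.
move=> lw h; have fin a : B (f a) by case: (h a).
have fE a x : B x -> w (x *> a) = muB (mulM x (f a)) by case: (h a) => _; apply.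
split=> // [k u v|x a Bx]; apply: muB_injl => // [|z Bz]; try qmem.
- rewrite -fE // multlD; last qmem.
  by rewrite lw !fE // mulM_linr ?muBD //; qmem.
- by rewrite -fE // -(fE a (mulM z x)) //; qmem.
Qed.

Lemma is_Br_form w f : linear w -> is_Br muB w f -> rBform f.
Proof.
move=> lw h; have fin a : B (f a) by case: (h a).
have fE a x : B x -> w (a <* x) = muB (mulM (f a) x) by case: (h a) => _; apply.
split=> // [k u v|x a Bx]; apply: muB_injr => // [|z Bz]; try qmem.
- rewrite -fE // multrD; last qmem.
  by rewrite lw !fE // mulM_linl ?muBD //; qmem.
- by rewrite -fE // -(fE a (mulM x z)) //; qmem.
Qed.

Lemma is_Cl_form w f : linear w -> is_Cl muC w f -> lCform f.
Proof.
move=> lw h; have fin a : C (f a) by case: (h a).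
have fE a x : C x -> w (x *> a) = muC (mulM x (f a)) by case: (h a) => _; apply.
split=> // [k u v|x a Bx]; apply: muC_injl => // [|z Bz]; try qmem.
- rewrite -fE // multlD; last qmem.
  by rewrite lw !fE // mulM_linr ?muCD //; qmem.
- by rewrite -fE // -(fE a (mulM z x)) //; qmem.
Qed.

Lemma is_Cr_form w f : linear w -> is_Cr muC w f -> rCform f.
Proof.
move=> lw h; have fin a : C (f a) by case: (h a).
have fE a x : C x -> w (a <* x) = muC (mulM (f a) x) by case: (h a) => _; apply.
split=> // [k u v|x a Bx]; apply: muC_injr => // [|z Bz]; try qmem.
- rewrite -fE // multrD; last qmem.
  by rewrite lw !fE // mulM_linl ?muCD //; qmem.
- by rewrite -fE // -(fE a (mulM x z)) //; qmem.
Qed.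

Lemma Bl_E w f : is_Bl muB w f -> Bl muB w = f.
Proof.
move=> h; rewrite /Bl; case: xgetP => [g _ hg|/(_ f)//].
apply/funext => a; have [[Ba Ea] [Ba' Ea']] := (h a, hg a).
by apply: muB_injl => // x Bx; rewrite -Ea // Ea'.
Qed.

Lemma Br_E w f : is_Br muB w f -> Br muB w = f.
Proof.
move=> h; rewrite /Br; case: xgetP => [g _ hg|/(_ f)//].
apply/funext => a; have [[Ba Ea] [Ba' Ea']] := (h a, hg a).
by apply: muB_injr => // x Bx; rewrite -Ea // Ea'.
Qed.

Lemma Cl_E w f : is_Cl muC w f -> Cl muC w = f.
Proof.
move=> h; rewrite /Cl; case: xgetP => [g _ hg|/(_ f)//].
apply/funext => a; have [[Ba Ea] [Ba' Ea']] := (h a, hg a).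
by apply: muC_injl => // x Bx; rewrite -Ea // Ea'.
Qed.

Lemma Cr_E w f : is_Cr muC w f -> Cr muC w = f.
Proof.
move=> h; rewrite /Cr; case: xgetP => [g _ hg|/(_ f)//].
apply/funext => a; have [[Ba Ea] [Ba' Ea']] := (h a, hg a).
by apply: muC_injr => // x Bx; rewrite -Ea // Ea'.
Qed.

Lemma adapted_lin w : adapted muB muC w -> linear w. Proof. by case. Qed.
Lemma adapted_Bl w : adapted muB muC w -> is_Bl muB w (Bl muB w).
Proof. by case=> _ [[f h] _ _ _]; rewrite (Bl_E h). Qed.
Lemma adapted_Br w : adapted muB muC w -> is_Br muB w (Br muB w).
Proof. by case=> _ [_ [f h] _ _]; rewrite (Br_E h). Qed.
Lemma adapted_Cl w : adapted muB muC w -> is_Cl muC w (Cl muC w).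
Proof. by case=> _ [_ _ [f h] _]; rewrite (Cl_E h). Qed.
Lemma adapted_Cr w : adapted muB muC w -> is_Cr muC w (Cr muC w).
Proof. by case=> _ [_ _ _ [f h]]; rewrite (Cr_E h). Qed.

Context (eB eC : A -> dcent A).
Hypotheses (leB : left_counit eB) (leC : right_counit eC).
Hypothesis mu_e : forall a, muB (eB a) = muC (eC a).

Lemma bal_eB : bal_l A (fun u v => eB v *> u).
Proof.
split=> [w k u v|v k u w|x v w Bx] /=.
- by rewrite multlD //; apply/multiplierB/lcounit_range.
- by rewrite (lcounit_linear leB).
- by rewrite (lcounit_SB leB).
Qed.

Lemma bal_SBeB : bal_l A (fun u v => S_B (eB u) *> v).
Proof.
by apply: balanced_SB; split; [exact: lcounit_range|exact: lcounit_linear|exact: lcounit_B].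
Qed.

Lemma bal_SCeC : bal_r A (fun u v => u <* S_C (eC v)).
Proof.
by apply: balanced_SC; split; [exact: rcounit_range|exact: rcounit_linear|exact: rcounit_C].
Qed.

Lemma bal_eC : bal_r A (fun u v => v <* eC u).
Proof.
split=> [w k u v|v k u w|x v w Bx] /=.
- by rewrite (rcounit_linear leC).
- by rewrite multrD //; apply/multiplierC/rcounit_range.
- by rewrite (rcounit_SC leC).
Qed.

(* For w with left B-module map f, the functional w(. d) has the right B-module
   map [Br_of f d], by the counit property p d = sum eB(p_2) p_1 d and the
   equality of the two counit functionals. *)
Definition Br_of f d p : dcent A :=
  S_C (tlift (fun u v => eC (S_B (f u) *> v)) (DBl A p d)).

Lemma Br_of_range f d p : C (tlift (fun u v => eC (S_B (f u) *> v)) (DBl A p d)).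
Proof. by apply: tlift_in => [|u v]; [exact: subspaceC|exact: rcounit_range]. Qed.

(** With p_1 d (x) p_2 for [DBl A p d], the counit gives w(p x d) = sum muB(eB(p_2 x) f(p_1 d)). The
    [S_B]-rule of eB moves f inside: the summand is muB(eB(S_B(f(p_1 d)) p_2 x)). Replacing muB o eB
    by muC o eC, the [S_C]-rule of eC lets x out again, on the other side. *)
Lemma is_Br_of w f d : linear w -> is_Bl muB w f ->
  is_Br muB (fun a => w (a ** d)) (Br_of f d).
Proof.
move=> lw h p; have ff := is_Bl_form lw h.
split=> [|x Bx]; first exact/S_C_in/Br_of_range.
have bf : bal_l A (fun u v => eC (S_B (f u) *> v)).
  by apply: balanced_comp (balanced_SB ff); exact: (rcounit_linear leC).
rewrite -(lcounit_r leB) DBl_xr // (tlift_tmap _ _ _ bal_eB).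
rewrite tlift_comp // -{2}(SCinvK Bx).
rewrite -S_CM ?muSC; [|apply: qgC_mul|apply: SCinv_in|exact: Br_of_range]; try qmem; last exact: Br_of_range.
rewrite (tlift_comp (F := fun z => mulM (SCinv x) z)); last by apply: mulM_linr; qmem.
rewrite (tlift_comp_on (P := C) (F := muC)) //.
- apply: eq_tlift => u v; rewrite (h u).2; last exact: (lcounit_range leB).
  rewrite -(lcounit_SB leB) ?mu_e; last by case: (h u).
  rewrite multl_multr; [|apply/multiplierC/S_B_in/(h u).1|qmem].
  by rewrite -{1}(SCinvK Bx) (rcounit_SC leC) //; qmem.
- exact: subspaceC.
- by move=> u v; apply: qgC_mul; [qmem|exact: (rcounit_range leC)].
- exact: (bw_linC bw).
Qed.

(** The analogue of [Br_of] for [C]: the right [C]-module map of w(. d), from the left one f of w,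
    by means of p d = sum S_B(eB(p_1)) p_2 d. *)
Definition Cr_of f d p : dcent A :=
  tlift (fun u v => eC (SBinv (f v) *> u)) (DBr A p d).

Lemma Cr_of_range f d p : C (Cr_of f d p).
Proof. by apply: tlift_in => [|u v]; [exact: subspaceC|exact: rcounit_range]. Qed.

Lemma is_Cr_of w f d : linear w -> is_Cl muC w f ->
  is_Cr muC (fun a => w (a ** d)) (Cr_of f d).
Proof.
move=> lw h p; have ff := is_Cl_form lw h.
split=> [|y Cy]; first exact: Cr_of_range.
rewrite -(lcounit_l leB) DBr_yr // (tlift_tmap _ _ _ bal_SBeB) tlift_comp //.
rewrite /Cr_of (tlift_comp (F := fun z => mulM z y)); last by apply: mulM_linl; qmem.
rewrite (tlift_comp_on (P := C) (F := muC)) //.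
- apply: eq_tlift => u v.
  have Cf := (h v).1; have Bu := lcounit_range leB (u <* y).
  rewrite (h v).2 -1?{1}(SBinvK Cf) -?S_BM ?muSB; try qmem.
  rewrite -(lcounit_B leB) ?mu_e; last qmem.
  by rewrite multl_multr ?(rcounit_C leC) //; qmem.
- exact: subspaceC.
- by move=> u v; apply: qgC_mul; [exact: (rcounit_range leC)|].
- exact: (bw_linC bw).
Qed.

(** The left [B]-module map of w(e .), where g is the right [B]-module map of w; it comes from e p =
    sum e p_1 S_C(eC(p_2)). *)
Definition Bl_of g e p : dcent A :=
  tlift (fun u v => eB (v <* SCinv (g u))) (DCl A e p).

Lemma Bl_of_range g e p : B (Bl_of g e p).
Proof. by apply: tlift_in => [|u v]; [exact: subspaceB|exact: lcounit_range]. Qed.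

Lemma is_Bl_of w g e : linear w -> is_Br muB w g ->
  is_Bl muB (fun a => w (e ** a)) (Bl_of g e).
Proof.
move=> lw h p; have gg := is_Br_form lw h.
split=> [|x Bx]; first exact: Bl_of_range.
rewrite -(rcounit_r leC) DCl_xl // (tlift_tmap _ _ _ bal_SCeC) tlift_comp //.
rewrite /Bl_of (tlift_comp (F := fun z => mulM x z)); last by apply: mulM_linr; qmem.
rewrite (tlift_comp_on (P := B) (F := muB)) //.
- apply: eq_tlift => u v.
  have Bg := (h u).1; have Cv := rcounit_range leC (x *> v).
  rewrite (h u).2 -1?{1}(SCinvK Bg) -?S_CM ?muSC; try qmem.
  rewrite -(rcounit_C leC) -?mu_e; last qmem.
  by rewrite -multl_multr ?(lcounit_B leB) //; qmem.
- exact: subspaceB.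
- by move=> u v; apply: qgB_mul; [|exact: (lcounit_range leB)].
- exact: (bw_linB bw).
Qed.

(* [lam f d] is lambda(w(. d)) and [rh f d] is rho(w(. d)), for f the left
   B-module, resp. C-module, map of w. *)
Definition lam f d a : A := tlift (fun u v => S_B (f u) *> v) (DBl A a d).
Definition rh f d a : A := tlift (fun u v => SBinv (f v) *> u) (DBr A a d).

Lemma lam_mulr f d a b : lBform f ->
  lam f d a ** b = tlift (fun p q => S_B (f (p ** d)) *> q) (DBr A a b).
Proof.
move=> ff; rewrite /lam (tlift_comp (F := fun a => a ** b)); last exact: qmul_linl.
rewrite -(DB_swap _ _ _ _ (balanced_SB ff)); apply: eq_tlift => u v.
by rewrite multl_mul //; apply/multiplierC/S_B_in/lB_in.
Qed.

Lemma rh_mulr f d a b : lCform f ->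
  rh f d a ** b = tlift (fun p q => SBinv (f (q ** d)) *> p) (DBl A a b).
Proof.
move=> ff; rewrite /rh (tlift_comp (F := fun a => a ** b)); last exact: qmul_linl.
rewrite (DB_swap _ _ _ _ (balanced_SBinv ff)); apply: eq_tlift => u v.
by rewrite multl_mul //; apply/multiplierB/SBinv_in/lC_in.
Qed.

(** After inserting [Br_of], the right side applies Delta_B to the first leg of Delta_C(a). Mixed
    coassociativity turns this into Delta_C on the second leg of Delta_B(a), where the counit
    formula of eC collapses it to multiplication by b. *)
Lemma lam_mull f d a b : lBform f ->
  b ** lam f d a = tlift (fun p q => q <* SCinv (Br_of f d p)) (DCr A b a).
Proof.
move=> ff; have Cf p : C (S_B (f p)) by apply/S_B_in/lB_in.
pose H p u v : A := v <* eC (S_B (f p) *> u).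
have -> : tlift (fun p q => q <* SCinv (Br_of f d p)) (DCr A b a) =
    tlift (fun p q => tlift (fun u v => H u v q) (DBl A p d)) (DCr A b a).
  apply: eq_tlift => p q; rewrite S_CK; last exact: Br_of_range.
  by rewrite (tlift_comp (F := fun z : dcent A => q <* z)).
rewrite mixed_lr_apply.
- rewrite /lam (tlift_comp (F := fun a => b ** a)); last exact: qmul_linr.
  apply: eq_tlift => p q.
  by rewrite -(rcounit_l leC) DCr_yl // (tlift_tmap _ _ _ bal_eC).
- split=> [u v k p p'|p v k u u'|p u k v v'] /=; rewrite /H.
  + by rewrite (lB_lin ff) S_BD ?(rcounit_linear leC) //; exact: (lB_in ff).
  + by rewrite multlD ?(rcounit_linear leC) //; qmem.
  + by rewrite multrD //; apply/multiplierC/rcounit_range.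
- move=> x p u v Bx; rewrite /H (lB_mod ff) // S_BM //; exact: (lB_in ff).
- move=> y p u v Cy; rewrite /H multl_multr; [|qmem..].
  by rewrite (rcounit_SC leC).
Qed.

Lemma rh_mull f d a b : lCform f ->
  b ** rh f d a = tlift (fun p q => p <* S_C (Cr_of f d q)) (DCl A b a).
Proof.
move=> ff; have Bf p : B (SBinv (f p)) by apply/SBinv_in/lC_in.
pose H p u v : A := p <* S_C (eC (SBinv (f v) *> u)).
have eCr := rcounit_range leC.
have -> : tlift (fun p q => p <* S_C (Cr_of f d q)) (DCl A b a) =
    tlift (fun p q => tlift (fun u v => H p u v) (DBr A q d)) (DCl A b a).
  apply: eq_tlift => p q; rewrite /Cr_of (tlift_comp_on (@subspaceC K A) (F := S_C)) //; last exact: S_C_linear_on.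
  by rewrite (tlift_comp (F := fun z : dcent A => p <* z)).
rewrite -mixed_rl_apply.
- rewrite /rh (tlift_comp (F := fun a => b ** a)); last exact: qmul_linr.
  apply: eq_tlift => p q.
  by rewrite -(rcounit_r leC) DCl_xl // (tlift_tmap _ _ _ bal_SCeC).
- split=> [u v k p p'|p v k u u'|p u k v v'] /=; rewrite /H.
  + by rewrite multrD //; apply/multiplierB/S_C_in.
  + by rewrite multlD ?(rcounit_linear leC) ?S_CD //; qmem.
  + by rewrite (lC_lin ff) SBinvD ?(rcounit_linear leC) ?S_CD //; exact: (lC_in ff).
- move=> y p u v Cy; rewrite /H multl_multr; [|qmem..].
  by rewrite (rcounit_C leC) // S_CM.
- move=> x p u v Bx; rewrite /H (lC_mod ff); last qmem.
  by rewrite SBinvM ?S_BK //; [qmem|exact: (lC_in ff)].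
Qed.

Lemma is_lambda_lam_form w f d : linear w -> is_Bl muB w f ->
  is_lambda muB (fun a => w (a ** d)) (lam f d).
Proof.
move=> lw h a b; have ff := is_Bl_form lw h.
have -> : Bl muB (fun a => w (a ** d)) = (fun a => f (a ** d)).
  apply: Bl_E => p; split=> [|x Bx]; first exact: (lB_in ff).
  by rewrite -(h (p ** d)).2 // multl_mul //; qmem.
by rewrite (Br_E (is_Br_of d lw h)) lam_mulr // lam_mull.
Qed.

Lemma is_rho_rh_form w f d : linear w -> is_Cl muC w f ->
  is_rho muC (fun a => w (a ** d)) (rh f d).
Proof.
move=> lw h a b; have ff := is_Cl_form lw h.
have -> : Cl muC (fun a => w (a ** d)) = (fun a => f (a ** d)).
  apply: Cl_E => p; split=> [|x Bx]; first exact: (lC_in ff).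
  by rewrite -(h (p ** d)).2 // multl_mul //; qmem.
by rewrite (Cr_E (is_Cr_of d lw h)) rh_mulr // rh_mull.
Qed.

End Weights.

Lemma span_ind (K : fieldType) (U V W : lmodType K) (P : set U) (Q : set V)
    (m : U -> V -> W) (S : W -> Prop) :
  span_prod P Q m = setT -> S 0 -> (forall w w', S w -> S w' -> S (w + w')) ->
  (forall u v, P u -> Q v -> S (m u v)) -> forall w, S w.
Proof.
move=> E S0 SD Sm w; have : [set: W] w by [].
rewrite -E => -[s [sP ->]]; rewrite big_seq.
by elim/big_ind: _ => // p /sP[]; exact: Sm.
Qed.

Lemma span_prodP (K : fieldType) (U V W : lmodType K) (P : set U) (Q : set V) (m : U -> V -> W) :
  [/\ span_prod P Q m 0,
    (forall w w', span_prod P Q m w -> span_prod P Q m w' -> span_prod P Q m (w + w')) &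
    (forall u v, P u -> Q v -> span_prod P Q m (m u v))].
Proof.
split=> [|w w' [s [sP ->]] [s' [sP' ->]]|u v Pu Qv].
- by exists [::]; rewrite big_nil.
- exists (s ++ s'); rewrite big_cat; split=> // p.
  by rewrite mem_cat => /orP[/sP|/sP'].
- by exists [:: (u, v)]; rewrite big_seq1; split=> // p; rewrite inE => /eqP ->.
Qed.

(** * Convolution operators of functionals w(. d) *)

Section Convolution.
Context (K : fieldType) (A : multiplier_bialgebroid K).
Context (muB muC : dcent A -> K^o) (bw : base_weight muB muC).
Implicit Types (a b c d e : A) (x y z : dcent A) (w : A -> K^o) (f g : A -> dcent A).
Local Notation B := (qg_B A).
Local Notation C := (qg_C A).

(** Two ways to evaluate the tensor product of w and w' relative to the base weight at u (x) v: both
    are muC(S_B(f(u)) g(v)), because muC o S_B = muB. *)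
Lemma pairing w w' f g u v : is_Bl muB w f -> is_Cl muC w' g ->
  w' (S_B (f u) *> v) = w (SBinv (g v) *> u).
Proof.
move=> hf hg; have [Bf Ef] := hf u; have [Cg Eg] := hg v.
rewrite Eg ?Ef; try qmem.
by rewrite -(muSB bw) ?S_BM ?SBinvK //; qmem.
Qed.

Lemma lam_xl f d a x : lBform f -> B x -> lam f d (x *> a) = x *> lam f d a.
Proof.
move=> ff Bx; rewrite /lam DBl_xl // (tlift_tmap _ _ _ (balanced_SB ff)).
rewrite (tlift_comp (F := fun q => x *> q)); last by apply/multl_linear; qmem.
by apply: eq_tlift => u v; rewrite (multl_BC _ Bx (S_B_in (lB_in ff u))).
Qed.

Lemma lam_xr f d a x : lBform f -> B x -> lam f d (a <* x) = lam f d a <* x.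
Proof.
move=> ff Bx; rewrite /lam DBl_xr // (tlift_tmap _ _ _ (balanced_SB ff)).
rewrite (tlift_comp (F := fun q => q <* x)); last by apply/multr_linear; qmem.
by apply: eq_tlift => u v; rewrite multl_multr //; [apply/multiplierC/S_B_in/lB_in|qmem].
Qed.

Lemma rh_yl f d a y : lCform f -> C y -> rh f d (y *> a) = y *> rh f d a.
Proof.
move=> ff Bx; rewrite /rh DBr_yl // (tlift_tmap _ _ _ (balanced_SBinv ff)).
rewrite (tlift_comp (F := fun q => y *> q)); last by apply/multl_linear; qmem.
by apply: eq_tlift => u v; rewrite multl_BC //; apply/SBinv_in/lC_in.
Qed.

Lemma rh_yr f d a y : lCform f -> C y -> rh f d (a <* y) = rh f d a <* y.
Proof.
move=> ff Bx; rewrite /rh DBr_yr // (tlift_tmap _ _ _ (balanced_SBinv ff)).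
rewrite (tlift_comp (F := fun q => q <* y)); last by apply/multr_linear; qmem.
by apply: eq_tlift => u v; rewrite multl_multr //; [apply/multiplierB/SBinv_in/lC_in|qmem].
Qed.

Lemma lam_lin f d : lBform f -> linear (lam f d).
Proof.
by move=> ff k a b; rewrite /lam DBl_linl (tlift_lin (balanced_SB ff)).
Qed.

Lemma lam_lind f a : lBform f -> linear (fun d => lam f d a).
Proof.
by move=> ff k d e; rewrite /lam DBl_linr (tlift_lin (balanced_SB ff)).
Qed.

Lemma rh_lin f d : lCform f -> linear (rh f d).
Proof.
by move=> ff k a b; rewrite /rh DBr_linl (tlift_lin (balanced_SBinv ff)).
Qed.

Lemma rh_lind f a : lCform f -> linear (fun d => rh f d a).
Proof.
by move=> ff k d e; rewrite /rh DBr_linr (tlift_lin (balanced_SBinv ff)).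
Qed.

(** This is w' o lambda(w(. d)) = w(. d) o rho for the functional w'(. d'), stated elementwise: both
    sides are sums over [DBr A a d'], and [pairing] identifies the summands. *)
Lemma conv_swap w w' f g d d' a : linear w -> linear w' ->
  is_Bl muB w f -> is_Cl muC w' g ->
  w' (lam f d a ** d') = w (rh g d' a ** d).
Proof.
move=> lw lw' hf hg; have ff := is_Bl_form bw lw hf; have gg := is_Cl_form bw lw' hg.
rewrite lam_mulr // /rh (tlift_comp (F := fun a => a ** d)); last exact: qmul_linl.
rewrite !tlift_comp //; apply: eq_tlift => u v.
by rewrite (pairing _ _ hf hg) multl_mul //; apply/multiplierB/SBinv_in/lC_in.
Qed.

(** One operator evaluates the first leg of the comultiplication, the other the last leg. By
    coassociativity both composites evaluate the outer legs of the iterated comultiplication and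
    keep the middle one. *)
Lemma lam_rh_comm f g d e a : lBform f -> lCform g ->
  rh g e (lam f d a) = lam f d (rh g e a).
Proof.
move=> ff gg.
have Cf p : C (S_B (f p)) by apply/S_B_in/lB_in.
have Bg p : B (SBinv (g p)) by apply/SBinv_in/lC_in.
pose H p u v : A := S_B (f p) *> (SBinv (g v) *> u).
rewrite [in RHS]/rh [LHS](tlift_comp (F := rh g e)); last exact: rh_lin.
rewrite (tlift_comp (F := lam f d)); last exact: lam_lin.
transitivity (tlift (fun p q => tlift (fun u v => H p u v) (DBr A q e)) (DBl A a d)).
  apply: eq_tlift => p q; rewrite rh_yl // /rh.
  by rewrite (tlift_comp (F := fun q => S_B (f p) *> q)) //; apply/multl_linear; qmem.
rewrite -coassoc_apply.
- apply: eq_tlift => p q; rewrite lam_xl // /lam.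
  rewrite (tlift_comp (F := fun v => SBinv (g q) *> v)); last by apply/multl_linear; qmem.
  by apply: eq_tlift => u v; rewrite /H (multl_BC _ (Bg q) (Cf u)).
- split=> [u v k p p'|p v k u u'|p u k v v'] /=; rewrite /H.
  + by rewrite (lB_lin ff) S_BD //; exact: (lB_in ff).
  + by rewrite !multlD //; qmem.
  + by rewrite (lC_lin gg) SBinvD; [exact: (multl_linear (multiplierC (Cf p)))|exact: (lC_in gg)|exact: (lC_in gg)].
- move=> x p u v Bx; rewrite /H (lB_mod ff) // S_BM //; last exact: (lB_in ff).
  by rewrite /= -(multl_BC _ (Bg v) (S_B_in Bx)).
- move=> x p u v Bx; rewrite /H (lC_mod gg); last qmem.
  by rewrite SBinvM ?S_BK //; [qmem|exact: (lC_in gg)].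
Qed.

(** The products l(a) b determine l(a) by non-degeneracy, so the chosen operator is the explicit
    one. *)
Lemma lambda_E w l : is_lambda muB w l -> conv_lambda muB w = l.
Proof.
move=> h; rewrite /conv_lambda; case: xgetP => [g _ hg|/(_ l)//].
apply/funext => a; apply: qmul_injr => b.
by rewrite (h a b).1 (hg a b).1.
Qed.

Lemma rho_E w r : is_rho muC w r -> conv_rho muC w = r.
Proof.
move=> h; rewrite /conv_rho; case: xgetP => [g _ hg|/(_ r)//].
apply/funext => a; apply: qmul_injr => b.
by rewrite (h a b).1 (hg a b).1.
Qed.

Context (eB eC : A -> dcent A).
Hypotheses (leB : left_counit eB) (leC : right_counit eC).
Hypothesis mu_e : forall a, muB (eB a) = muC (eC a).

Lemma is_lambda_lam w d : adapted muB muC w ->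
  is_lambda muB (fun a => w (a ** d)) (lam (Bl muB w) d).
Proof.
move=> hw.
exact (is_lambda_lam_form bw leB leC mu_e d (adapted_lin hw) (adapted_Bl bw hw)).
Qed.

Lemma is_rho_rh w d : adapted muB muC w ->
  is_rho muC (fun a => w (a ** d)) (rh (Cl muC w) d).
Proof.
move=> hw.
exact (is_rho_rh_form bw leB leC mu_e d (adapted_lin hw) (adapted_Cl bw hw)).
Qed.

Lemma adapted_mulr w d : adapted muB muC w -> adapted muB muC (fun a => w (a ** d)).
Proof.
move=> hw; have lw := adapted_lin hw.
split=> [k a b|]; first by rewrite qmulDl lw.
split.
- exists (fun a => Bl muB w (a ** d)) => a; have [Ba Ea] := adapted_Bl bw hw (a ** d).
  by split=> // x Bx; rewrite -Ea // multl_mul //; qmem.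
- by exists (Br_of eC (Bl muB w) d); exact (is_Br_of bw leB leC mu_e d lw (adapted_Bl bw hw)).
- exists (fun a => Cl muC w (a ** d)) => a; have [Ba Ea] := adapted_Cl bw hw (a ** d).
  by split=> // x Bx; rewrite -Ea // multl_mul //; qmem.
- by exists (Cr_of eC (Cl muC w) d); exact (is_Cr_of bw leB leC mu_e d lw (adapted_Cl bw hw)).
Qed.

End Convolution.

(** * The dual algebra and its actions on [A] *)

Section Measured.
Context (K : fieldType) (A : measured_hopf_algebroid K).
Implicit Types (a b c d e p q u v : A) (x y z : dcent A) (w : A -> K^o) (t : tens_l A) (f : A -> dcent A).
Local Notation B := (qg_B A).
Local Notation C := (qg_C A).
Local Notation bw := (mh_base_weight A).
Local Notation phi := (@phi K A).
Local Notation psi := (@psi K A).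
Local Notation muB := (@mu_B K A).
Local Notation muC := (@mu_C K A).
Local Notation Blphi := (Bl muB phi).
Local Notation Brphi := (Br muB phi).
Local Notation Clphi := (Cl muC phi).
Local Notation Crphi := (Cr muC phi).
Local Notation Blpsi := (Bl muB psi).
Local Notation Brpsi := (Br muB psi).
Local Notation Clpsi := (Cl muC psi).
Local Notation Crpsi := (Cr muC psi).

Lemma phi_adapted : adapted muB muC phi. Proof. by case: (mh_left_integral A). Qed.
Lemma psi_adapted : adapted muB muC psi. Proof. by case: (mh_right_integral A). Qed.
Lemma phi_lin : linear phi. Proof. exact (adapted_lin phi_adapted). Qed.
Lemma psi_lin : linear psi. Proof. exact (adapted_lin psi_adapted). Qed.
Lemma phi_Bl : is_Bl muB phi Blphi. Proof. exact (adapted_Bl bw phi_adapted). Qed.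
Lemma phi_Br : is_Br muB phi Brphi. Proof. exact (adapted_Br bw phi_adapted). Qed.
Lemma phi_Cl : is_Cl muC phi Clphi. Proof. exact (adapted_Cl bw phi_adapted). Qed.
Lemma phi_Cr : is_Cr muC phi Crphi. Proof. exact (adapted_Cr bw phi_adapted). Qed.
Lemma psi_Bl : is_Bl muB psi Blpsi. Proof. exact (adapted_Bl bw psi_adapted). Qed.
Lemma psi_Br : is_Br muB psi Brpsi. Proof. exact (adapted_Br bw psi_adapted). Qed.
Lemma psi_Cl : is_Cl muC psi Clpsi. Proof. exact (adapted_Cl bw psi_adapted). Qed.
Lemma Blphi_form : lBform Blphi. Proof. exact (is_Bl_form bw phi_lin phi_Bl). Qed.
Lemma Brphi_form : rBform Brphi. Proof. exact (is_Br_form bw phi_lin phi_Br). Qed.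
Lemma Clphi_form : lCform Clphi. Proof. exact (is_Cl_form bw phi_lin phi_Cl). Qed.
Lemma Crphi_form : rCform Crphi. Proof. exact (is_Cr_form bw phi_lin phi_Cr). Qed.
Lemma Blpsi_form : lBform Blpsi. Proof. exact (is_Bl_form bw psi_lin psi_Bl). Qed.
Lemma Brpsi_form : rBform Brpsi. Proof. exact (is_Br_form bw psi_lin psi_Br). Qed.
Lemma Clpsi_form : lCform Clpsi. Proof. exact (is_Cl_form bw psi_lin psi_Cl). Qed.
Lemma phi_invariant a b :
  tlift (fun p q => SBinv (Clphi q) *> p) (DBl A b a) = Clphi b *> a.
Proof. by case: (mh_left_integral A). Qed.

Lemma psi_invariant a b :
  tlift (fun p q => S_B (Blpsi p) *> q) (DBr A a b) = Blpsi a *> b.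
Proof. by case: (mh_right_integral A). Qed.

Lemma Blphi_onto x : B x -> exists a, Blphi a = x.
Proof. by case: (mh_full_left A) => <- _ [a _ <-]; exists a. Qed.
Lemma Brphi_onto x : B x -> exists a, Brphi a = x.
Proof. by case: (mh_full_left A) => _ <- [a _ <-]; exists a. Qed.
Lemma Clpsi_onto x : C x -> exists a, Clpsi a = x.
Proof. by case: (mh_full_right A) => <- _ [a _ <-]; exists a. Qed.

(** [DBl A (b y) a] equals [DBl A b (y a)], so invariance gives Clphi(b y) a = Clphi(b) y a. The
    identity with muC then follows on the elements y' a, which span [A]. *)
Lemma CrphiE : Crphi = Clphi.
Proof.
have ff := Clphi_form.
have Cr b y : C y -> Clphi (b <* y) = mulM (Clphi b) y.
  move=> Cy; apply: multl_inj => [||a]; [exact/multiplierC/(lC_in ff)|apply/multiplierC/qgC_mul => //; exact/(lC_in ff)|].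
  by rewrite -phi_invariant DBl_yr // phi_invariant.
apply: (Cr_E bw) => a; split; first exact: (lC_in ff).
move=> y Cy; move: a; apply: (span_ind (qg_CA A)) => [|a b Ea Eb|y' a Cy' _].
- have -> : Clphi 0 = 0 by exact: linear_at0 (lC_lin ff).
  rewrite (linear_at0 (multr_linear (multiplierC Cy))) (linear_at0 phi_lin).
  by rewrite (linear_at0 (mulM_linl (multiplierC Cy))) (lin_on0 (@subspaceC K A) (bw_linC bw)).
- rewrite (linear_add _ _ (multr_linear (multiplierC Cy))) (linear_add _ _ phi_lin) Ea Eb.
  rewrite (linear_add _ _ (lC_lin ff)) (linear_add _ _ (mulM_linl (multiplierC Cy))).
  rewrite -[mulM (Clphi a) y]scale1r (muCD bw) ?scale1r //; by apply/qgC_mul => //; exact: (lC_in ff).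
rewrite -multl_multr; [|qmem..].
by rewrite (phi_Cl _).2 // Cr // (lC_mod ff).
Qed.

Lemma BrpsiE : Brpsi = Blpsi.
Proof.
have ff := Blpsi_form.
have Cr b y : B y -> Blpsi (b <* y) = mulM (Blpsi b) y.
  move=> Cy; apply: multl_inj => [||a]; [exact/multiplierB/(lB_in ff)|apply/multiplierB/qgB_mul => //; exact/(lB_in ff)|].
  by rewrite -psi_invariant DBr_xr // psi_invariant.
apply: (Br_E bw) => a; split; first exact: (lB_in ff).
move=> y Cy; move: a; apply: (span_ind (qg_BA A)) => [|a b Ea Eb|y' a Cy' _].
- have -> : Blpsi 0 = 0 by exact: linear_at0 (lB_lin ff).
  rewrite (linear_at0 (multr_linear (multiplierB Cy))) (linear_at0 psi_lin).
  by rewrite (linear_at0 (mulM_linl (multiplierB Cy))) (lin_on0 (@subspaceB K A) (bw_linB bw)).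
- rewrite (linear_add _ _ (multr_linear (multiplierB Cy))) (linear_add _ _ psi_lin) Ea Eb.
  rewrite (linear_add _ _ (lB_lin ff)) (linear_add _ _ (mulM_linl (multiplierB Cy))).
  rewrite -[mulM (Blpsi a) y]scale1r (muBD bw) ?scale1r //; by apply/qgB_mul => //; exact: (lB_in ff).
rewrite -multl_multr; [|qmem..].
by rewrite (psi_Bl _).2 // Cr // (lB_mod ff).
Qed.

(* [conv t] is the functional b |-> (psi (x)_mu phi)(Delta_B(b) t). *)
Definition conv (t : tens_l A) b : K^o :=
  tlift (fun u v => phi (S_B (Blpsi u) *> v)) (DeltaB A b t).

Lemma bal_conv : bal_l A (fun u v => phi (S_B (Blpsi u) *> v)).
Proof. by apply: balanced_comp (balanced_SB Blpsi_form); exact: phi_lin. Qed.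

Lemma conv_lin : linear (fun t => conv t : A -> K^o).
Proof.
move=> k t t'; apply/funext => b.
by rewrite /conv DeltaB_end (tlift_lin bal_conv).
Qed.

Lemma conv_otimes d d' : conv (otimes d d') = (fun b => phi (lam Blpsi d b ** d')).
Proof.
apply/funext => b; rewrite /conv DeltaB_l; last exact: bal_conv.
rewrite /lam (tlift_comp (F := fun a => a ** d')); last exact: qmul_linl.
rewrite tlift_comp; last exact: phi_lin.
by apply: eq_tlift => u v; rewrite multl_mul //; apply/multiplierC/S_B_in/(lB_in Blpsi_form).
Qed.

(** Delta_B(b) sends [DBl A p q] to [DBl A (b p) q]. After [pairing], left invariance leaves
    psi(Clphi(b p) q) = muC(Clphi(b p) Clpsi(q)), and this is phi(b p Clpsi(q)) since phi has equal
    left and right [C]-maps. *)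
Lemma conv_DBl p q : conv (DBl A p q) = (fun b => phi (b ** (p <* Clpsi q))).
Proof.
have Cq := lC_in Clpsi_form q; have Cf b := lC_in Clphi_form b.
apply/funext => b; rewrite /conv -DBl_mul.
rewrite (@eq_tlift _ _ _ _ _ _ _ _ _ (fun u v => psi (SBinv (Clphi v) *> u))); last first.
  by move=> u v; rewrite (pairing bw _ _ psi_Bl phi_Cl).
rewrite -tlift_comp ?phi_invariant; last exact: psi_lin.
rewrite (psi_Cl _).2 // -CrphiE -(phi_Cr _).2 //.
by rewrite multr_mul //; qmem.
Qed.

Lemma conv_DBr p q : conv (DBr A p q) = (fun b => psi (b ** (p <* Blphi q))).
Proof.
have Bq := lB_in Blphi_form q; have Bf b := lB_in Blpsi_form b.
apply/funext => b; rewrite /conv -DBr_mul -tlift_comp ?psi_invariant; last exact: phi_lin.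
rewrite (phi_Bl _).2 // -BrpsiE -(psi_Br _).2 //.
by rewrite multr_mul //; qmem.
Qed.

Lemma conv_phi t : exists a, conv t = (fun b => phi (b ** a)).
Proof.
have [s ->] := DBl_span (mh_regular A) t.
exists (\sum_(p <- s) (p.2 <* Clpsi p.1)); rewrite (linear_bigsum _ _ conv_lin).
apply/funext => b; rewrite fct_sumE (linear_bigsum _ _ (qmul_linr b)) (linear_bigsum _ _ phi_lin).
by apply: eq_bigr => p _; rewrite conv_DBl.
Qed.

Lemma conv_psi t : exists a, conv t = (fun b => psi (b ** a)).
Proof.
have [s ->] := DBr_span (mh_regular A) t.
exists (\sum_(p <- s) (p.1 <* Blphi p.2)); rewrite (linear_bigsum _ _ conv_lin).
apply/funext => b; rewrite fct_sumE (linear_bigsum _ _ (qmul_linr b)) (linear_bigsum _ _ psi_lin).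
by apply: eq_bigr => p _; rewrite conv_DBr.
Qed.

(** Fullness of psi enters here: [A] = [AC], and each y in [C] is Clpsi(q), so that phi(. a y) is
    [conv] of [DBl A a q]. *)
Lemma phi_conv a : exists t, (fun b => phi (b ** a)) = conv t.
Proof.
move: a; apply: (span_ind (qg_AC A)) => [|a a' [t E] [t' E']|a y _ Cy].
- exists 0; rewrite (linear_at0 conv_lin); apply/funext => b.
  by rewrite (linear_at0 (qmul_linr b)) (linear_at0 phi_lin).
- exists (t + t'); rewrite (linear_add _ _ conv_lin) -E -E'; apply/funext => b.
  by rewrite (linear_add _ _ (qmul_linr b)) (linear_add _ _ phi_lin).
- have [q <-] := Clpsi_onto Cy; exists (DBl A a q); by rewrite conv_DBl.
Qed.

Lemma psi_conv a : exists t, (fun b => psi (b ** a)) = conv t.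
Proof.
move: a; apply: (span_ind (qg_AB A)) => [|a a' [t E] [t' E']|a y _ Cy].
- exists 0; rewrite (linear_at0 conv_lin); apply/funext => b.
  by rewrite (linear_at0 (qmul_linr b)) (linear_at0 psi_lin).
- exists (t + t'); rewrite (linear_add _ _ conv_lin) -E -E'; apply/funext => b.
  by rewrite (linear_add _ _ (qmul_linr b)) (linear_add _ _ psi_lin).
- have [q <-] := Blphi_onto Cy; exists (DBr A a q); by rewrite conv_DBr.
Qed.

Lemma dual_psiP w : dual_alg A w <-> exists a, w = (fun b => psi (b ** a)).
Proof.
split=> -[a ->].
  by have [t ->] := phi_conv a; exact: conv_psi.
by have [t ->] := psi_conv a; exact: conv_phi.
Qed.

Lemma dual_mul_phi d : dual_alg A (fun b => phi (b ** d)). Proof. by exists d. Qed.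
Lemma dual_mul_psi d : dual_alg A (fun b => psi (b ** d)). Proof. by apply/dual_psiP; exists d. Qed.

(** Since phi is full, [CA] = [A] is spanned by the elements S_B(Blphi(u)) v, and u (x) v is a sum
    of elements [DBl]. *)
Lemma lam_span (S : A -> Prop) : S 0 -> (forall a b, S a -> S b -> S (a + b)) ->
  (forall d a, S (lam Blphi d a)) -> forall a, S a.
Proof.
move=> S0 SD Sl; have bl := balanced_SB Blphi_form.
apply: (span_ind (qg_CA A)) => // y v Cy _.
have [u Eu] := Blphi_onto (SBinv_in Cy); rewrite -(SBinvK Cy) -Eu.
have -> : S_B (Blphi u) *> v = tlift (fun u v => S_B (Blphi u) *> v) (otimes u v : tens_l A).
  by rewrite tliftE.
have [s ->] := DBl_span (mh_regular A) (otimes u v).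
rewrite (linear_bigsum _ _ (tlift_lin bl)); elim/big_ind: _ => // p _; exact: Sl.
Qed.

(** The form f is left general because two are used: Clpsi, and later the left [C]-module map of phi
    o S. *)
Lemma rh_span f : lCform f -> (forall y, C y -> exists a, f a = y) ->
  forall S : A -> Prop, S 0 -> (forall a b, S a -> S b -> S (a + b)) ->
  (forall d a, S (rh f d a)) -> forall a, S a.
Proof.
move=> ff f_onto S S0 SD Sl; have bl := balanced_SBinv ff.
apply: (span_ind (qg_BA A)) => // x u Bx _.
have [v Ev] := f_onto _ (S_B_in Bx); rewrite -(S_BK Bx) -Ev.
have -> : SBinv (f v) *> u = tlift (fun u v => SBinv (f v) *> u) (otimes u v : tens_l A).
  by rewrite tliftE.
have [s ->] := DBr_span (mh_regular A) (otimes u v).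
rewrite (linear_bigsum _ _ (tlift_lin bl)); elim/big_ind: _ => // p _; exact: Sl.
Qed.

Lemma dual_sep a b : (forall w, dual_alg A w -> w a = w b) -> a = b.
Proof.
move=> E; apply/eqP; rewrite -subr_eq0; apply/negPn/negP => ab0.
have [[c _ +] _] := mh_faithful_left (m := A) I ab0.
rewrite addrC -scaleN1r qmulDl phi_lin.
have := E _ (dual_mul_phi c) => /= ->.
by rewrite scaleN1r addNr eqxx.
Qed.

Context (eB eC : A -> dcent A).
Hypotheses (leB : left_counit eB) (leC : right_counit eC).
Hypothesis mu_e : forall a, muB (eB a) = muC (eC a).

Lemma dual_adapted : dual_alg A `<=` adapted_space A.
Proof. move=> _ [d ->]; exact: (adapted_mulr bw leB leC mu_e d phi_adapted). Qed.

Lemma lambda_phi d : lambda (fun b => phi (b ** d)) = lam Blphi d.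
Proof. exact/lambda_E/(is_lambda_lam bw leB leC mu_e d phi_adapted). Qed.
Lemma lambda_psi d : lambda (fun b => psi (b ** d)) = lam Blpsi d.
Proof. exact/lambda_E/(is_lambda_lam bw leB leC mu_e d psi_adapted). Qed.
Lemma rho_phi d : rho (fun b => phi (b ** d)) = rh Clphi d.
Proof. exact/rho_E/(is_rho_rh bw leB leC mu_e d phi_adapted). Qed.
Lemma rho_psi d : rho (fun b => psi (b ** d)) = rh Clpsi d.
Proof. exact/rho_E/(is_rho_rh bw leB leC mu_e d psi_adapted). Qed.

Lemma dual_is_conv w : dual_alg A w ->
  is_lambda muB w (lambda w) /\ is_rho muC w (rho w).
Proof.
move=> [d ->]; rewrite lambda_phi rho_phi.
by split; [exact: (is_lambda_lam bw leB leC mu_e d phi_adapted)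
          |exact: (is_rho_rh bw leB leC mu_e d phi_adapted)].
Qed.

Lemma lambda_rho w w' : dual_alg A w -> dual_alg A w' -> w \o rho w' = w' \o lambda w.
Proof.
move=> [d ->] [d' ->]; apply/funext => a; rewrite lambda_phi rho_phi /=.
by rewrite (conv_swap bw d d' a phi_lin phi_lin phi_Bl phi_Cl).
Qed.

(** Taking the first factor from A.psi and the second from A.phi puts the two integrals on the legs
    that [conv] expects. *)
Lemma conv_prod d d' :
  (fun b => psi (b ** d)) \o rho (fun b => phi (b ** d')) = conv (otimes d d').
Proof.
rewrite lambda_rho; [|exact: dual_mul_psi|exact: dual_mul_phi].
by rewrite lambda_psi conv_otimes.
Qed.

Lemma dual_prod w w' : dual_alg A w -> dual_alg A w' -> dual_alg A (w \o rho w').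
Proof.
by move=> /dual_psiP[d ->] [d' ->]; rewrite conv_prod; exact: conv_phi.
Qed.

Lemma rho_lambda_comm w w' a : dual_alg A w -> dual_alg A w' ->
  rho w (lambda w' a) = lambda w' (rho w a).
Proof.
move=> [d ->] [d' ->]; rewrite rho_phi lambda_phi.
by apply: lam_rh_comm; [exact: Blphi_form|exact: Clphi_form].
Qed.

(** Rewriting the outer product with lambda(w) gives w' o rho(w'') o lambda(w), so associativity
    amounts to the commutation of lambda(w) and rho(w''). *)
Lemma dual_prodA w w' w'' : dual_alg A w -> dual_alg A w' -> dual_alg A w'' ->
  w \o rho (w' \o rho w'') = (w \o rho w') \o rho w''.
Proof.
move=> h h' h''; rewrite (lambda_rho h (dual_prod h' h'')).
apply/funext => a /=; rewrite rho_lambda_comm //.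
by have /(congr1 (@^~ (rho w'' a))) /= := lambda_rho h h'.
Qed.

(** The equation u(w w') = (u w) w' evaluated at a is this identity under u, and the functionals u
    in the dual separate the points of [A]. *)
Lemma rho_prod w w' a : dual_alg A w -> dual_alg A w' ->
  rho (w \o rho w') a = rho w (rho w' a).
Proof.
move=> h h'; apply: dual_sep => u hu.
by have /(congr1 (@^~ a)) := dual_prodA hu h h'.
Qed.

Lemma lambda_prod w w' a : dual_alg A w -> dual_alg A w' ->
  lambda (w \o rho w') a = lambda w' (lambda w a).
Proof.
move=> h h'; apply: dual_sep => u hu.
have /(congr1 (@^~ a)) /= <- := lambda_rho (dual_prod h h') hu.
have /(congr1 (@^~ (lambda w a))) /= <- := lambda_rho h' hu.
rewrite rho_lambda_comm //.
by have /(congr1 (@^~ (rho u a))) /= := lambda_rho h h'.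
Qed.

Lemma dual_subspace : subspace (dual_alg A).
Proof.
split=> [|k _ _ [d ->] [d' ->]].
  by exists 0; apply/funext => b; rewrite (linear_at0 (qmul_linr b)) (linear_at0 phi_lin).
by exists (k *: d + d'); apply/funext => b; rewrite qmulDr phi_lin.
Qed.

Lemma rho_lin w : dual_alg A w -> linear (rho w).
Proof. by move=> [d ->]; rewrite rho_phi; apply: rh_lin; exact: Clphi_form. Qed.
Lemma lambda_lin w : dual_alg A w -> linear (lambda w).
Proof. by move=> [d ->]; rewrite lambda_phi; apply: lam_lin; exact: Blphi_form. Qed.

Lemma rho_linw a : linear_on (dual_alg A) (fun w => rho w a).
Proof.
move=> k _ _ [d ->] [d' ->].
have -> : k *: (fun b => phi (b ** d)) + (fun b => phi (b ** d')) =
    (fun b => phi (b ** (k *: d + d'))).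
  by apply/funext => b; rewrite qmulDr phi_lin.
by rewrite !rho_phi rh_lind //; exact: Clphi_form.
Qed.

Lemma lambda_linw a : linear_on (dual_alg A) (fun w => lambda w a).
Proof.
move=> k _ _ [d ->] [d' ->].
have -> : k *: (fun b => phi (b ** d)) + (fun b => phi (b ** d')) =
    (fun b => phi (b ** (k *: d + d'))).
  by apply/funext => b; rewrite qmulDr phi_lin.
by rewrite !lambda_phi lam_lind //; exact: Blphi_form.
Qed.

Lemma lambda_span (S : A -> Prop) : S 0 -> (forall a b, S a -> S b -> S (a + b)) ->
  (forall w a, dual_alg A w -> S (lambda w a)) -> forall a, S a.
Proof.
move=> S0 SD Sl; apply: lam_span => // d a.
by rewrite -lambda_phi; exact/Sl/dual_mul_phi.
Qed.

Lemma rho_span (S : A -> Prop) : S 0 -> (forall a b, S a -> S b -> S (a + b)) ->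
  (forall w a, dual_alg A w -> S (rho w a)) -> forall a, S a.
Proof.
move=> S0 SD Sl; apply: (rh_span Clpsi_form (@Clpsi_onto)) => // d a.
by rewrite -rho_psi; exact/Sl/dual_mul_psi.
Qed.

(** Each phi(. a) is [conv t]; writing t as a sum of elementary tensors writes it as a sum of
    products. *)
Lemma dual_idempotent : idempotent_algebra (dual_alg A) (fun w w' => w \o rho w').
Proof.
apply/seteqP; split=> [_ [s [sP ->]]|_ [a ->]].
  by apply: (subspace_sum dual_subspace) => p /sP[]; exact: dual_prod.
have [t ->] := phi_conv a.
have [S0 SD Sm] := span_prodP (dual_alg A) (dual_alg A) (fun w w' : A -> K^o => (w \o rho w' : A -> K^o)).
rewrite (otimes_sum t) (linear_bigsum _ _ conv_lin).
elim/big_ind: _ => // p _; rewrite -conv_prod.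
by apply: Sm; [exact: dual_mul_psi|exact: dual_mul_phi].
Qed.

Lemma rho_span0 w : linear w -> (forall w', dual_alg A w' -> w \o rho w' = 0) -> w = 0.
Proof.
move=> lw E; apply/funext; apply: rho_span => [|a b /= Ea Eb|w' a hw'].
- exact: linear_at0.
- by rewrite linear_add // Ea Eb addr0.
- by have /(congr1 (@^~ a)) := E _ hw'.
Qed.

Lemma lambda_span0 w : linear w -> (forall w', dual_alg A w' -> w \o lambda w' = 0) -> w = 0.
Proof.
move=> lw E; apply/funext; apply: lambda_span => [|a b /= Ea Eb|w' a hw'].
- exact: linear_at0.
- by rewrite linear_add // Ea Eb addr0.
- by have /(congr1 (@^~ a)) := E _ hw'.
Qed.

Lemma dual_lin w : dual_alg A w -> linear w.
Proof. by move=> /dual_adapted; exact: adapted_lin. Qed.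

Lemma rho_nz w : linear w -> w != 0 -> exists2 w', dual_alg A w' & w \o rho w' != 0.
Proof.
move=> lw w0; apply: contrapT => h; move/eqP: w0; apply.
apply: rho_span0 => // w' hw'; apply: contrapT => /eqP ww'; apply: h.
by exists w'.
Qed.

Lemma lambda_nz w : linear w -> w != 0 -> exists2 w', dual_alg A w' & w \o lambda w' != 0.
Proof.
move=> lw w0; apply: contrapT => h; move/eqP: w0; apply.
apply: lambda_span0 => // w' hw'; apply: contrapT => /eqP ww'; apply: h.
by exists w'.
Qed.

Lemma dual_nondegenerate : nondegenerate_algebra (dual_alg A) (fun w w' => w \o rho w').
Proof.
move=> w hw w0; split; first exact/rho_nz/w0/dual_lin.
have [w' hw' +] := lambda_nz (dual_lin hw) w0.
by rewrite -lambda_rho //; exists w'.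
Qed.

(** If rho(w) vanished, then so would every product w' w, against non-degeneracy of the dual. *)
Lemma rho_act_nz w : dual_alg A w -> w != 0 -> exists a, rho w a != 0.
Proof.
move=> hw w0; apply: contrapT => h.
have [_ [w' hw' /eqP]] := dual_nondegenerate hw w0; apply; apply/funext => a /=.
have -> : rho w a = 0 by apply/eqP/negPn/negP => ra; apply: h; exists a.
exact: linear_at0 (dual_lin hw').
Qed.

Lemma lambda_act_nz w : dual_alg A w -> w != 0 -> exists a, lambda w a != 0.
Proof.
move=> hw w0; apply: contrapT => h.
have [[w' hw' /eqP +] _] := dual_nondegenerate hw w0; apply.
rewrite lambda_rho //; apply/funext => a /=.
have -> : lambda w a = 0 by apply/eqP/negPn/negP => ra; apply: h; exists a.
exact: linear_at0 (dual_lin hw').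
Qed.

Lemma dual_faithful_nz a : a != 0 -> exists2 w, dual_alg A w & w a != 0.
Proof.
move=> a0; have [[c _ h] _] := mh_faithful_left (m := A) I a0.
by exists (fun b => phi (b ** c)) => //; exact: dual_mul_phi.
Qed.

(** Some functional in the dual is nonzero at a, and by idempotence it is a sum of products. One
    product yields non-degeneracy of both actions, since w(rho(w')(a)) = w'(lambda(w)(a)). *)
Lemma dual_prod_nz a : a != 0 ->
  exists w w', [/\ dual_alg A w, dual_alg A w' & w (rho w' a) != 0].
Proof.
move=> /dual_faithful_nz[w hw]; have := hw; rewrite -{1}dual_idempotent => -[s [sP ->]].
move=> h; apply: contrapT => h'; move/eqP: h; apply.
rewrite fct_sumE big_seq big1 // => p /sP[h1 h2].
by apply/eqP/negPn/negP => h3; apply: h'; exists p.1, p.2.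
Qed.

Lemma rho_nondegenerate a : a != 0 -> exists2 w, dual_alg A w & rho w a != 0.
Proof.
move=> /dual_prod_nz[w [w' [hw hw' h]]]; exists w' => //.
by apply: contraNneq h => ->; rewrite (linear_at0 (dual_lin hw)).
Qed.

Lemma lambda_nondegenerate a : a != 0 -> exists2 w, dual_alg A w & lambda w a != 0.
Proof.
move=> /dual_prod_nz[w [w' [hw hw' h]]]; exists w => //.
apply: contraNneq h => h.
rewrite -[w _]/((w \o rho w') a) lambda_rho //= h (linear_at0 (dual_lin hw')) //.
Qed.

End Measured.

(** * The antipode from the inverse canonical maps *)

Section CanonicalInverses.
Context (K : fieldType) (A : multiplier_bialgebroid K).
Hypothesis reg : regular_hopf A.
Context (eB eC : A -> dcent A).
Hypotheses (leB : left_counit eB) (leC : right_counit eC).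
Implicit Types (a b c e : A).
Local Notation B := (qg_B A).
Local Notation C := (qg_C A).

Lemma bal_DBr : balanced B (fun x (a : A) => a <* x) (fun x (b : A) => x *> b)
  (fun a b => DBr A a b).
Proof.
split=> [w k u v|v k u w|x v w Bx] /=.
- exact: DBr_linl.
- exact: DBr_linr.
- exact: DBr_xr.
Qed.

Lemma bal_DCl : balanced C (fun y (a : A) => a <* y) (fun y (b : A) => y *> b)
  (fun a b => DCl A a b).
Proof.
split=> [w k u v|v k u w|x v w Bx] /=.
- exact: DCl_linl.
- exact: DCl_linr.
- by rewrite DCl_yl.
Qed.

Lemma inv_lin (U V : lmodType K) (f : U -> V) g : linear f -> cancel f g ->
  cancel g f -> linear g.
Proof. by move=> lf fK gK k u v; apply: (can_inj fK); rewrite lf !gK. Qed.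

(** The antipode identity sum S(u_1) u_2 v = S_C(eC(u)) v read as a definition: [T_rho] is
    invertible, and the right side respects the relations of its source [tens_B]. *)
Lemma kap_exists : exists kap : tens_l A -> A,
  linear kap /\ forall u v, kap (DBr A u v) = S_C (eC u) *> v.
Proof.
have lT : linear (T_rho (A := A)) := tlift_lin bal_DBr.
case: reg => _ [g gK Kg] _ _.
have bE : balanced B (fun x (a : A) => a <* x) (fun x (b : A) => x *> b)
    (fun u v => S_C (eC u) *> v).
  have eCr := rcounit_range leC.
  split=> [w k u v|v k u w|x v w Bx] /=.
  - by rewrite (rcounit_linear leC) S_CD.
  - by rewrite multlD //; qmem.
  - by rewrite -(SCinvK Bx) (rcounit_SC leC) ?S_CM //; qmem.
exists (fun t => tlift (fun u v => S_C (eC u) *> v) (g t)); split=> [k s t|u v].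
  by rewrite (inv_lin lT gK Kg) (tlift_lin bE).
have -> : DBr A u v = T_rho (otimes u v : tens_B A) by rewrite /T_rho (tliftE _ _ bal_DBr).
by rewrite gK (tliftE _ _ bE).
Qed.

(** Likewise from sum e p_1 S(p_2) = e S_B(eB(p)) and the inverse of [lambda_T]. *)
Lemma kapL_exists : exists kapL : tens_r A -> A,
  linear kapL /\ forall e p, kapL (DCl A e p) = e <* S_B (eB p).
Proof.
have lT : linear (lambda_T (A := A)) := tlift_lin bal_DCl.
case: reg => _ _ [g gK Kg] _.
have bE : balanced C (fun y (a : A) => a <* y) (fun y (b : A) => y *> b)
    (fun u v => u <* S_B (eB v)).
  have eBr := lcounit_range leB.
  split=> [w k u v|v k u w|x v w Bx] /=.
  - by rewrite multrD //; qmem.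
  - by rewrite (lcounit_linear leB) S_BD.
  - by rewrite -(SBinvK Bx) (lcounit_SB leB) ?S_BM //; qmem.
exists (fun t => tlift (fun u v => u <* S_B (eB v)) (g t)); split=> [k s t|u v].
  by rewrite (inv_lin lT gK Kg) (tlift_lin bE).
have -> : DCl A u v = lambda_T (otimes u v : tens_C A) by rewrite /lambda_T (tliftE _ _ bal_DCl).
by rewrite gK (tliftE _ _ bE).
Qed.

End CanonicalInverses.

(* With S the antipode, kap(x (x) e) is S(x) e and kapL(e (x) x) is e S(x). *)
Section Antipode.
Context (K : fieldType) (A : multiplier_bialgebroid K).
Hypothesis reg : regular_hopf A.
Context (eB eC : A -> dcent A).
Hypotheses (leB : left_counit eB) (leC : right_counit eC).
Context (kap : tens_l A -> A) (kapL : tens_r A -> A).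
Hypotheses (kap_lin : linear kap) (kapE : forall u v, kap (DBr A u v) = S_C (eC u) *> v).
Hypotheses (kapL_lin : linear kapL) (kapLE : forall e p, kapL (DCl A e p) = e <* S_B (eB p)).
Implicit Types (a b c e p q u v : A) (x y z : dcent A) (t : tens_l A) (r : tens_r A).
Local Notation B := (qg_B A).
Local Notation C := (qg_C A).
Let eCr := rcounit_range leC.
Let eBr := lcounit_range leB.

Lemma kapL_x r x : B x -> kapL (tmap id (fun q => x *> q) r) = kapL r <* S_B x.
Proof.
move=> Bx; have lx : linear (tmap id (fun q => x *> q) : tens_r A -> tens_r A).
  by apply: tmap_r_lin; qmem.
move: r; apply: (DCl_ext reg) => [k u v|k u v|e p].
- by rewrite lx kapL_lin.
- by rewrite kapL_lin multrD //; qmem.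
- by rewrite -DCl_xl // !kapLE (lcounit_B leB) // S_BM.
Qed.

Lemma kapL_y r y : C y -> kapL (tmap id (fun q => y *> q) r) = kapL r <* S_C y.
Proof.
move=> Cy; have lx : linear (tmap id (fun q => y *> q) : tens_r A -> tens_r A).
  by apply: tmap_r_lin; qmem.
move: r; apply: (DCl_ext reg) => [k u v|k u v|e p].
- by rewrite lx kapL_lin.
- by rewrite kapL_lin multrD //; qmem.
- by rewrite -DCl_SC // !kapLE multr_BC //; qmem.
Qed.

Lemma kap_x t x : B x -> kap (tmap (fun q => q <* x) id t) = S_B x *> kap t.
Proof.
move=> Bx; have lx : linear (tmap (fun q => q <* x) id : tens_l A -> tens_l A).
  by apply: tmap_l_lin; qmem.
move: t; apply: (DBr_ext reg) => [k u v|k u v|u v].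
- by rewrite lx kap_lin.
- by rewrite kap_lin multlD //; qmem.
- by rewrite -DBr_SB // !kapE multl_BC //; qmem.
Qed.

(** On t = [DBr A x e] this is the multiplicativity eC(u x) = eC(S_C(eC(u)) x) of the right
    counit. *)
Lemma kap_DeltaB t u : kap (DeltaB A u t) = kap (tmap id (fun q => S_C (eC u) *> q) t).
Proof.
have lx : linear (tmap id (fun q => S_C (eC u) *> q) : tens_l A -> tens_l A).
  by apply: tmap_l_lin; qmem.
move: t; apply: (DBr_ext reg) => [k s t|k s t|x e].
- by rewrite DeltaB_end kap_lin.
- by rewrite lx kap_lin.
- rewrite -DBr_mul -DBr_xl ?kapE; last qmem.
  by rewrite (rcounit_mul leC _ _).2.
Qed.

(** In terms of the antipode, S(p c0) q = S(c0) S(p) q, before S is available as a map on [A]. For t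
    = [DBr A u e] the left side is [kap] of Delta_B(u)(c0 (x) e), to which [kap_DeltaB] applies. *)
Lemma kap_mul t c0 : kap (tmap (fun p => p ** c0) id t) = kap (otimes c0 (kap t)).
Proof.
have lx : linear (tmap (fun p => p ** c0) id : tens_l A -> tens_l A).
  by apply: tmap_l_lin; qmem.
move: t; apply: (DBr_ext reg) => [k s t|k s t|u e].
- by rewrite lx kap_lin.
- by rewrite kap_lin (otimes_linr) kap_lin.
- by rewrite DBrE kap_DeltaB tmap_lE ?kapE //; qmem.
Qed.

Lemma kapL_otimes_x p u x : B x -> kapL (otimes p (x *> u)) = kapL (otimes p u) <* S_B x.
Proof. by move=> Bx; rewrite -kapL_x // tmap_rE //; qmem. Qed.

Lemma bal_kapL p : bal_l A (fun u v => kapL (otimes p u) ** v).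
Proof.
split=> [w k u v|v k u w|x v w Bx] /=.
- by rewrite otimes_linr kapL_lin qmulDl.
- by rewrite qmulDr.
- by rewrite kapL_otimes_x // mul_mult //; qmem.
Qed.

(* The two one-sided descriptions of the antipode by the inverses of the
   canonical maps agree: (e S(x)) f = e (S(x) f). *)
Lemma kap_kapL e u0 f : e ** kap (otimes u0 f) = kapL (otimes e u0) ** f.
Proof.
pose H c p q : A := tlift (fun u v => kapL (otimes p u) ** v) (DBr A q c).
have bH c : bal_r A (H c).
  split=> [w k u v|v k u w|y v w Cy] /=; rewrite /H.
  - rewrite /tlift scaler_sumr -big_split; apply: eq_bigr => i _ /=.
    by rewrite otimes_linl kapL_lin qmulDl.
  - by rewrite DBr_linl (tlift_lin (bal_kapL v)).
  - rewrite DBr_yr // (tlift_tmap _ _ _ (bal_kapL v)).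
    by apply: eq_tlift => u v'; rewrite otimes_r.
have bG c : bal_r A (fun p q => (p <* S_C (eC q)) ** c).
  exact: (balanced_comp (F := fun a => a ** c) (qmul_linl c) (bal_SCeC leC)).
(* This says p S(q_1) q_2 c = p S_C(eC(q)) c with the antipode taken from [kapL]. For p (x) q =
   [DCl A a b] both sides are a b c: the left by mixed coassociativity and the counit eB, the right
   by the counit eC. *)
have HE c p q : H c p q = (p <* S_C (eC q)) ** c.
  rewrite -(tliftE p q (bH c)) -(tliftE p q (bG c)).
  move: (otimes p q); apply: (DCl_ext reg); [exact: tlift_lin|exact: tlift_lin|].
  move=> a b.
  rewrite -(tlift_comp (F := fun a => a ** c)) ?(rcounit_r leC); last exact: qmul_linl.
  rewrite /H -mixed_rl_apply.
  - transitivity (tlift (fun p q => a ** (S_B (eB p) *> q)) (DBr A b c)).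
      apply: eq_tlift => p' q'.
      rewrite -(tlift_comp (F := fun a => a ** q')); last exact: qmul_linl.
      rewrite -(tlift_comp (F := kapL)) // tlift_id kapLE mul_mult //; qmem.
    by rewrite -(tlift_comp (F := fun q => a ** q)) ?(lcounit_l leB) ?qmulA //; exact: qmul_linr.
  - split=> [u v k p' q'|p' v k u u'|p' u k v v'] /=.
    + by rewrite otimes_linl kapL_lin qmulDl.
    + by rewrite otimes_linr kapL_lin qmulDl.
    + by rewrite qmulDr.
  - by move=> y p' u v Cy; rewrite otimes_r.
  - by move=> y p' u v Cy; rewrite kapL_otimes_x // mul_mult //; qmem.
have bl := bal_kapL e.
rewrite -(tliftE u0 f bl); apply/esym; move: (otimes u0 f).
apply: (DBr_ext reg) => [|k s t|u c]; first exact: tlift_lin.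
  by rewrite kap_lin qmulDr.
by rewrite kapE -[LHS]/(H c e u) HE mul_mult //; qmem.
Qed.

Context (s : A -> A) (sE : forall v e, s v ** e = kap (otimes v e)).

Lemma mul_s e v : e ** s v = kapL (otimes e v).
Proof. by apply: qmul_injr => f; rewrite -kap_kapL -sE qmulA. Qed.

Lemma s_lin : linear s.
Proof.
by move=> k u v; apply: qmul_injr => e; rewrite qmulDl !sE otimes_linl kap_lin.
Qed.

Lemma s_mul u v : s (u ** v) = s v ** s u.
Proof.
apply: qmul_injr => e; rewrite -qmulA !sE -kap_mul tmap_lE //; qmem.
Qed.

Lemma s_xr u x : B x -> s (u <* x) = S_B x *> s u.
Proof.
move=> Bx; apply: qmul_injr => e; rewrite -multl_mul; last qmem.
rewrite !sE -kap_x // tmap_lE //; qmem.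
Qed.

Lemma s_yl u y : C y -> s (y *> u) = s u <* S_C y.
Proof.
move=> Cy; apply: qmul_injl => e; rewrite -multr_mul; last qmem.
rewrite !mul_s -kapL_y // tmap_rE //; qmem.
Qed.

End Antipode.

(** * Strong invariance, the inclusion of A.phi in phi.A, and adaptedness *)

Section Modular.
Context (K : fieldType) (A : measured_hopf_algebroid K).
Implicit Types (a b c d e g p q u v : A) (x y z : dcent A) (w : A -> K^o).
Implicit Types (t : tens_l A) (r : tens_r A) (f : A -> dcent A).
Local Notation B := (qg_B A).
Local Notation C := (qg_C A).
Local Notation bw := (mh_base_weight A).
Local Notation reg := (mh_regular A).
Local Notation phi := (@phi K A).
Local Notation psi := (@psi K A).
Local Notation muB := (@mu_B K A).
Local Notation muC := (@mu_C K A).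
Local Notation Blphi := (Bl muB phi).
Local Notation Brphi := (Br muB phi).
Local Notation Clphi := (Cl muC phi).
Local Notation Crphi := (Cr muC phi).
Local Notation Blpsi := (Bl muB psi).
Local Notation Brpsi := (Br muB psi).
Local Notation Clpsi := (Cl muC psi).
Context (eB eC : A -> dcent A).
Hypotheses (leB : left_counit eB) (leC : right_counit eC).
Hypothesis mu_e : forall a, muB (eB a) = muC (eC a).

Lemma pairingr w w' f (g : A -> dcent A) u v : is_Br muB w f -> is_Cr muC w' g ->
  w (u <* S_C (g v)) = w' (v <* SCinv (f u)).
Proof.
move=> hf hg; have [Bf Ef] := hf u; have [Cg Eg] := hg v.
rewrite Eg ?Ef; try qmem.
by rewrite -(muSC bw) ?S_CM ?SCinvK //; qmem.
Qed.

(** Fullness of psi concerns its [C]-maps only. On the spanning elements sum S_B(Blpsi(u)) v the map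
    Clpsi takes the value sum S_B(Blpsi(u)) Clpsi(v), which is S_B(Blpsi(sum SBinv(Clpsi(v)) u)). *)
Lemma Blpsi_onto x : B x -> exists a, Blpsi a = x.
Proof.
move=> Bx; have fB := lB_in (Blpsi_form A).
have [a Ea] := Clpsi_onto (S_B_in Bx).
suff [u Eu] : exists u, S_B (Blpsi u) = Clpsi a.
  by exists u; apply: (anti_inj (qg_SB A)) => //; rewrite Eu.
move: a {Ea}; apply: (lambda_span leB leC mu_e) => [|a b [u Eu] [v Ev]|w a /dual_psiP[d ->]].
- exists 0; rewrite (linear_at0 (lB_lin (Blpsi_form A))) (linear_at0 (lC_lin (Clpsi_form A))).
  exact: (lin_on0 (@subspaceB K A) (@S_B_linear_on K A)).
- exists (u + v); rewrite (linear_add _ _ (lB_lin (Blpsi_form A))) (linear_add _ _ (lC_lin (Clpsi_form A))) -Eu -Ev.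
  by rewrite -[Blpsi u]scale1r S_BD // !scale1r.
exists (tlift (fun u v => SBinv (Clpsi v) *> u) (DBl A a d)).
rewrite (lambda_psi leB leC mu_e) /lam (tlift_comp (F := Blpsi)); last exact: lB_lin (Blpsi_form A).
have Cv := lC_in (Clpsi_form A).
rewrite (tlift_comp (F := Clpsi)); last exact: lC_lin (Clpsi_form A).
rewrite (tlift_comp_on (@subspaceB K A) (F := S_B)) //; last exact: S_B_linear_on.
apply: eq_tlift => u v.
rewrite (lB_mod (Blpsi_form A)) ?(lC_mod (Clpsi_form A)) ?S_BM ?SBinvK //; qmem.
Qed.

(* lambda(psi(b .))(c), by means of Delta_C. *)
Definition lam_left b c : A := tlift (fun u v => v <* SCinv (Brpsi u)) (DCl A b c).

Lemma lam_left_linr b : linear (lam_left b).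
Proof. by move=> k u v; rewrite /lam_left DCl_linr (tlift_lin (balanced_SCinv (Brpsi_form A))). Qed.

Lemma lam_left_lBlin b : lBlin (lam_left b).
Proof.
split=> [|x c Bx]; first exact: lam_left_linr.
rewrite /lam_left DCl_xl // (tlift_tmap _ _ _ (balanced_SCinv (Brpsi_form A))).
rewrite (tlift_comp (F := fun q => x *> q)); last by apply/multl_linear; qmem.
apply: eq_tlift => u v; rewrite -multl_multr //; [qmem|].
exact/multiplierC/SCinv_in/(rB_in (Brpsi_form A)).
Qed.

Lemma lam_left_span (S : A -> Prop) : S 0 -> (forall a b, S a -> S b -> S (a + b)) ->
  (forall b c, S (lam_left b c)) -> forall a, S a.
Proof.
move=> S0 SD Sl; have bl := balanced_SCinv (Brpsi_form A).
apply: (span_ind (qg_AC A)) => // v y _ Cy.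
have [u Eu] := Blpsi_onto (S_C_in Cy); rewrite -(S_CK Cy) -Eu -BrpsiE.
have -> : v <* SCinv (Brpsi u) = tlift (fun u v => v <* SCinv (Brpsi u)) (otimes u v : tens_r A).
  by rewrite (tliftE _ _ bl).
have [s ->] := DCl_span reg (otimes u v).
rewrite (linear_bigsum _ _ (tlift_lin bl)); elim/big_ind: _ => // p _; exact: Sl.
Qed.

Lemma lam_left_eC b c : S_C (eC (lam_left b c)) = Brpsi (b ** c).
Proof.
have Bp := rB_in (Brpsi_form A); have Ce := rcounit_range leC.
rewrite /lam_left (tlift_comp (F := eC)); last exact: (rcounit_linear leC).
rewrite (tlift_comp_on (@subspaceC K A) (F := S_C)) //; last exact: S_C_linear_on.
rewrite -(rcounit_r leC) (tlift_comp (F := Brpsi)); last exact: rB_lin (Brpsi_form A).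
apply: eq_tlift => u v.
by rewrite (rcounit_C leC) ?S_CM ?SCinvK ?(rB_mod (Brpsi_form A)) //; qmem.
Qed.

Lemma rh_eB g c : S_B (eB (rh Clphi g c)) = Clphi (c ** g).
Proof.
have Cp := lC_in (Clphi_form A); have Be := lcounit_range leB.
rewrite /rh (tlift_comp (F := eB)); last exact: (lcounit_linear leB).
rewrite (tlift_comp_on (@subspaceB K A) (F := S_B)) //; last exact: S_B_linear_on.
rewrite -(lcounit_l leB) (tlift_comp (F := Clphi)); last exact: lC_lin (Clphi_form A).
apply: eq_tlift => u v.
by rewrite (lcounit_B leB) ?S_BM ?SBinvK ?(lC_mod (Clphi_form A)) //; qmem.
Qed.

(** The operator consumes the first leg of Delta_C(c), so by mixed coassociativity the remaining
    comultiplication passes through it. *)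
Lemma lam_left_DBr b c e : tmap (lam_left b) id (DBr A c e) = DBr A (lam_left b c) e :> tens_l A.
Proof.
have Bp := rB_in (Brpsi_form A).
pose H p u v : tens_l A := otimes (u <* SCinv (Brpsi p)) v.
transitivity (tlift (fun p q => tlift (fun u v => H u v q) (DCl A b p)) (DBr A c e)).
  apply: eq_tlift => p q; rewrite /lam_left.
  by rewrite (tlift_comp (F := fun p => otimes p q : tens_l A)) //; exact: otimes_linl.
rewrite mixed_rl_apply.
- rewrite /lam_left (tlift_comp (F := fun q => DBr A q e)); last exact: DBr_linl.
  by apply: eq_tlift => p q; rewrite DBr_yr //; qmem.
- split=> [u v k p p'|p v k u u'|p u k v v'] /=; rewrite /H.
  + by rewrite (rB_lin (Brpsi_form A)) SCinvD //; exact: otimes_linl.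
  + by rewrite multrD; [exact: otimes_linl|qmem].
  + exact: otimes_linr.
- move=> y p u v Cy; rewrite /H (rB_mod (Brpsi_form A)); last qmem.
  by rewrite SCinvM ?S_CK //; qmem.
- by move=> x p u v Bx; rewrite /H -multl_multr ?otimes_l //; qmem.
Qed.

Lemma rh_DCl g e c :
  tmap id (rh Clphi g) (DCl A e c) = DCl A e (rh Clphi g c) :> tens_r A.
Proof.
have Cp := lC_in (Clphi_form A).
pose H p u v : tens_r A := otimes p (SBinv (Clphi v) *> u).
transitivity (tlift (fun p q => tlift (fun u v => H p u v) (DBr A q g)) (DCl A e c)).
  apply: eq_tlift => p q; rewrite /rh.
  by rewrite (tlift_comp (F := fun q => otimes p q : tens_r A)) //; exact: otimes_linr.
rewrite -mixed_rl_apply.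
- rewrite /rh (tlift_comp (F := fun q => DCl A e q)); last exact: DCl_linr.
  by apply: eq_tlift => p q; rewrite DCl_xl //; qmem.
- split=> [u v k p p'|p v k u u'|p u k v v'] /=; rewrite /H.
  + exact: otimes_linl.
  + by rewrite multlD; [exact: otimes_linr|qmem].
  + by rewrite (lC_lin (Clphi_form A)) SBinvD //; exact: otimes_linr.
- by move=> y p u v Cy; rewrite /H multl_multr ?otimes_r //; qmem.
- move=> x p u v Bx; rewrite /H (lC_mod (Clphi_form A)); last qmem.
  by rewrite SBinvM ?S_BK //; qmem.
Qed.

Lemma psi_faithful a b : (forall d, psi (a ** d) = psi (b ** d)) -> a = b.
Proof.
move=> E; apply/eqP; rewrite -subr_eq0; apply/negPn/negP => ab0.
have [[c _ +] _] := mh_faithful_right (m := A) I ab0.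
by rewrite addrC -scaleN1r qmulDl psi_lin E scaleN1r addNr eqxx.
Qed.

(* The left invariance of phi, in terms of Delta_C. *)
Lemma phi_invariantC e a :
  tlift (fun u v => u <* S_C (Crphi v)) (DCl A e a) = e <* Clphi a.
Proof.
(* Testing against psi(. d) brings in the functional psi(e . d), whose operator lambda has a Delta_C
   and a Delta_B description; invariance is known for the latter. *)
apply: psi_faithful => d.
have pl : linear (fun b => psi (b ** d)) by move=> k u v; rewrite /= qmulDl psi_lin.
have pel : linear (fun b => psi (e ** b)) by move=> k u v; rewrite /= qmulDr psi_lin.
have hr := is_Br_of bw leB leC mu_e d (@psi_lin K A) (@psi_Bl K A).
have hl := is_Bl_of bw leB leC mu_e e (@psi_lin K A) (@psi_Br K A).
have fr := is_Br_form bw pl hr; have fl := is_Bl_form bw pel hl.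
have hlr := is_Br_of bw leB leC mu_e d pel hl.
set g := Br_of eC Blpsi d in hr fr; set f := Bl_of eB Brpsi e in hl fl hlr.
rewrite -[LHS]/((fun b => psi (b ** d)) _) tlift_comp //.
under eq_tlift => u v do rewrite (pairingr _ _ hr (@phi_Cr K A)).
rewrite -tlift_comp; last exact: phi_lin.
(* Both sides are lambda(psi(e . d))(a); the right [B]-module maps used in the two descriptions
   agree by faithfulness of muB. *)
have -> : tlift (fun u v => v <* SCinv (g u)) (DCl A e a) = lam f d a.
  apply: qmul_injl => c; rewrite (lam_mull leC) //.
  rewrite (tlift_comp (F := fun q => c ** q)); last exact: qmul_linr.
  have E u v : c ** (v <* SCinv (g u)) = (c ** v) <* SCinv (g u).
    by rewrite multr_mul //; exact/multiplierC/SCinv_in/(rB_in fr).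
  under eq_tlift => u v do rewrite E.
  rewrite (DC_swap _ _ _ _ (balanced_SCinv fr)); apply: eq_tlift => u v.
  congr (_ <* SCinv _); apply: (muB_injr bw); [exact: (rB_in fr)|exact: (hlr u).1|].
  move=> x Bx; rewrite -(hr _).2 // -(hlr _).2 //.
  by rewrite multr_mul ?qmulA //; qmem.
rewrite /lam tlift_comp; last exact: phi_lin.
under eq_tlift => u v do rewrite (pairing bw _ _ hl (@phi_Cl K A)).
rewrite -(tlift_comp (F := fun b => psi (e ** b))) // phi_invariant mul_mult //.
exact/multiplierC/(lC_in (Clphi_form A)).
Qed.

Section WithAntipode.
Context (kap : tens_l A -> A) (kapL : tens_r A -> A).
Hypotheses (kap_lin : linear kap) (kapE : forall u v, kap (DBr A u v) = S_C (eC u) *> v).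
Hypotheses (kapL_lin : linear kapL) (kapLE : forall e p, kapL (DCl A e p) = e <* S_B (eB p)).

Lemma bal_Blpsi : bal_l A (fun u v => S_B (Blpsi u) *> v).
Proof. exact: balanced_SB (Blpsi_form A). Qed.

(** Strong invariance of psi: S(lambda(psi(b .))(c)) = lambda(psi(. c))(b). When c (x) e is replaced
    by [DBr A u v], both sides become Blpsi(b u) v, by the counit on the left and by right
    invariance on the right. *)
Lemma kap_lam_left b c e : kap (otimes (lam_left b c) e) = lam Blpsi c b ** e.
Proof.
have lx : linear (tmap (lam_left b) id : tens_l A -> tens_l A).
  by apply: tmap_l_lin; [exact: lam_left_lBlin|qmem].
have -> : lam Blpsi c b ** e = tlift (fun u v => S_B (Blpsi u) *> v) (DeltaB A b (otimes c e)).
  rewrite (DeltaB_l _ _ _ _ bal_Blpsi) /lam.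
  rewrite (tlift_comp (F := fun a => a ** e)); last exact: qmul_linl.
  by apply: eq_tlift => u v; rewrite multl_mul //; apply/multiplierC/S_B_in/(lB_in (Blpsi_form A)).
have -> : (otimes (lam_left b c) e : tens_l A) = tmap (lam_left b) id (otimes c e : tens_l A).
  by rewrite tmap_lE //; exact: lam_left_lBlin.
move: (otimes c e); apply: (DBr_ext reg) => [k s t|k s t|u v].
- by rewrite lx kap_lin.
- by rewrite DeltaB_end (tlift_lin bal_Blpsi).
by rewrite lam_left_DBr kapE lam_left_eC -DBr_mul psi_invariant BrpsiE.
Qed.

(* rho(phi(a .))(b). *)
Definition rh_left a b : A := tlift (fun u v => u <* S_C (Crphi v)) (DCr A a b).

(** Strong invariance of phi: S(rho(phi(. g))(c)) = rho(phi(c .))(g). It rests on the left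
    invariance in terms of Delta_C. *)
Lemma kapL_rh e c g : kapL (otimes e (rh Clphi g c)) = e ** rh_left c g.
Proof.
have bl := balanced_SC (Crphi_form A).
have rl : rClin (rh Clphi g).
  by split=> [|y a Cy]; [exact/rh_lin/(Clphi_form A)|exact/rh_yr/Cy/(Clphi_form A)].
have lx : linear (tmap id (rh Clphi g) : tens_r A -> tens_r A).
  by apply: tmap_r_lin; [qmem|].
have -> : e ** rh_left c g = tlift (fun u v => u <* S_C (Crphi v)) (DeltaC A g (otimes e c)).
  rewrite -DCrE (tlift_tmap _ _ _ bl) /rh_left.
  rewrite (tlift_comp (F := fun a => e ** a)); last exact: qmul_linr.
  by apply: eq_tlift => u v; rewrite multr_mul //; apply/multiplierB/S_C_in/(rC_in (Crphi_form A)).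
have -> : (otimes e (rh Clphi g c) : tens_r A) = tmap id (rh Clphi g) (otimes e c : tens_r A).
  by rewrite tmap_rE //; qmem.
move: (otimes e c); apply: (DCl_ext reg) => [k s t|k s t|u v].
- by rewrite lx kapL_lin.
- by rewrite DeltaC_end (tlift_lin bl).
by rewrite rh_DCl kapLE rh_eB -DCl_mul phi_invariantC.
Qed.

(** On the spanning elements [lam_left b c] the map [kap] is left multiplication by the element
    [lam Blpsi c b], so S takes its values in [A] itself. *)
Lemma antipode_exists : exists s : A -> A, forall v e, s v ** e = kap (otimes v e).
Proof.
suff h v : exists a, forall e, a ** e = kap (otimes v e).
  have [s sE] := choice h; by exists s.
move: v; apply: lam_left_span => [|u v [a Ea] [b Eb]|b c].
- exists 0 => e; rewrite (linear_at0 (qmul_linl e)).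
  by rewrite (linear_at0 (otimes_linl _ _ _ e)) linear_at0.
- exists (a + b) => e; rewrite (linear_add _ _ (qmul_linl e)) Ea Eb.
  by rewrite (linear_add _ _ (otimes_linl _ _ _ e)) linear_add.
- by exists (lam Blpsi c b) => e; rewrite kap_lam_left.
Qed.

Context (s : A -> A) (sE : forall v e, s v ** e = kap (otimes v e)).

Let s_linear : linear s := s_lin kap_lin sE.
Let sM u v : s (u ** v) = s v ** s u := s_mul reg leC kap_lin kapE sE u v.
Let s_right u x : B x -> s (u <* x) = S_B x *> s u.
Proof. exact: (s_xr reg leC kap_lin kapE sE). Qed.
Let s_left u y : C y -> s (y *> u) = s u <* S_C y.
Proof. exact: (s_yl reg leB leC kap_lin kapE kapL_lin kapLE sE). Qed.

Lemma s_lam_left b c : s (lam_left b c) = lam Blpsi c b.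
Proof. by apply: qmul_injr => e; rewrite sE kap_lam_left. Qed.

Lemma s_rh c g : s (rh Clphi g c) = rh_left c g.
Proof.
apply: qmul_injl => e.
by rewrite (mul_s reg leB leC kap_lin kapE kapL_lin kapLE sE) kapL_rh.
Qed.

Lemma s_onto a : exists v, s v = a.
Proof.
move: a; apply: (lambda_span leB leC mu_e) => [|a b [u <-] [v <-]|w a /dual_psiP[d ->]].
- by exists 0; rewrite linear_at0.
- by exists (u + v); rewrite linear_add.
- by rewrite (lambda_psi leB leC mu_e); exists (lam_left a d); exact: s_lam_left.
Qed.

(** By strong invariance and anti-multiplicativity of S the left side is phi o S at lambda(psi(b
    .))(c) c0. The functional phi o S has a left [C]-module map because S(y u) = S(u) S_C(y), so
    [pairingr] trades lambda(psi(b .)) for rho of (phi o S)(. c0), leaving b outside. *)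
Lemma phi_lam_psi c0 c b :
  phi (s c0 ** lam Blpsi c b) = psi (b ** rh (fun u => SCinv (Brphi (s u))) c0 c).
Proof.
have Bp a := rB_in (Brphi_form A) a.
pose th u : K^o := phi (s u).
have thl : linear th by move=> k u v; rewrite /th s_linear phi_lin.
have hth : is_Cl muC th (fun u => SCinv (Brphi (s u))).
  move=> u; split=> [|y Cy]; first qmem.
  rewrite /th s_left // (phi_Br _).2; last qmem.
  by rewrite -(muSC bw) ?S_CM ?SCinvK //; qmem.
have hr := is_Cr_of bw leB leC mu_e c0 thl hth.
rewrite -s_lam_left -sM -/(th _) -[LHS]/((fun a => th (a ** c0)) (lam_left b c)).
rewrite /lam_left (tlift_comp (F := fun a => th (a ** c0))); last by move=> k u v; rewrite /= qmulDl thl.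
under eq_tlift => u v do rewrite -(pairingr _ _ (@psi_Br K A) hr).
rewrite -tlift_comp; last exact: psi_lin.
by rewrite -(rh_mull leC _ _ _ (is_Cl_form bw thl hth)).
Qed.

(** With c = S(c'), pairing gives psi(rho(phi(a .))(b) S(c')), and strong invariance of phi makes
    this psi o S at c' rho(phi(. b))(a). Now b occurs only in the functional phi(. b), from which it
    can be pulled out. *)
Lemma phi_lam_phi a c : exists q, forall b, phi (a ** lam Blpsi c b) = phi (q ** b).
Proof.
have [c' <-] := s_onto c; have Cp u := lC_in (Clpsi_form A) u.
(* k is the right [B]-module map of psi o S, since S(p x) = S_B(x) S(p). *)
pose k p := SBinv (Clpsi (s p)).
exists (tlift (fun p q => q <* SCinv (k p)) (DCl A c' a)) => b.
have hr := is_Br_of bw leB leC mu_e (s c') (@psi_lin K A) (@psi_Bl K A).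
rewrite (lam_mull leC _ _ _ (Blpsi_form A)) tlift_comp; last exact: phi_lin.
under eq_tlift => u v do rewrite -(pairingr _ _ hr (@phi_Cr K A)).
rewrite -(tlift_comp (F := fun a => psi (a ** s c'))); last first.
  by move=> l u v; rewrite /= qmulDl psi_lin.
rewrite -/(rh_left a b) -s_rh -sM (rh_mull leC _ _ _ (Clphi_form A)).
have hc := is_Cr_of bw leB leC mu_e b (@phi_lin K A) (@phi_Cl K A).
have Cc q : C (Cr_of eC Clphi b q) := (hc q).1.
have Bk p : B (k p) by rewrite /k; qmem.
rewrite (tlift_comp (F := s)) // tlift_comp; last exact: psi_lin.
rewrite (tlift_comp (F := fun q => phi (q ** b))); last first.
  by move=> l u v; rewrite /= qmulDl phi_lin.
apply: eq_tlift => p q; rewrite s_right; last qmem.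
rewrite (psi_Cl _).2; last qmem.
have -> : Clpsi (s p) = S_B (k p) by rewrite SBinvK.
rewrite -S_BM ?(muSB bw); try qmem.
rewrite (hc q).2; last qmem.
by rewrite -(muSC bw) ?S_CM ?SCinvK //; qmem.
Qed.

(** The elements p supplied by [phi_lam_psi] span [A] by [rh_span], as the [C]-map of phi o S is
    onto: Brphi is onto [B] and S is onto [A]. *)
Lemma psi_phi p : exists q, forall b, psi (b ** p) = phi (q ** b).
Proof.
have Bp a := rB_in (Brphi_form A) a.
have ff : lCform (fun u => SCinv (Brphi (s u))).
  have thl : linear (fun u => phi (s u)) by move=> k u v; rewrite /= s_linear phi_lin.
  apply: (is_Cl_form bw thl) => u; split=> [|y Cy]; first qmem.
  rewrite s_left // (phi_Br _).2; last qmem.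
  by rewrite -(muSC bw) ?S_CM ?SCinvK //; qmem.
have f_onto y : C y -> exists a, SCinv (Brphi (s a)) = y.
  move=> Cy; have [a Ea] := Brphi_onto (S_C_in Cy); have [v Ev] := s_onto a.
  by exists v; rewrite Ev Ea S_CK.
move: p; apply: (rh_span ff f_onto) => [|p p' [q E] [q' E']|d a].
- exists 0 => b; rewrite (linear_at0 (qmul_linr b)) (linear_at0 (qmul_linl b)).
  by rewrite (linear_at0 (@phi_lin K A)) (linear_at0 (@psi_lin K A)).
- exists (q + q') => b; rewrite (linear_add _ _ (qmul_linr b)) (linear_add _ _ (qmul_linl b)).
  by rewrite (linear_add _ _ (@phi_lin K A)) (linear_add _ _ (@psi_lin K A)) E E'.
have [q Eq] := phi_lam_phi (s d) a; exists q => b.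
by rewrite -phi_lam_psi.
Qed.

End WithAntipode.

Lemma dual_left w : dual_alg A w -> exists q, w = (fun b => phi (q ** b)).
Proof.
move=> /dual_psiP[p ->].
have [kap [kap_lin kapE]] := kap_exists reg leC.
have [kapL [kapL_lin kapLE]] := kapL_exists reg leB.
have [s sE] := antipode_exists kap_lin kapE.
have [q Eq] := psi_phi kap_lin kapE kapL_lin kapLE sE p.
by exists q; apply/funext.
Qed.

(** The form phi(q .) lets q replace the test factor in Delta_C(a), which gives lambda(w)(a) itself
    and not only its products with other elements. *)
Lemma lambda_dual_left q w a : dual_alg A w -> w = (fun b => phi (q ** b)) ->
  lambda w a = tlift (fun u v => v <* SCinv (Brphi u)) (DCl A q a).
Proof.
move=> hw E; apply: qmul_injl => c.
have [hl _] := dual_is_conv leB leC mu_e hw; rewrite (hl _ _).2.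
rewrite (tlift_comp (F := fun a => c ** a)); last exact: qmul_linr.
have E' u v : c ** (v <* SCinv (Brphi u)) = (c ** v) <* SCinv (Brphi u).
  by rewrite multr_mul //; exact/multiplierC/SCinv_in/(rB_in (Brphi_form A)).
under [RHS]eq_tlift => u v do rewrite E'.
rewrite (DC_swap _ _ _ _ (balanced_SCinv (Brphi_form A))).
have -> // : Br muB w = (fun u => Brphi (q ** u)).
apply: (Br_E bw) => u; split=> [|x Bx]; first exact: (rB_in (Brphi_form A)).
by rewrite E -(phi_Br _).2 // multr_mul //; qmem.
Qed.

Lemma rho_dual_left q w a : dual_alg A w -> w = (fun b => phi (q ** b)) ->
  rho w a = tlift (fun u v => u <* S_C (Crphi v)) (DCr A q a).
Proof.
move=> hw E; apply: qmul_injl => c.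
have [_ hl] := dual_is_conv leB leC mu_e hw; rewrite (hl _ _).2.
rewrite (tlift_comp (F := fun a => c ** a)); last exact: qmul_linr.
have E' u v : c ** (u <* S_C (Crphi v)) = (c ** u) <* S_C (Crphi v).
  by rewrite multr_mul //; exact/multiplierB/S_C_in/(rC_in (Crphi_form A)).
under [RHS]eq_tlift => u v do rewrite E'.
rewrite -(DC_swap _ _ _ _ (balanced_SC (Crphi_form A))).
have -> // : Cr muC w = (fun u => Crphi (q ** u)).
apply: (Cr_E bw) => u; split=> [|x Bx]; first exact: (rC_in (Crphi_form A)).
by rewrite E -(phi_Cr _).2 // multr_mul //; qmem.
Qed.

Lemma adapted_lambda w w0 : dual_alg A w -> adapted_space A w0 ->
  adapted_space A (w0 \o lambda w).
Proof.
move=> hw hu; have lu := adapted_lin hu; have lw := lambda_lin leB leC mu_e hw.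
have uBl := adapted_Bl bw hu; have uBr := adapted_Br bw hu.
have uCl := adapted_Cl bw hu; have uCr := adapted_Cr bw hu.
have [d Ed] := hw; have [q Eq] := dual_left hw.
have El : lambda w = lam Blphi d by rewrite Ed (lambda_phi leB leC mu_e).
split=> [k a b|]; first by rewrite /= lw lu.
split.
- exists (fun a => Bl muB w0 (lambda w a)) => a; split=> [|x Bx]; first exact: (uBl _).1.
  by rewrite -(uBl _).2 //= El (lam_xl _ _ (Blphi_form A)).
- exists (fun a => Br muB w0 (lambda w a)) => a; split=> [|x Bx]; first exact: (uBr _).1.
  by rewrite -(uBr _).2 //= El (lam_xr _ _ (Blphi_form A)).
(* By [pairing], w0(lambda(w)(a)) is phi of this sum. The left action of y on a reaches only the
   first leg, now the argument of phi, so Clphi applies. *)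
- exists (fun a => Clphi (tlift (fun p v => SBinv (Cl muC w0 v) *> p) (DBl A a d))) => a.
  split=> [|y Cy]; first exact: (lC_in (Clphi_form A)).
  rewrite -(phi_Cl _).2 //= El /lam DBl_yl // (tlift_tmap _ _ _ (balanced_SB (Blphi_form A))).
  rewrite tlift_comp // (tlift_comp (F := fun p => phi (y *> p))); last first.
    by move=> k u v; rewrite /= multlD ?phi_lin //; qmem.
  apply: eq_tlift => u v; rewrite (pairing bw _ _ (@phi_Bl K A) uCl).
  by rewrite multl_BC //; apply/SBinv_in/(uCl _).1.
(* Here w = phi(q .) is essential: [DCl A q a] keeps the right side of the first leg free, so that
   the right action of y reaches the argument of phi. *)
- exists (fun a => Crphi (tlift (fun p v => p <* S_C (Cr muC w0 v)) (DCl A q a))) => a.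
  split=> [|y Cy]; first exact: (rC_in (Crphi_form A)).
  rewrite -(phi_Cr _).2 //= !(lambda_dual_left _ hw Eq) DCl_yr //.
  rewrite (tlift_tmap _ _ _ (balanced_SCinv (Brphi_form A))).
  rewrite tlift_comp // (tlift_comp (F := fun p => phi (p <* y))); last first.
    by move=> k u v; rewrite /= multrD ?phi_lin //; qmem.
  apply: eq_tlift => u v; rewrite -(pairingr _ _ (@phi_Br K A) uCr).
  by rewrite -(multr_BC _ (S_C_in (uCr v).1) Cy).
Qed.

Lemma adapted_rho w w0 : dual_alg A w -> adapted_space A w0 ->
  adapted_space A (w0 \o rho w).
Proof.
move=> hw hu; have lu := adapted_lin hu; have lw := rho_lin leB leC mu_e hw.
have uBl := adapted_Bl bw hu; have uBr := adapted_Br bw hu.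
have uCl := adapted_Cl bw hu; have uCr := adapted_Cr bw hu.
have [d Ed] := hw; have [q Eq] := dual_left hw.
have El : rho w = rh Clphi d by rewrite Ed (rho_phi leB leC mu_e).
split=> [k a b|]; first by rewrite /= lw lu.
split.
- exists (fun a => Blphi (tlift (fun p v => S_B (Bl muB w0 p) *> v) (DBr A a d))) => a.
  split=> [|x Bx]; first exact: (lB_in (Blphi_form A)).
  rewrite -(phi_Bl _).2 //= El /rh DBr_xl // (tlift_tmap _ _ _ (balanced_SBinv (Clphi_form A))).
  rewrite tlift_comp // (tlift_comp (F := fun p => phi (x *> p))); last first.
    by move=> k u v; rewrite /= multlD ?phi_lin //; qmem.
  apply: eq_tlift => u v; rewrite -(pairing bw _ _ uBl (@phi_Cl K A)).
  by rewrite (multl_BC _ Bx) //; apply/S_B_in/(uBl _).1.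
- exists (fun a => Brphi (tlift (fun p v => v <* SCinv (Br muB w0 p)) (DCr A q a))) => a.
  split=> [|x Bx]; first exact: (rB_in (Brphi_form A)).
  rewrite -(phi_Br _).2 //= !(rho_dual_left _ hw Eq) DCr_xr //.
  rewrite (tlift_tmap _ _ _ (balanced_SC (Crphi_form A))).
  rewrite tlift_comp // (tlift_comp (F := fun p => phi (p <* x))); last first.
    by move=> k u v; rewrite /= multrD ?phi_lin //; qmem.
  apply: eq_tlift => u v; rewrite (pairingr _ _ uBr (@phi_Cr K A)).
  by rewrite (multr_BC _ Bx) //; apply/SCinv_in/(uBr _).1.
- exists (fun a => Cl muC w0 (rho w a)) => a; split=> [|x Bx]; first exact: (uCl _).1.
  by rewrite -(uCl _).2 //= El (rh_yl _ _ (Clphi_form A)).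
- exists (fun a => Cr muC w0 (rho w a)) => a; split=> [|x Bx]; first exact: (uCr _).1.
  by rewrite -(uCr _).2 //= El (rh_yr _ _ (Clphi_form A)).
Qed.

End Modular.

(** * The space of adapted functionals, and the assembly of the theorem *)

Section AdaptedSubspace.
Context (K : fieldType) (A : multiplier_bialgebroid K).
Context (muB muC : dcent A -> K^o) (bw : base_weight muB muC).

Lemma adapted_subspace : subspace (adapted muB muC).
Proof.
split=> [|k w w' [lw [[f1 h1] [f2 h2] [f3 h3] [f4 h4]]] [lw' [[g1 k1] [g2 k2] [g3 k3] [g4 k4]]]].
  have z1 x : multiplier (@Defs.mul K A) x -> mulM x 0 = 0 :> dcent A.
    by move=> mx; exact: (linear_at0 (mulM_linr mx)).
  have z2 x : multiplier (@Defs.mul K A) x -> mulM 0 x = 0 :> dcent A.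
    by move=> mx; exact: (linear_at0 (mulM_linl mx)).
  have m1 : muB 0 = 0 := lin_on0 (subspaceB A) (bw_linB bw).
  have m2 : muC 0 = 0 := lin_on0 (subspaceC A) (bw_linC bw).
  split=> [k a b|]; first by rewrite scaler0 addr0.
  by split; exists (fun=> 0) => a; (split=> [|x hx]; first qmem); rewrite ?z1 ?z2 ?m1 ?m2 //; qmem.
split=> [l a b|].
  rewrite /= !fctE lw lw' !scalerDr !scalerA (mulrC k) -!addrA; congr (_ + _).
  by rewrite addrCA.
split.
- exists (fun a => k *: f1 a + g1 a) => a; split=> [|x Bx].
    by apply: qgB_lin; [exact: (h1 a).1|exact: (k1 a).1].
  rewrite !fctE (h1 a).2 // (k1 a).2 // mulM_linr ?(muBD bw) //; try qmem.
    by apply: qgB_mul => //; exact: (h1 a).1.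
  by apply: qgB_mul => //; exact: (k1 a).1.
- exists (fun a => k *: f2 a + g2 a) => a; split=> [|x Bx].
    by apply: qgB_lin; [exact: (h2 a).1|exact: (k2 a).1].
  rewrite !fctE (h2 a).2 // (k2 a).2 // mulM_linl ?(muBD bw) //; try qmem.
    by apply: qgB_mul => //; exact: (h2 a).1.
  by apply: qgB_mul => //; exact: (k2 a).1.
- exists (fun a => k *: f3 a + g3 a) => a; split=> [|x Bx].
    by apply: qgC_lin; [exact: (h3 a).1|exact: (k3 a).1].
  rewrite !fctE (h3 a).2 // (k3 a).2 // mulM_linr ?(muCD bw) //; try qmem.
    by apply: qgC_mul => //; exact: (h3 a).1.
  by apply: qgC_mul => //; exact: (k3 a).1.
- exists (fun a => k *: f4 a + g4 a) => a; split=> [|x Bx].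
    by apply: qgC_lin; [exact: (h4 a).1|exact: (k4 a).1].
  rewrite !fctE (h4 a).2 // (k4 a).2 // mulM_linl ?(muCD bw) //; try qmem.
    by apply: qgC_mul => //; exact: (h4 a).1.
  by apply: qgC_mul => //; exact: (k4 a).1.
Qed.

End AdaptedSubspace.

Theorem proposition4p1p2 (R : realType) (A : measured_hopf_algebroid R[i]) :
  let Ahat : set (A -> R[i]^o) := dual_alg A in
  let Adual : set (A -> R[i]^o) := adapted_space A in
  let prod (w w' : A -> R[i]^o) : A -> R[i]^o := w \o rho w' in
  let actl (w : A -> R[i]^o) (a : A) : A := rho w a in
  let actr (a : A) (w : A -> R[i]^o) : A := lambda w a in
  let dactl (w u : A -> R[i]^o) : A -> R[i]^o := u \o lambda w in
  let dactr (u w : A -> R[i]^o) : A -> R[i]^o := u \o rho w in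
  [/\ Ahat `<=` Adual,
      (forall w, Ahat w -> is_lambda mu_B w (lambda w) /\ is_rho mu_C w (rho w)),
      [/\ (forall w w', Ahat w -> Ahat w' -> prod w w' = w' \o lambda w),
          algebra_on Ahat prod,
          idempotent_algebra Ahat prod &
          nondegenerate_algebra Ahat prod],
      [/\ bimodule_on Ahat prod [set: A] actl actr,
          idempotent_bimodule Ahat [set: A] actl actr,
          nondegenerate_bimodule Ahat [set: A] actl actr &
          faithful_bimodule Ahat [set: A] actl actr] &
      [/\ bimodule_on Ahat prod Adual dactl dactr,
          nondegenerate_bimodule Ahat Adual dactl dactr &
          faithful_bimodule Ahat Adual dactl dactr]].
Proof.
move=> Ahat Adual prod actl actr dactl dactr.
have [eB [eC [leB leC mu_e]]] := bw_counit (mh_base_weight A).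
have sub : Ahat `<=` Adual := dual_adapted leB leC mu_e.
have hat_sub : subspace Ahat := dual_subspace A.
have prod_lambda w w' : Ahat w -> Ahat w' -> prod w w' = w' \o lambda w.
  exact: (lambda_rho leB leC mu_e).
have prod_in w w' : Ahat w -> Ahat w' -> Ahat (prod w w').
  exact: (dual_prod leB leC mu_e).
have hat_lin w : Ahat w -> linear w by move=> /sub; exact: adapted_lin.
have dual_sub : subspace Adual := adapted_subspace (mh_base_weight A).
have nondeg := dual_nondegenerate leB leC mu_e.
split=> //.
- exact: (dual_is_conv leB leC mu_e).
- split=> //; last exact: (dual_idempotent leB leC mu_e).
  split=> // [|w w' w'' h h' h'']; last exact: (dual_prodA leB leC mu_e).
  split=> [w hw k u v _ _ //|w hw k u v hu hv].
  (* Linearity in the second factor is visible only in the form w' o lambda(w) of the product. *)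
  by rewrite !prod_lambda //; case: hat_sub => _; exact.
- split.
  + split; [split=> //|split=> //|].
    * split=> [a _|w hw k a b _ _]; first exact: (rho_linw leB leC mu_e a).
      exact: (rho_lin leB leC mu_e hw).
    * by move=> w w' a h h' _; exact: (rho_prod leB leC mu_e).
    * split=> [w hw k a b _ _|a _]; last exact: (lambda_linw leB leC mu_e a).
      exact: (lambda_lin leB leC mu_e hw).
    * by move=> a w w' _ h h'; exact: (lambda_prod leB leC mu_e).
    * by move=> w a w' h _ h'; rewrite /actl /actr (rho_lambda_comm leB leC mu_e).
  + split; apply/seteqP; split=> // a _.
      have [S0 SD Sm] := span_prodP Ahat [set: A] actl.
      by apply: (rho_span leB leC mu_e) a => // w a hw; exact: Sm.
    have [S0 SD Sm] := span_prodP [set: A] Ahat actr.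
    by apply: (lambda_span leB leC mu_e) a => // w a hw; exact: Sm.
  + move=> a _ a0; split; first exact: (rho_nondegenerate leB leC mu_e).
    exact: (lambda_nondegenerate leB leC mu_e).
  + move=> w hw w0; split.
      by have [a] := rho_act_nz leB leC mu_e hw w0; exists a.
    by have [a] := lambda_act_nz leB leC mu_e hw w0; exists a.
- have dl w u : Ahat w -> Adual u -> Adual (dactl w u).
    exact: (adapted_lambda leB leC mu_e).
  have dr u w : Adual u -> Ahat w -> Adual (dactr u w).
    by move=> hu hw; exact: (adapted_rho leB leC mu_e).
  split.
  + split; [split=> //|split=> //|].
    * split=> [u hu k w w' hw hw'|w hw k u v _ _ //].
      apply/funext => a; rewrite /dactl /= (lambda_linw leB leC mu_e) //.
      exact: adapted_lin hu _ _ _.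
    * move=> w w' u h h' hu; apply/funext => a.
      by rewrite /dactl /= (lambda_prod leB leC mu_e).
    * split=> [w hw k u v _ _ //|u hu k w w' hw hw'].
      apply/funext => a; rewrite /dactr /= (rho_linw leB leC mu_e) //.
      exact: adapted_lin hu _ _ _.
    * move=> u w w' hu h h'; apply/funext => a.
      by rewrite /dactr /= (rho_prod leB leC mu_e).
    * move=> w u w' h hu h'; apply/funext => a.
      by rewrite /dactl /dactr /= (rho_lambda_comm leB leC mu_e).
  + move=> u hu u0; have lu := adapted_lin hu.
    by split; [exact: (lambda_nz leB leC mu_e)|exact: (rho_nz leB leC mu_e)].
  (* The dual lies in the adapted space and acts there by its own product, so non-degeneracy of the
     dual already provides the witnesses. *)
  + move=> w hw w0; have [[w1 h1 e1] [w2 h2 e2]] := nondeg w hw w0.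
    split; [exists w1; first exact: sub|exists w2; first exact: sub].
      by rewrite /dactl -prod_lambda.
    by [].
Qed.
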